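(* For every $q_0 \in [0,1)$ there exists $\beta = \beta(q_0) \in (0,1)$ with the following property. For every Borel set $E \subset \mathbb{R}$ with $\dim_H(E) > \beta$, there exist real numbers $0 < a_0 < a_1$ such that for every pair $(a,q) \in \mathbb{R}^2$ with $a_0 \le |a| \le a_1$ and $|q| \le q_0$, there exist $x, t \in \mathbb{R}$ with $t \neq 0$ such that $$\{x,\; x+t,\; x + a t^2 + q t\} \subset E.$$
   Context: $\dim_H$ denotes Hausdorff dimension. *)

(* Defs.v *)
From HB Require Import structures.
From mathcomp Require Export all_boot all_order all_algebra.
From mathcomp Require Export all_classical all_reals all_analysis.

Set Implicit Arguments.
Unset Strict Implicit.
Unset Printing Implicit Defensive.

Export Order.TTheory GRing.Theory Num.Theory.
Export numFieldNormedType.Exports.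

Local Open Scope classical_set_scope.
Local Open Scope ring_scope.
Local Open Scope ereal_scope.

Section Hausdorff.
Context {R : realType}.
Implicit Types (A U : set R) (s delta : R).

(* Adding 0 to the set of distances gives the empty set diameter 0 (the
   supremum of the empty set is -oo in \bar R); it changes nothing otherwise. *)
Definition diam U : \bar R :=
  ereal_sup (0 |` [set (`|x - y|%R)%:E | x in U & y in U]).

(* The empty set has weight 0 for every s. Since 0 `^ 0 = 1, a singleton has
   weight 1 for s = 0, so that the measure below is then the counting measure. *)
Definition diam_pow s U : \bar R := if U == set0 then 0 else diam U `^ s.

Definition delta_cover delta A (U : nat -> set R) :=
  (forall k, diam (U k) <= delta%:E) /\ A `<=` \bigcup_k U k.

Definition hausdorff_premeasure s delta A : \bar R :=
  ereal_inf [set \sum_(0 <= k <oo) diam_pow s (U k) | U in delta_cover delta A].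

Definition hausdorff_measure s A : \bar R :=
  ereal_sup [set hausdorff_premeasure s delta A | delta in [set d : R | (0 < d)%R]].

Definition hausdorff_dim A : \bar R :=
  ereal_inf [set s%:E | s in [set s : R | (0 <= s)%R /\ hausdorff_measure s A = 0]].

End Hausdorff.

(* Main.v *)
Require Import Defs.
From mathcomp Require Import ring lra zify.

(* Zooming into [E] changes [a] by a power of 2, so one may work at unit scale,
   where [E] has almost maximal dyadic content of exponent beta.  A capacity
   argument (Borel sets are Souslin, and the dyadic content is continuous along
   increasing sequences) provides a decreasing sequence of sets of almost maximal
   content whose closures intersect inside [E]; each of them carries discrete
   Frostman measures, with densities [F_k] at scale 2^-36k.  Put
     T(f, g, h) = average over x, y of f(x) g(y) h(x + a (y - x)^2 + q (y - x))
   and S_k = T(F_2k, F_2k, F_k).  At a fixed scale k0 the densities are bounded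
   below, hence so is S_k0.  The increments S_(k+1) - S_k decay geometrically:
   - if h oscillates at scale d, then T(f, g, h) gains a power of d.  Two uses of
     the Cauchy-Schwarz inequality bound it by an average of h(z11) h(z12) h(z21)
     h(z22) with zij = x_i + a (y_j - x_i)^2 + q (y_j - x_i), and curvature
     lets z22 move while the other three points are fixed;
   - if f or g oscillates at a scale much finer than that of h, then a summation
     by parts suffices.
   When beta is close to 1 this beats the growth of the densities, so S_K > 0 for
   all K, and a limit of approximate configurations lies in [E]. *)

Set Implicit Arguments.
Unset Strict Implicit.
Unset Printing Implicit Defensive.

Local Open Scope classical_set_scope.
Local Open Scope ring_scope.

(** * Finite sums *)

(** The exponent 36 is 4 * 9. With [u = 2 ^- (4 * k)], oscillation at scale [u ^+ 9] gains the
    fourth root of [u], which is [2 ^- k], because two uses of Cauchy-Schwarz leave a fourth power.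
    This gain is proved for the third slot only, which is why the first two slots carry level 2k:
    their increments live at the square of the scale of F_k, and the derivative that summation by
    parts puts on F_k costs only half, in exponent, of what the primitive gains. The three densities
    grow by [w ^+ 5] per step, with [w = kappa ^+ 36], while the gain is 1/2; the condition
    [kappa ^+ 180 <= 3 / 2] makes the ratio 3/4. The order of the choices matters: [k0] is fixed
    first, so that the whole geometric tail stays below the lower bound of S_k0; then [kappa] is
    taken so close to 1 that a Frostman measure of nearly full mass must give every dyadic cell up
    to level [72 * k0 + 1] at least half of its length. Content serves better than Hausdorff measure
    here: it is at most 1 on the unit interval, and near equality forces this uniformity. *)

Lemma sum_mul_split (V : nmodType) (N m : nat) (F : nat -> V) :
  \sum_(i < N * m) F i = \sum_(I < N) \sum_(i < m) F (I * m + i)%N.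
Proof.
rewrite -(big_mkord xpredT F) big_nat_mul big_mkord; apply: eq_bigr => I _.
rewrite -{1}[(I * m)%N]add0n big_addn mulSn addnK big_mkord.
by apply: eq_bigr => i _; rewrite addnC.
Qed.

Lemma sqr_sum_le (R : realDomainType) (I : finType) (a : I -> R) :
  (\sum_i a i) ^+ 2 <= #|I|%:R * \sum_i a i ^+ 2.
Proof.
have : 0 <= \sum_i \sum_j (a i - a j) ^+ 2.
  by apply: sumr_ge0 => i _; apply: sumr_ge0 => j _; rewrite sqr_ge0.
have -> : \sum_i \sum_j (a i - a j) ^+ 2 =
    \sum_i (#|I|%:R * a i ^+ 2 - 2 * a i * (\sum_j a j) + \sum_j a j ^+ 2).
  apply: eq_bigr => i _.
  under eq_bigr do rewrite sqrrB.
  rewrite big_split sumrB /= sumr_const -[_ *+ #|_|]mulr_natl; congr (_ - _ + _).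
  by rewrite mulr_sumr; apply: eq_bigr => j _; rewrite mulr2n; ring.
rewrite big_split sumrB /= sumr_const -mulr_natl -mulr_sumr.
rewrite -mulr_suml -mulr_sumr; nra.
Qed.

Lemma norm_sum_bound (R : realDomainType) (I : finType) (F : I -> R) (B : R) :
  (forall i, `|F i| <= B) -> `|\sum_i F i| <= #|I|%:R * B.
Proof.
move=> FB; apply: (le_trans (ler_norm_sum _ _ _)).
apply: (le_trans (ler_sum _ (fun i _ => FB i))).
by rewrite sumr_const mulr_natl.
Qed.

Lemma norm_sum_bound_ord (R : realDomainType) n (F : nat -> R) (B : R) :
  (forall i, (i < n)%N -> `|F i| <= B) -> `|\sum_(i < n) F i| <= n%:R * B.
Proof.
move=> FB; have := @norm_sum_bound R 'I_n F B (fun i => FB i (ltn_ord i)).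
by rewrite card_ord.
Qed.

Lemma norm_sum_bound_fin (R : realDomainType) n (F : 'I_n -> R) (B : R) :
  (forall i, `|F i| <= B) -> `|\sum_(i < n) F i| <= n%:R * B.
Proof. by move=> FB; have := norm_sum_bound FB; rewrite card_ord. Qed.

Lemma sqr_weighted_sum_le (R : realDomainType) n (f c : nat -> R) :
  (forall i, `|f i| <= 1) ->
  (\sum_(i < n) f i * c i) ^+ 2 <= n%:R * \sum_(i < n) c i ^+ 2.
Proof.
move=> f1; apply: (le_trans (@sqr_sum_le R _ (fun i : 'I_n => f i * c i))); rewrite card_ord.
rewrite ler_wpM2l// ler_sum// => i _; rewrite exprMn.
have : f i ^+ 2 <= 1 by rewrite -real_normK ?num_real// expr_le1.
by move=> ?; rewrite ler_piMl// sqr_ge0.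
Qed.

(* Two applications of the Cauchy-Schwarz inequality remove [f] and then [g]. *)
Lemma box_bound (R : realDomainType) n (f g : nat -> R) (D : nat -> nat -> R) :
  (forall i, `|f i| <= 1) -> (forall j, `|g j| <= 1) ->
  (\sum_(i < n) \sum_(j < n) f i * g j * D i j) ^+ 4 <=
  n%:R ^+ 4 * \sum_(i < n) \sum_(i' < n) \sum_(j < n) \sum_(j' < n)
     D i j * D i j' * D i' j * D i' j'.
Proof.
move=> f1 g1; set S := \sum_(i < n) _.
have S2 : S ^+ 2 <= n%:R * \sum_(i < n) (\sum_(j < n) g j * D i j) ^+ 2.
  rewrite /S; under eq_bigr do under eq_bigr do rewrite -mulrA.
  under eq_bigr do rewrite -mulr_sumr.
  exact: (@sqr_weighted_sum_le R n f (fun i => \sum_(j < n) g j * D i j)).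
pose K j j' := \sum_(i < n) D i j * D i j'.
have E1 : \sum_(i < n) (\sum_(j < n) g j * D i j) ^+ 2 =
    \sum_(j < n) g j * (\sum_(j' < n) g j' * K j j').
  transitivity (\sum_(i < n) \sum_(j < n) \sum_(j' < n)
      g j * (g j' * (D i j * D i j'))).
    apply: eq_bigr => i _; rewrite expr2 mulr_suml; apply: eq_bigr => j _.
    by rewrite mulr_sumr; apply: eq_bigr => j' _; ring.
  rewrite exchange_big /=; apply: eq_bigr => j _.
  rewrite exchange_big /= mulr_sumr; apply: eq_bigr => j' _.
  by rewrite /K !mulr_sumr.
have S3 : (\sum_(j < n) g j * (\sum_(j' < n) g j' * K j j')) ^+ 2 <=
   n%:R * \sum_(j < n) (n%:R * \sum_(j' < n) K j j' ^+ 2).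
  apply: (le_trans (@sqr_weighted_sum_le _ _ g (fun j => \sum_(j' < n) g j' * K j j') g1)).
  rewrite ler_wpM2l// ler_sum// => j _.
  exact: (@sqr_weighted_sum_le _ _ g (K j) g1).
have -> : \sum_(i < n) \sum_(i' < n) \sum_(j < n) \sum_(j' < n)
     D i j * D i j' * D i' j * D i' j' = \sum_(j < n) \sum_(j' < n) K j j' ^+ 2.
  under eq_bigr do rewrite exchange_big /=.
  rewrite exchange_big /=; apply: eq_bigr => j _.
  under eq_bigr do rewrite exchange_big /=.
  rewrite exchange_big /=; apply: eq_bigr => j' _.
  rewrite expr2 /K mulr_suml; apply: eq_bigr => i _.
  by rewrite mulr_sumr; apply: eq_bigr => i' _; ring.
have -> : S ^+ 4 = (S ^+ 2) ^+ 2 by rewrite -exprM.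
apply: (@le_trans _ _ ((n%:R * \sum_(j < n) g j * (\sum_(j' < n) g j' * K j j')) ^+ 2)).
  by rewrite ler_sqr ?nnegrE ?sqr_ge0 -?E1// (le_trans _ S2)// sqr_ge0.
rewrite exprMn (le_trans (ler_wpM2l _ S3)) ?sqr_ge0//.
rewrite -mulr_sumr; set T := \sum_(_ < _) _.
by rewrite le_eqVlt; apply/orP; left; apply/eqP; ring.
Qed.

Lemma sum_shift_nat (R : realDomainType) (F : nat -> R) (B : R) m k :
  (forall i, `|F i| <= B) ->
  `|\sum_(i < m) F (i + k)%N - \sum_(i < m) F i| <= 2 * k%:R * B.
Proof.
move=> F1; elim: k => [|k IH].
  by under eq_bigr do rewrite addn0; rewrite subrr normr0 mulr0 mul0r.
have -> : \sum_(i < m) F (i + k.+1)%N - \sum_(i < m) F i =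
    (\sum_(i < m) F (i + k)%N - \sum_(i < m) F i) + (F (m + k)%N - F k).
  have : \sum_(i < m.+1) F (i + k)%N = \sum_(i < m.+1) F (i + k)%N by [].
  rewrite {1}big_ord_recl big_ord_recr /= add0n.
  under eq_bigr do rewrite /bump /= add1n addSnnS.
  by move=> H; lra.
have := ler_normB (F (m + k)%N) (F k).
have := F1 (m + k)%N; have := F1 k.
have := ler_normD (\sum_(i < m) F (i + k)%N - \sum_(i < m) F i) (F (m + k)%N - F k).
by rewrite -natr1; lra.
Qed.

(** The integer part of the shift only exchanges boundary terms; the fractional part costs one
    Lipschitz increment per term. *)
Lemma sum_shift (R : realType) (F : R -> R) (B L : R) m (d : R) :
  (forall x, `|F x| <= B) -> (forall x y, `|F x - F y| <= L * `|x - y|) ->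
  `|\sum_(i < m) F (i%:R + d) - \sum_(i < m) F i%:R| <=
    2 * `|d| * B + m%:R * L.
Proof.
have main (G : R -> R) (c : R) : 0 <= c ->
    (forall x, `|G x| <= B) -> (forall x y, `|G x - G y| <= L * `|x - y|) ->
    `|\sum_(i < m) G (i%:R + c) - \sum_(i < m) G i%:R| <= 2 * c * B + m%:R * L.
  move=> c0 G1 GL; have L0 : 0 <= L.
    have := GL 0 1; rewrite sub0r normrN1 mulr1; exact: le_trans.
  have B0 : 0 <= B by apply: le_trans (G1 0).
  have /andP[kl ku] := truncn_itv c0; set k := Num.truncn c in kl ku.
  have H1 : `|\sum_(i < m) G (i%:R + c) - \sum_(i < m) G (i + k)%:R| <= m%:R * L.
    rewrite -sumrB; apply: (@norm_sum_bound_ord R m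
      (fun i => G (i%:R + c) - G (i + k)%:R)) => i _.
    apply: (le_trans (GL _ _)); rewrite ler_piMr// natrD.
    rewrite ler_norml; move: ku; rewrite -natr1; lra.
  have := @sum_shift_nat R (fun i => G i%:R) B m k (fun i => G1 _).
  set P := \sum_(i < m) _ in H1 *; set Q := \sum_(i < m) _ in H1 *.
  set C := \sum_(i < m) _ => H2.
  have -> : P - C = (P - Q) + (Q - C) by ring.
  rewrite (le_trans (ler_normD _ _))// addrC lerD// (le_trans H2)//.
  by rewrite ler_wpM2r// ler_wpM2l.
move=> F1 FL; have [d0|d0] := lerP 0 d.
  by apply: (le_trans (main F d d0 F1 FL)); rewrite ger0_norm.
have dN : 0 <= - d by lra.
have FdL x y : `|F (x + d) - F (y + d)| <= L * `|x - y|.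
  by apply: (le_trans (FL _ _)); rewrite opprD addrACA subrr addr0.
have := main (fun x => F (x + d)) (- d) dN (fun x => F1 _) FdL.
under eq_bigr do rewrite subrK.
by rewrite distrC (ltr0_norm d0).
Qed.

Lemma sum_shift_perturb (R : realType) (F H : R -> R) (B L E : R) m (d : R) :
  (forall x, `|F x| <= B) -> (forall x y, `|F x - F y| <= L * `|x - y|) ->
  (forall x, `|F x - H x| <= E) ->
  `|\sum_(i < m) F (i%:R + d) - \sum_(i < m) H i%:R| <=
    2 * `|d| * B + m%:R * L + m%:R * E.
Proof.
move=> FB FL FH.
have -> : \sum_(i < m) F (i%:R + d) - \sum_(i < m) H i%:R =
  (\sum_(i < m) F (i%:R + d) - \sum_(i < m) F i%:R) +
  \sum_(i < m) (F i%:R - H i%:R) by rewrite sumrB; ring.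
rewrite (le_trans (ler_normD _ _))// lerD//; first exact: sum_shift.
exact: (@norm_sum_bound_ord R m (fun i => F i%:R - H i%:R)).
Qed.

(** The sums are compared from the innermost outwards: inner sums are shifted in [F3], [F2], [F1]
    and unshifted in [H3], [H2], [H1], and each level adds one shift error. *)
Lemma sum_shift4 (R : realType) (W : R -> R -> R -> R -> R) (L A : R) m
    (d1 d2 d3 d4 : R) :
  (forall x x' y y', `|W x x' y y'| <= 1) ->
  (forall x1 x1' y1 y1' x2 x2' y2 y2', `|W x1 x1' y1 y1' - W x2 x2' y2 y2'| <=
     L * (`|x1 - x2| + `|x1' - x2'| + `|y1 - y2| + `|y1' - y2'|)) ->
  `|d1| <= A -> `|d2| <= A -> `|d3| <= A -> `|d4| <= A ->
  `|\sum_(i < m) \sum_(i' < m) \sum_(j < m) \sum_(j' < m)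
      W (i%:R + d1) (i'%:R + d2) (j%:R + d3) (j'%:R + d4) -
    \sum_(i < m) \sum_(i' < m) \sum_(j < m) \sum_(j' < m)
      W i%:R i'%:R j%:R j'%:R| <= 4 * m%:R ^+ 3 * (2 * A + m%:R * L).
Proof.
move=> W1 WL d1A d2A d3A d4A; set M := m%:R.
have M0 : 0 <= M by rewrite ler0n.
pose F3 x x' y := \sum_(j' < m) W x x' y (j'%:R + d4).
pose H3 x x' y := \sum_(j' < m) W x x' y j'%:R.
pose F2 x x' := \sum_(j < m) F3 x x' (j%:R + d3).
pose H2 x x' := \sum_(j < m) H3 x x' j%:R.
pose F1 x := \sum_(i' < m) F2 x (i'%:R + d2).
pose H1 x := \sum_(i' < m) H2 x i'%:R.
have F3B x x' y : `|F3 x x' y| <= M.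
  by rewrite -[M]mulr1; apply: (@norm_sum_bound_ord R m (fun j => W x x' y (j%:R + d4))).
have F2B x x' : `|F2 x x'| <= M * M.
  exact: (@norm_sum_bound_ord R m (fun j => F3 x x' (j%:R + d3))).
have F1B x : `|F1 x| <= M * (M * M).
  exact: (@norm_sum_bound_ord R m (fun j => F2 x (j%:R + d2))).
have F3L x1 x1' y1 x2 x2' y2 : `|F3 x1 x1' y1 - F3 x2 x2' y2| <=
    M * (L * (`|x1 - x2| + `|x1' - x2'| + `|y1 - y2|)).
  rewrite /F3 -sumrB; apply: (@norm_sum_bound_ord R m
    (fun j => W x1 x1' y1 (j%:R + d4) - W x2 x2' y2 (j%:R + d4))) => j _.
  by apply: (le_trans (WL _ _ _ _ _ _ _ _)); rewrite subrr normr0 addr0.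
have F2L x1 x1' x2 x2' : `|F2 x1 x1' - F2 x2 x2'| <=
    M * (M * (L * (`|x1 - x2| + `|x1' - x2'|))).
  rewrite /F2 -sumrB; apply: (@norm_sum_bound_ord R m
    (fun j => F3 x1 x1' (j%:R + d3) - F3 x2 x2' (j%:R + d3))) => j _.
  by apply: (le_trans (F3L _ _ _ _ _ _)); rewrite subrr normr0 addr0.
have F1L x1 x2 : `|F1 x1 - F1 x2| <= M * (M * (M * (L * `|x1 - x2|))).
  rewrite /F1 -sumrB; apply: (@norm_sum_bound_ord R m
    (fun j => F2 x1 (j%:R + d2) - F2 x2 (j%:R + d2))) => j _.
  by apply: (le_trans (F2L _ _ _ _)); rewrite subrr normr0 addr0.
have FH3 x x' y : `|F3 x x' y - H3 x x' y| <= 2 * A + M * L.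
  apply: (le_trans (@sum_shift R (W x x' y) 1 L m d4 _ _)) => //.
    move=> u v; apply: (le_trans (WL _ _ _ _ _ _ _ _)).
    by rewrite !subrr normr0 !add0r.
  by rewrite mulr1 lerD2r ler_wpM2l.
have FH2 x x' : `|F2 x x' - H2 x x'| <= 2 * M * (2 * A + M * L).
  apply: (le_trans (@sum_shift_perturb R (F3 x x') (H3 x x') M (M * L) _ m d3 _ _ (FH3 x x'))) => //.
    by move=> u v; apply: (le_trans (F3L _ _ _ _ _ _)); rewrite !subrr normr0 !add0r mulrA.
  by have := ler_wpM2r M0 d3A; rewrite -/M; lra.
have FH1 x : `|F1 x - H1 x| <= 3 * (M * M) * (2 * A + M * L).
  apply: (le_trans (@sum_shift_perturb R (F2 x) (H2 x) (M * M) (M * M * L) _ m d2 _ _ (FH2 x))) => //.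
    by move=> u v; apply: (le_trans (F2L _ _ _ _)); rewrite !subrr normr0 !add0r !mulrA.
  by have := ler_wpM2r (mulr_ge0 M0 M0) d2A; rewrite -/M; lra.
apply: (le_trans (@sum_shift_perturb R F1 H1 (M * (M * M)) (M * M * M * L) _ m d1 F1B _ FH1)).
  by move=> u v; apply: (le_trans (F1L _ _)); rewrite !mulrA.
by have := ler_wpM2r (mulr_ge0 M0 (mulr_ge0 M0 M0)) d1A; rewrite -/M; lra.
Qed.

(** [D] acts as the derivative of [G], so this Riemann sum telescopes to a difference of two values
    of [G], up to one Taylor error per step. Oscillation becomes cancellation here. *)
Lemma sum_progression (R : realType) (D G : R -> R) (B L2 : R) (c h : R) J :
  (forall x, `|G x| <= B) ->
  (forall x y, `|G (x + y) - G x - y * D x| <= L2 * y ^+ 2) ->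
  `|h * \sum_(t < J) D (c + t%:R * h)| <= 2 * B + J%:R * (L2 * h ^+ 2).
Proof.
move=> GB GL.
have H : h * \sum_(t < J) D (c + t%:R * h) = (G (c + J%:R * h) - G c) -
    \sum_(t < J) (G (c + t%:R * h + h) - G (c + t%:R * h) - h * D (c + t%:R * h)).
  elim: J => [|J IH]; first by rewrite !big_ord0 mul0r addr0 mulr0 subrr subr0.
  rewrite !big_ord_recr /= mulrDr IH -natr1 mulrDl mul1r addrA; ring.
rewrite H (le_trans (ler_normB _ _))// lerD//.
  by rewrite (le_trans (ler_normB _ _))//; have := GB (c + J%:R * h); have := GB c; lra.
exact: (@norm_sum_bound_ord R J (fun t => G (c + t%:R * h + h) - G (c + t%:R * h) - h * D (c + t%:R * h))).
Qed.

(** * The smoothing estimate *)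

Lemma prod4_dist (R : realDomainType) (a1 a2 a3 a4 b1 b2 b3 b4 : R) :
  `|a1| <= 1 -> `|a2| <= 1 -> `|a3| <= 1 ->
  `|b2| <= 1 -> `|b3| <= 1 -> `|b4| <= 1 ->
  `|a1 * a2 * a3 * a4 - b1 * b2 * b3 * b4| <=
     `|a1 - b1| + `|a2 - b2| + `|a3 - b3| + `|a4 - b4|.
Proof.
move=> A1 A2 A3 B2 B3 B4.
have -> : a1 * a2 * a3 * a4 - b1 * b2 * b3 * b4 =
  (a1 - b1) * (b2 * b3 * b4) + a1 * ((a2 - b2) * (b3 * b4)) +
  a1 * (a2 * ((a3 - b3) * b4)) + a1 * (a2 * (a3 * (a4 - b4))) by ring.
have P (x y : R) : `|x| <= 1 -> `|x * y| <= `|y|.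
  by move=> x1; rewrite normrM ler_piMl.
have P' (x y : R) : `|x| <= 1 -> `|y * x| <= `|y|.
  by move=> x1; rewrite normrM ler_piMr.
have PM (x y : R) : `|x| <= 1 -> `|y| <= 1 -> `|x * y| <= 1.
  by move=> ? ?; rewrite normrM mulr_ile1.
apply: (le_trans (ler_normD _ _)); apply: lerD; last first.
  by apply: (le_trans (P _ _ A1)); apply: (le_trans (P _ _ A2)); apply: P.
apply: (le_trans (ler_normD _ _)); apply: lerD; last first.
  by apply: (le_trans (P _ _ A1)); apply: (le_trans (P _ _ A2)); apply: P'.
apply: (le_trans (ler_normD _ _)); apply: lerD; last first.
  by apply: (le_trans (P _ _ A1)); apply: P'; rewrite PM.
by apply: P'; rewrite !PM.
Qed.

(* [D] is normalised and oscillates at scale [d]: it is the derivative of a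
   function [G] of size [d]. *)
Definition oscillating (R : realType) (d : R) (D G : R -> R) :=
  [/\ forall x, `|D x| <= 1,
      forall x y, `|D x - D y| <= d^-1 * `|x - y|,
      forall x, `|G x| <= d &
      forall x y, `|G (x + y) - G x - y * D x| <= d ^- 2 * y ^+ 2].

Lemma norm_div_le (R : realType) (x y B : R) : 0 <= B -> `|x| <= B -> 1 <= `|y| ->
  `|x / y| <= B.
Proof.
move=> B0 xB y1; rewrite normrM normfV.
have y0 : 0 < `|y| by apply: lt_le_trans y1.
by rewrite ler_pdivrMr// (le_trans xB)// ler_peMr.
Qed.

(* The shift direction [(1, v1, v2, v3)] of the four variables is chosen to
   leave the first three arguments of [D] invariant; the fourth one then moves
   at speed [e * mu], where the closed form of [mu] uses [p1 + p4 = p2 + p3]. *)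
Lemma linear_box (R : realType) (D G : R -> R) (d e c1 c2 c3 c4 p1 p2 p3 p4 mu : R)
    (m J : nat) :
  oscillating d D G -> 0 < d -> 0 <= e ->
  `|p1| <= 13 -> `|p2| <= 13 -> `|p3| <= 13 -> `|p4| <= 13 ->
  1 <= `|p1| -> 1 <= `|p2| -> 1 <= `|1 - p3| ->
  p1 + p4 = p2 + p3 ->
  mu = (p1 + p4 - 1) * (p2 - p1) * (p1 - p3) / (p1 * p2 * (1 - p3)) ->
  J%:R * (e * `|mu|) *
  `|\sum_(i < m) \sum_(i' < m) \sum_(j < m) \sum_(j' < m)
      D (c1 + ((1 - p1) * e * i%:R + p1 * e * j%:R)) *
      D (c2 + ((1 - p2) * e * i%:R + p2 * e * j'%:R)) *
      D (c3 + ((1 - p3) * e * i'%:R + p3 * e * j%:R)) *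
      D (c4 + ((1 - p4) * e * i'%:R + p4 * e * j'%:R))| <=
  J%:R * (e * `|mu|) * (4 * m%:R ^+ 3 * (364 * J%:R + m%:R * (56 * e / d))) +
  m%:R ^+ 4 * (2 * d + J%:R * (d ^- 2 * (e * mu) ^+ 2)).
Proof.
move=> [D1 DL GB GL] d0 e0 P1 P2 P3 P4 Q1 Q2 Q3 psum muE.
have nz (x : R) : 1 <= `|x| -> x != 0.
  by move=> x1; rewrite -normr_gt0; apply: lt_le_trans x1.
have n1 := nz _ Q1; have n2 := nz _ Q2; have n3 := nz _ Q3.
pose W (x x' y y' : R) : R :=
  D (c1 + ((1 - p1) * e * x + p1 * e * y)) *
  D (c2 + ((1 - p2) * e * x + p2 * e * y')) *
  D (c3 + ((1 - p3) * e * x' + p3 * e * y)) *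
  D (c4 + ((1 - p4) * e * x' + p4 * e * y')).
have PM (x y : R) : `|x| <= 1 -> `|y| <= 1 -> `|x * y| <= 1.
  by move=> ? ?; rewrite normrM mulr_ile1.
have W1 x x' y y' : `|W x x' y y'| <= 1 by rewrite !PM.
have DP (c p x1 y1 x2 y2 : R) : `|p| <= 13 ->
    `|D (c + ((1 - p) * e * x1 + p * e * y1)) -
      D (c + ((1 - p) * e * x2 + p * e * y2))| <=
    14 * e / d * (`|x1 - x2| + `|y1 - y2|).
  move=> p13; apply: (le_trans (DL _ _)).
  have -> : c + ((1 - p) * e * x1 + p * e * y1) - (c + ((1 - p) * e * x2 + p * e * y2)) =
    e * ((1 - p) * (x1 - x2) + p * (y1 - y2)) by ring.
  rewrite normrM (ger0_norm e0).
  have -> : 14 * e / d * (`|x1 - x2| + `|y1 - y2|) =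
    d^-1 * (e * (14 * (`|x1 - x2| + `|y1 - y2|))) by ring.
  rewrite ler_wpM2l ?invr_ge0 ?(ltW d0)// ler_wpM2l//.
  rewrite (le_trans (ler_normD _ _))// !normrM mulrDr lerD// ler_wpM2r//; last by lra.
  by rewrite (le_trans (ler_normB _ _))// normr1; lra.
have WL x1 x1' y1 y1' x2 x2' y2 y2' : `|W x1 x1' y1 y1' - W x2 x2' y2 y2'| <=
     56 * e / d * (`|x1 - x2| + `|x1' - x2'| + `|y1 - y2| + `|y1' - y2'|).
  apply: (le_trans (prod4_dist _ _ _ _ _ _ _ _)) => //.
  have := DP c1 p1 x1 y1 x2 y2 P1; have := DP c2 p2 x1 y1' x2 y2' P2.
  have := DP c3 p3 x1' y1 x2' y2 P3; have := DP c4 p4 x1' y1' x2' y2' P4.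
  have K : 0 <= e / d by rewrite mulr_ge0// invr_ge0 ltW.
  have k1 := mulr_ge0 K (normr_ge0 (x1 - x2)).
  have k2 := mulr_ge0 K (normr_ge0 (x1' - x2')).
  have k3 := mulr_ge0 K (normr_ge0 (y1 - y2)).
  have k4 := mulr_ge0 K (normr_ge0 (y1' - y2')).
  rewrite -!(mulrA _ e d^-1) !mulrDr -!mulrA; rewrite -!mulrA in k1 k2 k3 k4; lra.
(* [v1] cancels the unit shift of [i] in the first factor, [v2] in the second, and [v3] cancels the
   shift [v1] of [j] in the third. All are at most [13 * 14 = 182] in absolute value. *)
pose v1 : R := - (1 - p1) / p1; pose v2 : R := - (1 - p2) / p2.
pose v3 : R := p3 * ((1 - p1) / p1) / (1 - p3).
pose S (t : R) : R := \sum_(i < m) \sum_(i' < m) \sum_(j < m) \sum_(j' < m)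
   W (i%:R + t) (i'%:R + v3 * t) (j%:R + v1 * t) (j'%:R + v2 * t).
pose S0 := \sum_(i < m) \sum_(i' < m) \sum_(j < m) \sum_(j' < m)
   W i%:R i'%:R j%:R j'%:R.
set Err := 4 * m%:R ^+ 3 * _.
have B14 (p : R) : `|p| <= 13 -> `|1 - p| <= 14.
  by move=> p13; rewrite (le_trans (ler_normB _ _))// normr1; lra.
have v1B : `|v1| <= 182.
  by apply: norm_div_le => //; rewrite normrN; have := B14 _ P1; lra.
have v2B : `|v2| <= 182.
  by apply: norm_div_le => //; rewrite normrN; have := B14 _ P2; lra.
have v3B : `|v3| <= 182.
  apply: norm_div_le => //; rewrite normrM (_ : 182 = 13 * 14); last by ring.
  by rewrite ler_pM// norm_div_le// B14.
have SErr (t : nat) : (t < J)%N -> `|S t%:R - S0| <= Err.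
  move=> tJ; have tJ' : t%:R <= J%:R :> R by rewrite ler_nat ltnW.
  apply: (le_trans (@sum_shift4 R W (56 * e / d) (182 * J%:R) m _ _ _ _ W1 WL _ _ _ _)).
  - by rewrite normr_nat; have : 0 <= J%:R :> R by []; lra.
  - by rewrite normrM ler_pM// normr_nat.
  - by rewrite normrM ler_pM// normr_nat.
  - by rewrite normrM ler_pM// normr_nat.
  - by rewrite /Err mulrA (_ : 2 * 182 = 364); last by ring.
have main : `|e * mu * \sum_(t < J) S t%:R| <=
    m%:R ^+ 4 * (2 * d + J%:R * (d ^- 2 * (e * mu) ^+ 2)).
  pose I4 := ('I_m * ('I_m * ('I_m * 'I_m)))%type.
  pose D3 (q : I4) :=
    D (c1 + ((1 - p1) * e * q.1%:R + p1 * e * q.2.2.1%:R)) *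
    D (c2 + ((1 - p2) * e * q.1%:R + p2 * e * q.2.2.2%:R)) *
    D (c3 + ((1 - p3) * e * q.2.1%:R + p3 * e * q.2.2.1%:R)).
  pose c' (q : I4) := c4 + ((1 - p4) * e * q.2.1%:R + p4 * e * q.2.2.2%:R).
  have SE (t : R) : S t = \sum_(q : I4) D3 q * D (c' q + t * (e * mu)).
    rewrite /S; under eq_bigr do under eq_bigr do rewrite pair_bigA /=.
    under eq_bigr do rewrite pair_bigA /=.
    rewrite pair_bigA /=; apply: eq_bigr => -[i [i' [j j']]] _ /=.
    rewrite /W /D3 /c' /=; congr (D _ * D _ * D _ * D _).
    - by congr (_ + _); rewrite /v1; field.
    - by congr (_ + _); rewrite /v2; field.
    - by congr (_ + _); rewrite /v3 /v1; field; rewrite n1 n3.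
    - rewrite -addrA; congr (_ + _); rewrite /v3 /v2 muE.
      have -> : p4 = p2 + p3 - p1 by lra.
      by field; rewrite n1 n2 n3.
  under eq_bigr do rewrite SE.
  rewrite exchange_big /= mulr_sumr.
  have -> : m%:R ^+ 4 = #|{: I4}|%:R :> R.
    by rewrite !card_prod !card_ord !natrM; ring.
  apply: norm_sum_bound => q.
  rewrite -mulr_sumr mulrCA normrM.
  have h1 := @sum_progression R D G d (d ^- 2) (c' q) (e * mu) J GB GL.
  by apply: le_trans h1; rewrite ler_piMl// /D3 !PM.
have -> : J%:R * (e * `|mu|) * `|S0| = `|e * mu * (J%:R * S0)|.
  by rewrite !normrM (ger0_norm e0) normr_nat; ring.
(* The unshifted sum is replaced by the average of the shifted ones, in which the fourth factor runs
   through a progression. *)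
have -> : e * mu * (J%:R * S0) =
   e * mu * \sum_(t < J) S t%:R - e * mu * \sum_(t < J) (S t%:R - S0).
  by rewrite sumrB sumr_const card_ord -mulr_natl; ring.
rewrite (le_trans (ler_normB _ _))// addrC lerD//.
rewrite normrM (normrM e) (ger0_norm e0).
have -> : J%:R * (e * `|mu|) * Err = e * `|mu| * (J%:R * Err) by ring.
rewrite ler_wpM2l ?mulr_ge0//.
exact: (@norm_sum_bound_ord R J (fun t => S t%:R - S0)).
Qed.

Lemma exchange_big22 (V : nmodType) (N m : nat) (F : nat -> nat -> nat -> nat -> V) :
  \sum_(i < m) \sum_(i' < m) \sum_(J < N) \sum_(J' < N) F i i' J J' =
  \sum_(J < N) \sum_(J' < N) \sum_(i < m) \sum_(i' < m) F i i' J J'.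
Proof.
under eq_bigr => i _ do (under eq_bigr => i' _ do rewrite pair_bigA); rewrite pair_bigA /=.
by rewrite exchange_big /= [RHS]pair_bigA /=; apply: eq_bigr => p _; rewrite [RHS]pair_bigA.
Qed.

Lemma sum_mul_split2 (V : nmodType) (N m : nat) (F : nat -> nat -> V) :
  \sum_(i < N * m) \sum_(j < N * m) F i j =
  \sum_(I < N) \sum_(J < N) \sum_(i < m) \sum_(j < m) F (I * m + i)%N (J * m + j)%N.
Proof.
rewrite (@sum_mul_split V N m (fun i => \sum_(j < N * m) F i j)).
apply: eq_bigr => I _; rewrite [RHS]exchange_big /=; apply: eq_bigr => i _.
exact: (@sum_mul_split V N m (F (I * m + i)%N)).
Qed.

Lemma sum_mul_split4 (V : nmodType) (N m : nat) (F : nat -> nat -> nat -> nat -> V) :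
  \sum_(i < N * m) \sum_(i' < N * m) \sum_(j < N * m) \sum_(j' < N * m) F i i' j j' =
  \sum_(I < N) \sum_(I' < N) \sum_(J < N) \sum_(J' < N)
  \sum_(i < m) \sum_(i' < m) \sum_(j < m) \sum_(j' < m)
    F (I * m + i)%N (I' * m + i')%N (J * m + j)%N (J' * m + j')%N.
Proof.
rewrite (@sum_mul_split2 V N m (fun i i' => \sum_(j < N * m) \sum_(j' < N * m) F i i' j j')).
apply: eq_bigr => I _; apply: eq_bigr => I' _.
rewrite -(exchange_big22 N m (fun i i' J J' => \sum_(j < m) \sum_(j' < m)
   F (I * m + i)%N (I' * m + i')%N (J * m + j)%N (J' * m + j')%N)).
by apply: eq_bigr => i _; apply: eq_bigr => i' _; rewrite sum_mul_split2.
Qed.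

Lemma sum_near_diagonal (N K I : nat) :
  (\sum_(i < N) ((I < i + K) && (i < I + K)) <= 2 * K)%N.
Proof.
have : (\sum_(i < N) ((I < i + K) && (i < I + K)) <=
         minn N (I + K) - (I.+1 - K))%N.
  elim: N => [|N IH]; first by rewrite big_ord0.
  by rewrite big_ord_recr /=; move: IH; set s := (\sum_(i < N) _)%N; lia.
by move=> H; apply: (leq_trans H); lia.
Qed.

Definition far_apart (K I J : nat) := ~~ ((I < J + K) && (J < I + K))%N.

(** Each index is near at most [2 * K] others, so at most [4 * K * N ^ 3] quadruples have to rely on
    the trivial bound. *)
Lemma sum4_far_bound (R : realDomainType) (N K : nat)
    (b : nat -> nat -> nat -> nat -> R) (A M : R) :
  0 <= A -> 0 <= M -> (forall I I' J J', `|b I I' J J'| <= M) ->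
  (forall I I' J J', (I < N)%N -> (I' < N)%N -> (J < N)%N -> (J' < N)%N ->
    far_apart K I I' -> far_apart K J J' -> `|b I I' J J'| <= A) ->
  `|\sum_(I < N) \sum_(I' < N) \sum_(J < N) \sum_(J' < N) b I I' J J'| <=
    N%:R ^+ 4 * A + 4 * K%:R * N%:R ^+ 3 * M.
Proof.
move=> A0 M0 bM bA.
pose near I J : R := (~~ far_apart K I J)%:R.
have near_sum I : \sum_(J < N) near I J <= 2 * K%:R.
  rewrite /near -natr_sum -natrM ler_nat /far_apart.
  by under eq_bigr do rewrite negbK; exact: sum_near_diagonal.
have bI I I' J J' : (I < N)%N -> (I' < N)%N -> (J < N)%N -> (J' < N)%N ->
    `|b I I' J J'| <= A + M * near I I' + M * near J J'.
  move=> hI hI' hJ hJ'; rewrite /near.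
  have [f1|f1] := boolP (far_apart K I I') => /=; last first.
    have h : 0 <= M * (~~ far_apart K J J')%:R by rewrite mulr_ge0.
    by have := bM I I' J J'; lra.
  have [f2|f2] := boolP (far_apart K J J') => /=; last first.
    by have := bM I I' J J'; lra.
  by have := bA I I' J J' hI hI' hJ hJ' f1 f2; lra.
have step1 I I' J : (I < N)%N -> (I' < N)%N -> (J < N)%N ->
    `|\sum_(J' < N) b I I' J J'| <= N%:R * (A + M * near I I') + M * (2 * K%:R).
  move=> hI hI' hJ; apply: (le_trans (ler_norm_sum _ _ _)).
  apply: (le_trans (ler_sum _ (fun (J' : 'I_N) _ => bI I I' J J' hI hI' hJ (ltn_ord J')))).
  rewrite big_split; apply: lerD; first by rewrite sumr_const card_ord [leRHS]mulr_natl.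
  by rewrite -mulr_sumr ler_wpM2l.
have step2 I I' : (I < N)%N -> (I' < N)%N ->
    `|\sum_(J < N) \sum_(J' < N) b I I' J J'| <=
    N%:R * (N%:R * A + M * (2 * K%:R)) + N%:R ^+ 2 * M * near I I'.
  move=> hI hI'; have -> : N%:R * (N%:R * A + M * (2 * K%:R)) + N%:R ^+ 2 * M * near I I' =
    N%:R * (N%:R * (A + M * near I I') + M * (2 * K%:R)) by ring.
  by apply: norm_sum_bound_fin => J; apply: step1.
have -> : N%:R ^+ 4 * A + 4 * K%:R * N%:R ^+ 3 * M =
  N%:R * (N%:R * (N%:R * (N%:R * A + M * (2 * K%:R))) + N%:R ^+ 2 * M * (2 * K%:R)) by ring.
apply: norm_sum_bound_fin => I; apply: (le_trans (ler_norm_sum _ _ _)).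
apply: (le_trans (ler_sum _ (fun (I' : 'I_N) _ => step2 I I' (ltn_ord I) (ltn_ord I')))).
rewrite big_split; apply: lerD; first by rewrite sumr_const card_ord [leRHS]mulr_natl.
rewrite -mulr_sumr; apply: ler_wpM2l; last exact: near_sum.
by apply: mulr_ge0 => //; apply: exprn_ge0.
Qed.

(** * Linearisation of the quadratic map on small blocks *)

Definition quad (R : realType) (a q x y : R) : R := x + (a * (y - x) ^+ 2 + q * (y - x)).

(* The base points range over [1/2, 33/64] and [35/64, 36/64], so that
   [y - x] lies in [1/32, 1/16]. *)
Definition xpt (R : realType) (e : R) (i : nat) : R := 2^-1 + e * i%:R.
Definition ypt (R : realType) (e : R) (j : nat) : R := 35 / 64 + e * j%:R.

(** Taylor expansion at the corner of a block: [p = 2 * a * (y - x) + q] is the derivative in [y]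
    and [1 - p] the one in [x]. The remainder is quadratic in the size of the block. *)
Lemma quad_linearize (R : realType) (a q e : R) (I J i j : nat) :
  quad a q (xpt e (I + i)) (ypt e (J + j)) =
  quad a q (xpt e I) (ypt e J) +
  ((1 - (2 * a * (ypt e J - xpt e I) + q)) * e * i%:R +
   (2 * a * (ypt e J - xpt e I) + q) * e * j%:R) + a * (e * (j%:R - i%:R)) ^+ 2.
Proof. by rewrite /quad /xpt /ypt !natrD; field. Qed.

(** The ranges give [3 <= |2 * a * (y - x)| <= 12], so a [q] of size at most 1 cannot bring either
    derivative of [quad] near 0. The slopes share the sign of [a], which will keep [p1 + p4 - 1]
    away from 0. *)
Lemma slope_bounds (R : realType) (a q x y : R) :
  48 <= `|a| <= 96 -> `|q| <= 1 -> 2^-1 <= x <= 33 / 64 -> 35 / 64 <= y <= 36 / 64 ->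
  let p := 2 * a * (y - x) + q in
  [/\ `|p| <= 13, 1 <= `|p|, 1 <= `|1 - p| & 0 < a /\ 2 <= p \/ a < 0 /\ p <= -2].
Proof.
move=> /andP[a1 a2] q1 /andP[x1 x2] /andP[y1 y2] p.
have s1 : 1 / 32 <= y - x by lra.
have s2 : y - x <= 1 / 16 by lra.
move: q1; rewrite ler_norml => /andP[q1 q2].
have [a0|a0] := leP 0 a.
  rewrite ger0_norm// in a1 a2.
  have p2 : 2 <= p by rewrite /p; nra.
  have p13 : p <= 13 by rewrite /p; nra.
  rewrite [`|p|]ger0_norm; last by lra.
  rewrite [`|1 - p|]ler0_norm; last by lra.
  by split; [lra..|left; split; lra].
rewrite ltr0_norm// in a1 a2.
have p2 : p <= -2 by rewrite /p; nra.
have p13 : -13 <= p by rewrite /p; nra.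
rewrite [`|p|]ler0_norm; last by lra.
rewrite [`|1 - p|]ger0_norm; last by lra.
by split; [lra..|right; split; lra].
Qed.

(** Meant for the speed [mu] of [linear_box]: [s] is [p1 + p4 - 1], while [l] and [k] are
    differences of slopes between far blocks. The lower bound [u] enters once for each of the two,
    hence the square. *)
Lemma shift_speed_bounds (R : realType) (u s l k p1 p2 p3 : R) : 0 <= u ->
  1 <= `|s| -> `|s| <= 27 -> u <= `|l| -> `|l| <= 26 -> u <= `|k| -> `|k| <= 26 ->
  1 <= `|p1| -> `|p1| <= 13 -> 1 <= `|p2| -> `|p2| <= 13 -> 1 <= `|p3| -> `|p3| <= 14 ->
  u ^+ 2 / (13 * 13 * 14) <= `|s * l * k / (p1 * p2 * p3)| <= 27 * 26 * 26.
Proof.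
move=> u0 s1 s2 l1 l2 k1 k2 a1 a2 b1 b2 c1 c2.
have den0 : 0 < `|p1| * `|p2| * `|p3|.
  by rewrite !mulr_gt0//; apply: lt_le_trans ltr01 _.
rewrite !normrM normfV !normrM; apply/andP; split.
  rewrite ler_pdivlMr// mulrAC ler_pdivrMr//.
  have h1 : 1 * u <= `|s| * `|l| by apply: ler_pM.
  have h2 : 1 * u * u <= `|s| * `|l| * `|k| by apply: ler_pM => //; rewrite mul1r.
  have h3 : `|p1| * `|p2| <= 13 * 13 by apply: ler_pM.
  have h4 : `|p1| * `|p2| * `|p3| <= 13 * 13 * 14 by apply: ler_pM => //; apply: mulr_ge0.
  have -> : u ^+ 2 = 1 * u * u by ring.
  by apply: ler_pM => //; rewrite ?mul1r ?mulr_ge0.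
have h1 : `|s| * `|l| <= 27 * 26 by apply: ler_pM.
have h2 : `|s| * `|l| * `|k| <= 27 * 26 * 26 by apply: ler_pM => //; apply: mulr_ge0.
have h3 : 1 * 1 <= `|p1| * `|p2| by apply: ler_pM.
have h4 : 1 * 1 * 1 <= `|p1| * `|p2| * `|p3| by apply: ler_pM => //; rewrite mulr1.
by rewrite ler_pdivrMr// (le_trans h2)// ler_peMr//; rewrite !mulr1 in h4.
Qed.

(** The contributions, in this order, of the shift error, of the size of the primitive and of its
    Taylor error in [linear_box]. *)
Definition smoothing_cst (R : realType) : R :=
  7 * 240 + 128 * (13 * 13 * 14) + 27 * 26 * 26.

Lemma smoothing_cst_ge0 (R : realType) : 0 <= smoothing_cst R.
Proof. by rewrite /smoothing_cst; lra. Qed.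

Section smoothing.
Variables (R : realType) (a q : R) (U j0 : nat) (D G : R -> R).
Hypotheses (ha : 48 <= `|a| <= 96) (hq : `|q| <= 1) (U0 : (0 < U)%N) (j00 : (0 < j0)%N).
(** Up to constants: blocks have side [u ^+ 5], so that the quadratic remainder [u ^+ 10] is a
    fraction [u] of the scale [u ^+ 9] of [D]. Shifts extend over [u ^+ 6], a fraction [u] of a
    block. The fourth point moves at speed at least [u ^+ 2], hence over [u ^+ 8], which is longer
    than the scale of [D] by a factor [u^-1]. The mesh [e] is small enough for the discretisation
    errors. *)
Let u : R := U%:R^-1.
Let N := (U ^ 5)%N.
Let m := (U * j0)%N.
Let n := (N * m)%N.
Let e : R := (64 * n%:R)^-1.
Hypotheses (osc : oscillating (u ^+ 9) D G) (eu : e <= u ^+ 20).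

Let u0 : 0 < u. Proof. by rewrite invr_gt0 ltr0n. Qed.
Let u1 : u <= 1. Proof. by rewrite invf_le1 ?ler1n ?ltr0n. Qed.
Let N0 : (0 < N)%N. Proof. by rewrite expn_gt0 U0. Qed.
Let m0 : (0 < m)%N. Proof. by rewrite muln_gt0 U0. Qed.
Let n0 : (0 < n)%N. Proof. by rewrite muln_gt0 N0. Qed.
Let e0 : 0 < e. Proof. by rewrite invr_gt0 mulr_gt0// ltr0n. Qed.

Let en : e * n%:R = 1 / 64.
Proof. by rewrite /e; field; rewrite pnatr_eq0 -lt0n. Qed.

Let xI I : (I < N)%N -> 2^-1 <= xpt e (I * m) <= 33 / 64.
Proof.
move=> IN; have : e * (I * m)%:R <= e * n%:R.
  by rewrite ler_pM2l// ler_nat leq_mul2r ltnW ?orbT.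
have : 0 <= e * (I * m)%:R by rewrite mulr_ge0// ltW.
by rewrite en /xpt; lra.
Qed.

Let yJ J : (J < N)%N -> 35 / 64 <= ypt e (J * m) <= 36 / 64.
Proof.
move=> IN; have : e * (J * m)%:R <= e * n%:R.
  by rewrite ler_pM2l// ler_nat leq_mul2r ltnW ?orbT.
have : 0 <= e * (J * m)%:R by rewrite mulr_ge0// ltW.
by rewrite en /ypt; lra.
Qed.

Let em : e * m%:R = u ^+ 5 / 64.
Proof.
rewrite /e /n natrM /N natrX /u exprVn; field.
by rewrite !pnatr_eq0 -!lt0n U0 m0.
Qed.

Let ej : e * j0%:R = u ^+ 6 / 64.
Proof.
have : e * m%:R = u ^+ 5 / 64 by [].
rewrite /m natrM => h; have -> : e * j0%:R = u * (e * (U%:R * j0%:R)).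
  by rewrite /u; field; rewrite pnatr_eq0 -lt0n.
by rewrite h; ring.
Qed.

(** [U ^ 4] blocks out of [U ^ 5] span a distance of order [u]: slopes of far blocks differ by at
    least [u], and near pairs are a proportion of at most [2 * u] of all pairs. *)
Let far := far_apart (U ^ 4).

Let far_dist (I I' : nat) : far I I' -> u <= `|96 * (e * (I * m)%:R - e * (I' * m)%:R)|.
Proof.
move=> II'.
have H : U%:R ^+ 4 <= `|I%:R - I'%:R| :> R.
  move: II'; rewrite /far /far_apart negb_and -!leqNgt => /orP[] h.
    rewrite ger0_norm ?subr_ge0 ?ler_nat; last by lia.
    by rewrite lerBrDl -natrX -natrD ler_nat.
  rewrite ler0_norm ?subr_le0 ?ler_nat; last by lia.
  by rewrite opprB lerBrDl -natrX -natrD ler_nat.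
have -> : 96 * (e * (I * m)%:R - e * (I' * m)%:R) = 96 * (e * m%:R) * (I%:R - I'%:R).
  by rewrite !natrM; ring.
rewrite em normrM ger0_norm; last first.
  by rewrite mulr_ge0// mulr_ge0// exprn_ge0// ltW.
apply: (@le_trans _ _ (96 * (u ^+ 5 / 64) * U%:R ^+ 4)).
  have -> : 96 * (u ^+ 5 / 64) * U%:R ^+ 4 = 96 / 64 * u.
    by rewrite /u; field; rewrite pnatr_eq0 -lt0n.
  by move: (ltW u0); lra.
by rewrite ler_wpM2l// mulr_ge0// mulr_ge0// exprn_ge0// ltW.
Qed.

Let cell (I J i j : nat) := D (quad a q (xpt e (I * m + i)) (ypt e (J * m + j))).

Let block I I' J J' := \sum_(i < m) \sum_(i' < m) \sum_(j < m) \sum_(j' < m)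
  cell I J i j * cell I J' i j' * cell I' J i' j * cell I' J' i' j'.

Let D1 x : `|D x| <= 1. Proof. by case: osc. Qed.

Let block_trivial I I' J J' : `|block I I' J J'| <= m%:R ^+ 4.
Proof.
have -> : m%:R ^+ 4 = m%:R * (m%:R * (m%:R * (m%:R * 1))) :> R by ring.
do 4! [apply: norm_sum_bound_fin => ?].
by rewrite /cell !normrM !mulr_ile1 ?mulr_ge0 ?D1.
Qed.

Let block_far I I' J J' : (I < N)%N -> (I' < N)%N -> (J < N)%N -> (J' < N)%N ->
  far I I' -> far J J' -> `|block I I' J J'| <= (4 + smoothing_cst R) * u * m%:R ^+ 4.
Proof.
move=> IN I'N JN J'N II' JJ'.
pose p I J := 2 * a * (ypt e (J * m) - xpt e (I * m)) + q.
pose c I J := quad a q (xpt e (I * m)) (ypt e (J * m)).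
pose lin I J (i j : nat) := D (c I J + ((1 - p I J) * e * i%:R + p I J * e * j%:R)).
pose S := \sum_(i < m) \sum_(i' < m) \sum_(j < m) \sum_(j' < m)
  lin I J i j * lin I J' i j' * lin I' J i' j * lin I' J' i' j'.
have d0 : 0 < u ^+ 9 by rewrite exprn_gt0.
have m1 : 0 < m%:R :> R by rewrite ltr0n.
have cell_lin I1 J1 i j : (i < m)%N -> (j < m)%N -> `|cell I1 J1 i j - lin I1 J1 i j| <= u.
  move=> im jm; case: osc => _ DL _ _; apply: (le_trans (DL _ _)).
  rewrite quad_linearize addrC addKr.
  have ij : `|e * (j%:R - i%:R)| <= u ^+ 5 / 64.
    rewrite -em normrM gtr0_norm// ler_pM2l//.
    have : (i%:R : R) <= m%:R by rewrite ler_nat ltnW.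
    have : (j%:R : R) <= m%:R by rewrite ler_nat ltnW.
    have : 0 <= i%:R :> R by []. have : 0 <= j%:R :> R by [].
    by rewrite ler_norml; lra.
  have sq : (e * (j%:R - i%:R)) ^+ 2 <= (u ^+ 5 / 64) ^+ 2.
    by rewrite -real_normK ?num_real// lerXn2r// nnegrE mulr_ge0// exprn_ge0// ltW.
  rewrite normrM [`|_ ^+ 2|]ger0_norm ?sqr_ge0//.
  rewrite ler_pdivrMl//.
  have u10 : u ^+ 9 * u = u ^+ 10 by ring.
  have u10' : (u ^+ 5 / 64) ^+ 2 = u ^+ 10 / (64 * 64) by field.
  rewrite u10; rewrite u10' in sq.
  have u100 : 0 <= u ^+ 10 by rewrite exprn_ge0// ltW.
  case/andP: ha => _ a2; have := sqr_ge0 (e * (j%:R - i%:R)); nra.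
have blockS : `|block I I' J J' - S| <= 4 * u * m%:R ^+ 4.
  have -> : 4 * u * m%:R ^+ 4 = m%:R * (m%:R * (m%:R * (m%:R * (4 * u)))) by ring.
  rewrite /block /S -sumrB.
  apply: norm_sum_bound_fin => i; rewrite -sumrB.
  apply: norm_sum_bound_fin => i'; rewrite -sumrB.
  apply: norm_sum_bound_fin => j; rewrite -sumrB.
  apply: norm_sum_bound_fin => j'.
  apply: (le_trans (prod4_dist _ _ _ _ _ _ _ _)); rewrite ?D1//.
  have := cell_lin I J _ _ (ltn_ord i) (ltn_ord j).
  have := cell_lin I J' _ _ (ltn_ord i) (ltn_ord j').
  have := cell_lin I' J _ _ (ltn_ord i') (ltn_ord j).
  by have := cell_lin I' J' _ _ (ltn_ord i') (ltn_ord j'); lra.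
have SB : `|S| <= smoothing_cst R * u * m%:R ^+ 4.
  have [P1 Q1 _ sg1] := slope_bounds ha hq (xI IN) (yJ JN).
  have [P2 Q2 _ _] := slope_bounds ha hq (xI IN) (yJ J'N).
  have [P3 _ Q3 _] := slope_bounds ha hq (xI I'N) (yJ JN).
  have [P4 _ _ sg4] := slope_bounds ha hq (xI I'N) (yJ J'N).
  rewrite -/(p I J) in P1 Q1 sg1; rewrite -/(p I J') in P2 Q2.
  rewrite -/(p I' J) in P3 Q3; rewrite -/(p I' J') in P4 sg4.
  have psum : p I J + p I' J' = p I J' + p I' J by rewrite /p; ring.
  pose mu := (p I J + p I' J' - 1) * (p I J' - p I J) * (p I J - p I' J) /
    (p I J * p I J' * (1 - p I' J)).
  have sig1 : 1 <= `|p I J + p I' J' - 1|.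
    case: sg1 sg4 => [[a0 s1]|[a0 s1]] [[a0' s4]|[a0' s4]].
    - by rewrite ger0_norm; lra.
    - by have := lt_trans a0 a0'; rewrite ltxx.
    - by have := lt_trans a0 a0'; rewrite ltxx.
    - by rewrite ler0_norm; lra.
  have sig2 : `|p I J + p I' J' - 1| <= 27.
    have := ler_normB (p I J + p I' J') 1; have := ler_normD (p I J) (p I' J').
    by rewrite normr1; lra.
  have dl1 : u <= `|p I J' - p I J|.
    have -> : p I J' - p I J = a * (2 * (e * (J' * m)%:R - e * (J * m)%:R)).
      by rewrite /p /ypt /xpt; ring.
    apply: (le_trans (far_dist JJ')); rewrite !normrM distrC mulrA.
    rewrite ler_wpM2r//; case/andP: ha => a1 _.
    by rewrite !normr_nat; lra.
  have dk1 : u <= `|p I J - p I' J|.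
    have -> : p I J - p I' J = a * (2 * (e * (I' * m)%:R - e * (I * m)%:R)).
      by rewrite /p /ypt /xpt; ring.
    apply: (le_trans (far_dist II')); rewrite !normrM distrC mulrA.
    rewrite ler_wpM2r//; case/andP: ha => a1 _.
    by rewrite !normr_nat; lra.
  have dl2 : `|p I J' - p I J| <= 26.
    by rewrite (le_trans (ler_normB _ _))//; lra.
  have dk2 : `|p I J - p I' J| <= 26.
    by rewrite (le_trans (ler_normB _ _))//; lra.
  have B14 : `|1 - p I' J| <= 14.
    by rewrite (le_trans (ler_normB _ _))// normr1; lra.
  have /andP[mu1 mu2] := shift_speed_bounds (ltW u0) sig1 sig2 dl1 dl2 dk1 dk2 Q1 P1 Q2 P2 Q3 B14.
  rewrite -/mu in mu1 mu2.
  have mu0 : 0 < `|mu|.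
    by apply: lt_le_trans mu1; rewrite divr_gt0// exprn_gt0.
  have := @linear_box R D G (u ^+ 9) e (c I J) (c I J') (c I' J) (c I' J')
    (p I J) (p I J') (p I' J) (p I' J') mu m j0 osc d0 (ltW e0) P1 P2 P3 P4 Q1 Q2 Q3 psum erefl.
  rewrite -/S [j0%:R * (e * _)]mulrA [j0%:R * e]mulrC ej.
  (* [X] is the distance covered by the fourth point. Every error term will be at most a constant
     times [X * u * m ^ 4]. *)
  set X := u ^+ 6 / 64 * `|mu|.
  have X0 : 0 < X by rewrite mulr_gt0// divr_gt0// exprn_gt0.
  move=> H; rewrite -(ler_pM2l X0); apply: (le_trans H).
  have jm : j0%:R = u * m%:R.
    by rewrite /m natrM /u; field; rewrite pnatr_eq0 -lt0n.
  have B1 : 4 * m%:R ^+ 3 * (364 * j0%:R + m%:R * (56 * e / u ^+ 9)) <= (7 * 240) * u * m%:R ^+ 4.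
    have K : e / u ^+ 9 <= u.
      rewrite ler_pdivrMr//; apply: (le_trans eu).
      have -> : u * u ^+ 9 = u ^+ 10 by ring.
      by rewrite ler_wiXn2l// ltW.
    rewrite jm.
    have -> : 4 * m%:R ^+ 3 * (364 * (u * m%:R) + m%:R * (56 * e / u ^+ 9)) =
      m%:R ^+ 4 * ((6 * 240 + 16) * u + 224 * (e / u ^+ 9)) by ring.
    by rewrite mulrC ler_pM2r ?exprn_gt0//; lra.
  have B2 : 2 * u ^+ 9 <= X * ((128 * (13 * 13 * 14)) * u).
    have -> : X * ((128 * (13 * 13 * 14)) * u) = (2 * (13 * 13 * 14)) * u ^+ 7 * `|mu| by rewrite /X; field.
    have -> : 2 * u ^+ 9 = (2 * (13 * 13 * 14)) * u ^+ 7 * (u ^+ 2 / (13 * 13 * 14)) by field.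
    by rewrite ler_pM2l// mulr_gt0// exprn_gt0.
  have B3 : j0%:R * ((u ^+ 9) ^- 2 * (e * mu) ^+ 2) <= X * ((27 * 26 * 26) * u).
    have -> : j0%:R * ((u ^+ 9) ^- 2 * (e * mu) ^+ 2) =
      X * (`|mu| * (e / u ^+ 18)).
      have -> : (e * mu) ^+ 2 = e ^+ 2 * `|mu| ^+ 2 by rewrite exprMn real_normK ?num_real.
      by rewrite /X -ej; field; rewrite gt_eqF.
    rewrite ler_pM2l// ler_pM//.
      by rewrite divr_ge0 ?exprn_ge0// ltW.
    rewrite ler_pdivrMr ?exprn_gt0//; apply: (le_trans eu).
    by rewrite (_ : u * u ^+ 18 = u ^+ 19); [rewrite ler_wiXn2l// ltW | ring].
  have m40 : 0 <= m%:R ^+ 4 :> R by rewrite exprn_ge0.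
  apply: (@le_trans _ _ (X * ((7 * 240) * u * m%:R ^+ 4) +
     m%:R ^+ 4 * (X * ((128 * (13 * 13 * 14)) * u) + X * ((27 * 26 * 26) * u)))).
    by apply: lerD; [rewrite ler_pM2l | rewrite ler_wpM2l// lerD].
  rewrite le_eqVlt; apply/orP; left; apply/eqP.
  by rewrite /smoothing_cst; ring.
have -> : block I I' J J' = (block I I' J J' - S) + S by rewrite subrK.
rewrite (le_trans (ler_normD _ _))//.
have -> : (4 + smoothing_cst R) * u * m%:R ^+ 4 = 4 * u * m%:R ^+ 4 + smoothing_cst R * u * m%:R ^+ 4 by ring.
exact: lerD.
Qed.

Lemma trilinear_smoothing (f g : nat -> R) :
  (forall i, `|f i| <= 1) -> (forall j, `|g j| <= 1) ->
  (\sum_(i < n) \sum_(j < n) f i * g j * D (quad a q (xpt e i) (ypt e j))) ^+ 4 <=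
  (8 + smoothing_cst R) * u * n%:R ^+ 8.
Proof.
move=> f1 g1; apply: (le_trans (box_bound n (fun i j => D (quad a q (xpt e i) (ypt e j))) f1 g1)).
set B := \sum_(i < n) _.
suff : B <= (8 + smoothing_cst R) * u * n%:R ^+ 4.
  move=> BB; have -> : (8 + smoothing_cst R) * u * n%:R ^+ 8 = n%:R ^+ 4 * ((8 + smoothing_cst R) * u * n%:R ^+ 4) by ring.
  by rewrite ler_wpM2l// exprn_ge0.
rewrite /B (@sum_mul_split4 R N m (fun i i' j j' =>
  D (quad a q (xpt e i) (ypt e j)) * D (quad a q (xpt e i) (ypt e j')) *
  D (quad a q (xpt e i') (ypt e j)) * D (quad a q (xpt e i') (ypt e j')))).
have u0' := ltW u0.
have A0 : 0 <= (4 + smoothing_cst R) * u * m%:R ^+ 4.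
  by rewrite !mulr_ge0 ?exprn_ge0// addr_ge0// smoothing_cst_ge0.
have M40 : 0 <= m%:R ^+ 4 :> R by rewrite exprn_ge0.
(* The near blocks add [4 * U ^ 4 * N ^ 3 * m ^ 4 = 4 * u * n ^ 4], which raises the 4 of
   [block_far] to 8. *)
have := @sum4_far_bound R N (U ^ 4) block _ _ A0 M40 block_trivial block_far.
rewrite /block /cell => H; apply: (le_trans (ler_norm _)); apply: (le_trans H).
have -> : N%:R ^+ 3 = u * N%:R ^+ 4 / U%:R ^+ 4.
  by rewrite /u /N natrX; field; rewrite pnatr_eq0 -lt0n.
rewrite natrX /n natrM; rewrite le_eqVlt; apply/orP; left; apply/eqP; field.
by rewrite pnatr_eq0 -lt0n.
Qed.
End smoothing.

(** * Mollified discrete measures *)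

Definition pospart (R : realType) (u : R) : R := if 0 <= u then u else 0.

(** The hat function on [-1, 1], as a second difference of [pospart]. Its Lipschitz bound comes from
    that of [pospart], and the Taylor bound of its antiderivative [tent_prim] from that of the
    square of [pospart]. *)
Definition tent (R : realType) (u : R) : R :=
  pospart (u + 1) - 2 * pospart u + pospart (u - 1).

Definition tent_prim (R : realType) (u : R) : R :=
  (pospart (u + 1) ^+ 2 - 2 * pospart u ^+ 2 + pospart (u - 1) ^+ 2) / 2.

Section tent.
Variable R : realType.
Implicit Types u v h : R.

Lemma pospart_lipschitz u v : `|pospart u - pospart v| <= `|u - v|.
Proof.
rewrite /pospart; case: (lerP 0 u); case: (lerP 0 v) => hv hu; rewrite ?subrr ?normr0//.
- by rewrite subr0 !ger0_norm; lra.
- by rewrite sub0r normrN ger0_norm// ler0_norm; lra.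
Qed.

Lemma pospart_sqr_taylor u h :
  0 <= pospart (u + h) ^+ 2 - pospart u ^+ 2 - 2 * h * pospart u <= h ^+ 2.
Proof.
rewrite /pospart; case: (lerP 0 u); case: (lerP 0 (u + h)) => hv hu; nra.
Qed.

Lemma tent_itv u : 0 <= tent u <= 1.
Proof.
rewrite /tent /pospart.
by case: (lerP 0 (u + 1)); case: (lerP 0 u); case: (lerP 0 (u - 1)) => *; lra.
Qed.

Lemma tent_far u : 1 <= `|u| -> tent u = 0.
Proof.
rewrite ler_normr /tent /pospart => /orP h; case: (lerP 0 (u + 1)); case: (lerP 0 u);
  case: (lerP 0 (u - 1)) => *; case: h => *; lra.
Qed.

Lemma tent_near u : `|u| <= 2^-1 -> 2^-1 <= tent u.
Proof.
rewrite ler_norml /tent /pospart; case: (lerP 0 (u + 1)); case: (lerP 0 u);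
  case: (lerP 0 (u - 1)) => *; lra.
Qed.

Lemma tent_lipschitz u v : `|tent u - tent v| <= 4 * `|u - v|.
Proof.
have -> : tent u - tent v = (pospart (u + 1) - pospart (v + 1))
  - 2 * (pospart u - pospart v) + (pospart (u - 1) - pospart (v - 1)).
  by rewrite /tent; ring.
have := pospart_lipschitz (u + 1) (v + 1); have := pospart_lipschitz u v.
have := pospart_lipschitz (u - 1) (v - 1).
rewrite (_ : u + 1 - (v + 1) = u - v); last by ring.
rewrite (_ : u - 1 - (v - 1) = u - v); last by ring.
set A := pospart _ - _; set B := pospart _ - _; set C := pospart _ - _ => hA hB hC.
rewrite (le_trans (ler_normD _ _))//.
have := ler_normB C (2 * B); rewrite normrM normr_nat; lra.
Qed.

Lemma tent_prim_itv u : 0 <= tent_prim u <= 1.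
Proof.
rewrite /tent_prim /pospart.
by case: (lerP 0 (u + 1)); case: (lerP 0 u); case: (lerP 0 (u - 1)) => *; nra.
Qed.

Lemma tent_prim_ge1 u : 1 <= u -> tent_prim u = 1.
Proof.
rewrite /tent_prim /pospart.
by case: (lerP 0 (u + 1)); case: (lerP 0 u); case: (lerP 0 (u - 1)) => *; nra.
Qed.

Lemma tent_prim_leN1 u : u <= -1 -> tent_prim u = 0.
Proof.
rewrite /tent_prim /pospart.
by case: (lerP 0 (u + 1)); case: (lerP 0 u); case: (lerP 0 (u - 1)) => *; nra.
Qed.

Lemma tent_prim_taylor u h : `|tent_prim (u + h) - tent_prim u - h * tent u| <= 2 * h ^+ 2.
Proof.
have h1 := pospart_sqr_taylor (u + 1) h; have h2 := pospart_sqr_taylor u h.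
have h3 := pospart_sqr_taylor (u - 1) h.
rewrite (_ : u + 1 + h = u + h + 1) in h1; last by ring.
rewrite (_ : u - 1 + h = u + h - 1) in h3; last by ring.
by rewrite ler_norml /tent_prim /tent; have := sqr_ge0 h; lra.
Qed.
End tent.

Lemma ler_sum_mem (R : numDomainType) (I : eqType) (r : seq I) (F G : I -> R) :
  (forall i, i \in r -> F i <= G i) -> \sum_(i <- r) F i <= \sum_(i <- r) G i.
Proof. by move=> FG; rewrite big_seq [leRHS]big_seq; apply: ler_sum => i; apply: FG. Qed.

Section mollified_measure.
Variable R : realType.
Implicit Types (s : seq (R * R)) (x y h : R) (k : nat).

(* A list of pairs (point, mass) stands for the measure [\sum_p p.2 dirac p.1]. *)
Definition cell_mass s k (j : int) : R := \sum_(p <- s | Num.floor (2 ^+ k * p.1) == j) p.2.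

(** The growth bound stops at level [n], so that finitely many point masses can satisfy it.
    [kappa / 2] will be [2 ^ (- beta)]; a [kappa] close to 1 means a growth close to that of length.
    Level 0 bounds the total mass by 1. *)
Definition frostman (kappa : R) n s :=
  (forall p, p \in s -> 0 <= p.2 /\ 0 <= p.1 < 1) /\
  (forall k j, (k <= n)%N -> cell_mass s k j <= (kappa / 2) ^+ k).

Definition density s k x : R := \sum_(p <- s) p.2 * (2 ^+ k * tent (2 ^+ k * (x - p.1))).

(** A primitive of [density s k]. Differences of two levels of [density] and of [mollified_cdf] will
    serve as [D] and [G]. *)
Definition mollified_cdf s k x : R := \sum_(p <- s) p.2 * tent_prim (2 ^+ k * (x - p.1)).

Variables (kappa : R) (n : nat) (s : seq (R * R)).
Hypotheses (kappa1 : 1 <= kappa) (frost : frostman kappa n s).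

Let mass_ge0 p : p \in s -> 0 <= p.2. Proof. by case: frost => H _ /H[]. Qed.

(** An interval of radius [2 ^- k] meets at most three consecutive dyadic intervals of level [k]. *)
Lemma near_mass k x : (k <= n)%N ->
  \sum_(p <- s | `|2 ^+ k * (x - p.1)| < 1) p.2 <= 3 * (kappa / 2) ^+ k.
Proof.
move=> kn; set j := Num.floor (2 ^+ k * x).
have H j' := (frost.2 k j' kn).
apply: (@le_trans _ _ (cell_mass s k (j - 1) + cell_mass s k j + cell_mass s k (j + 1))); last first.
  by have := H (j - 1); have := H j; have := H (j + 1); lra.
rewrite /cell_mass big_mkcond [X in X + _ + _]big_mkcond [X in _ + X + _]big_mkcond [X in _ + _ + X]big_mkcond.
rewrite -!big_split /=; apply: ler_sum_mem => p ps.
have p2 := mass_ge0 ps; set j' := Num.floor _.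
case: ifPn => hp; last by rewrite !addr_ge0//; case: ifP.
have : [|| j' == j - 1, j' == j | j' == j + 1].
  have /andP[a1 a2] := floor_itv (2 ^+ k * x); have /andP[b1 b2] := floor_itv (2 ^+ k * p.1).
  rewrite -/j in a1 a2; rewrite -/j' in b1 b2.
  move: hp; rewrite mulrBr ltr_norml => /andP[c1 c2].
  have d1 : (j' : int)%:~R < (j + 2)%:~R :> R by rewrite intrD; rewrite intrD in a2; lra.
  have d2 : (j - 2)%:~R < (j' : int)%:~R :> R by rewrite intrD; rewrite intrD in b2; lra.
  rewrite !ltr_int in d1 d2; clear -d1 d2; lia.
by case/or3P => /eqP ->; rewrite eqxx; do ?case: ifP => _; lra.
Qed.

Lemma total_mass_le1 : \sum_(p <- s) p.2 <= 1.
Proof.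
have := frost.2 0%N 0 (leq0n _); rewrite expr0; apply: le_trans.
rewrite /cell_mass big_mkcond [leRHS]big_mkcond /=; apply: ler_sum_mem => p ps.
case: frost => /(_ _ ps)[_ p1] _; rewrite expr0 mul1r.
by rewrite floor_eq p1 .
Qed.

Lemma density_bounds k x : (k <= n)%N -> 0 <= density s k x <= 3 * kappa ^+ k.
Proof.
move=> kn; have k0 : 0 < 2 ^+ k :> R by rewrite exprn_gt0.
apply/andP; split.
  rewrite /density big_seq sumr_ge0// => p ps; rewrite mulr_ge0 ?mass_ge0// mulr_ge0 ?(ltW k0)//.
  by case/andP: (tent_itv (2 ^+ k * (x - p.1))).
have -> : 3 * kappa ^+ k = 2 ^+ k * (3 * (kappa / 2) ^+ k).
  rewrite expr_div_n; field.
  by rewrite gt_eqF.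
apply: le_trans (ler_wpM2l (ltW k0) (near_mass x kn)).
rewrite mulr_sumr [leRHS]big_mkcond /=; apply: ler_sum_mem => p ps.
have p2 := mass_ge0 ps.
rewrite mulrCA ltNge; case: ifPn => [_|]; last first.
  by rewrite negbK => h; rewrite tent_far// !mulr0.
rewrite ler_wpM2l ?(ltW k0)// ler_piMr//.
by case/andP: (tent_itv (2 ^+ k * (x - p.1))).
Qed.

Lemma density_lipschitz k x y : (k <= n)%N ->
  `|density s k x - density s k y| <= 24 * 2 ^+ k * kappa ^+ k * `|x - y|.
Proof.
move=> kn; have k0 : 0 < 2 ^+ k :> R by rewrite exprn_gt0.
have -> : 24 * 2 ^+ k * kappa ^+ k * `|x - y| =
  4 * 2 ^+ k * 2 ^+ k * `|x - y| * (3 * (kappa / 2) ^+ k + 3 * (kappa / 2) ^+ k).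
  by rewrite expr_div_n; field; rewrite gt_eqF.
have c0 : 0 <= 4 * 2 ^+ k * 2 ^+ k * `|x - y| by rewrite !mulr_ge0// ltW.
apply: le_trans (ler_wpM2l c0 (lerD (near_mass x kn) (near_mass y kn))).
rewrite [X in _ * (X + _)]big_mkcond [X in _ * (_ + X)]big_mkcond -big_split mulr_sumr /= /density -sumrB.
apply: (le_trans (ler_norm_sum _ _ _)); apply: ler_sum_mem => p ps.
have p2 := mass_ge0 ps.
rewrite -mulrBr normrM (ger0_norm p2) -mulrBr normrM (gtr0_norm k0).
have L : p.2 * (2 ^+ k * `|tent (2 ^+ k * (x - p.1)) - tent (2 ^+ k * (y - p.1))|) <=
    4 * 2 ^+ k * 2 ^+ k * `|x - y| * p.2.
  rewrite [leRHS]mulrC ler_wpM2l//.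
  have -> : 4 * 2 ^+ k * 2 ^+ k * `|x - y| = 2 ^+ k * (4 * (2 ^+ k * `|x - y|)) by ring.
  rewrite ler_wpM2l ?(ltW k0)//; apply: (le_trans (tent_lipschitz _ _)).
  by rewrite -mulrBr opprB addrA subrK normrM (gtr0_norm k0).
rewrite !ltNge; case: ifPn => hx; first by apply: (le_trans L); rewrite ler_wpM2l// lerDl; case: ifP.
case: ifPn => hy; first by apply: (le_trans L); rewrite ler_wpM2l// lerDr.
by rewrite !negbK in hx hy; rewrite !tent_far// subrr normr0 !mulr0 addr0 mulr0.
Qed.

Lemma mollified_cdf_taylor k x h :
  `|mollified_cdf s k (x + h) - mollified_cdf s k x - h * density s k x| <=
  2 * (2 ^+ k) ^+ 2 * h ^+ 2.
Proof.
have c0 : 0 <= 2 * (2 ^+ k) ^+ 2 * h ^+ 2 by rewrite mulr_ge0 ?sqr_ge0 ?mulr_ge0 ?exprn_ge0.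
apply: le_trans (ler_piMr c0 total_mass_le1).
rewrite /mollified_cdf /density !mulr_sumr -!sumrB.
apply: (le_trans (ler_norm_sum _ _ _)); apply: ler_sum_mem => p ps.
have p2 := mass_ge0 ps.
have := tent_prim_taylor (2 ^+ k * (x - p.1)) (2 ^+ k * h).
have -> : 2 ^+ k * (x - p.1) + 2 ^+ k * h = 2 ^+ k * (x + h - p.1) by ring.
set A := tent_prim _; set B := tent_prim _; set C := tent _ => H.
have -> : p.2 * A - p.2 * B - h * (p.2 * (2 ^+ k * C)) = p.2 * (A - B - 2 ^+ k * h * C) by ring.
rewrite normrM (ger0_norm p2) [leRHS]mulrC ler_wpM2l//.
by apply: (le_trans H); rewrite exprMn mulrA.
Qed.

(** A point mass at distance at least [2 ^- k] from [x] is counted entirely or not at all at both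
    levels, so only the mass near [x] can make a difference. *)
Lemma mollified_cdf_dist k k' x : (k <= k' <= n)%N ->
  `|mollified_cdf s k' x - mollified_cdf s k x| <= 3 * (kappa / 2) ^+ k.
Proof.
move=> /andP[kk' k'n]; have kn := leq_trans kk' k'n.
have k0 : 0 < 2 ^+ k :> R by rewrite exprn_gt0.
have k'0 : 2 ^+ k <= 2 ^+ k' :> R by rewrite ler_weXn2l// ler1n.
apply: le_trans (near_mass x kn); rewrite /mollified_cdf -sumrB.
apply: (le_trans (ler_norm_sum _ _ _)); rewrite [leRHS]big_mkcond; apply: ler_sum_mem => p ps.
have p2 := mass_ge0 ps; rewrite -mulrBr normrM (ger0_norm p2).
have I1 := tent_prim_itv (2 ^+ k * (x - p.1)); have I2 := tent_prim_itv (2 ^+ k' * (x - p.1)).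
rewrite ltNge; case: ifPn => [_|].
  by rewrite ler_piMr// ler_norml; lra.
rewrite negbK ler_normr => /orP[] h.
  have xp : 0 <= x - p.1 by rewrite -(pmulr_rge0 _ k0); lra.
  by rewrite !tent_prim_ge1 ?subrr ?normr0 ?mulr0//; apply: le_trans h _; rewrite ler_wpM2r.
have xp : x - p.1 <= 0 by rewrite -(pmulr_rle0 _ k0); lra.
rewrite !tent_prim_leN1 ?subrr ?normr0 ?mulr0//; first by lra.
by move: k'0; nra.
Qed.

(** The cell of level [k.+1] around [x] stays within half the radius of the kernel, where [tent] is
    at least 1/2. The constant is [2 ^ k * (1 / 2) * 2 ^- (k + 2)]. *)
Lemma density_ge k x : (k.+1 <= n)%N -> 0 <= x < 1 ->
  (forall j : nat, (j < 2 ^ k.+1)%N -> (2 ^+ k.+2)^-1 <= cell_mass s k.+1 j%:Z) ->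
  8^-1 <= density s k x.
Proof.
move=> kn /andP[x0 x1] cells; have k0 : 0 < 2 ^+ k :> R by rewrite exprn_gt0.
have k1 : 0 < 2 ^+ k.+1 :> R by rewrite exprn_gt0.
have y0 : 0 <= 2 ^+ k.+1 * x by rewrite mulr_ge0// ltW.
have : exists j : nat, Num.floor (2 ^+ k.+1 * x) = j%:Z.
  by exists `|Num.floor (2 ^+ k.+1 * x)|%N; rewrite gez0_abs// floor_ge0.
case=> j fj.
have jN : (j < 2 ^ k.+1)%N.
  rewrite -(ltr_nat R) natrX; apply: (@le_lt_trans _ _ (2 ^+ k.+1 * x)).
    by have := floor_le (2 ^+ k.+1 * x); rewrite fj.
  by rewrite gtr_pMr.
have := cells j jN => H.
have -> : 8^-1 = 2 ^+ k / 2 * (2 ^+ k.+2)^-1 :> R.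
  by rewrite !exprS; field; rewrite gt_eqF.
apply: le_trans (ler_wpM2l _ H) _; first by rewrite divr_ge0// ltW.
rewrite /cell_mass /density mulr_sumr big_mkcond; apply: ler_sum_mem => p ps.
have p2 := mass_ge0 ps.
case: ifPn => [/eqP hp|_]; last first.
  by rewrite mulr_ge0// mulr_ge0 ?(ltW k0)//; case/andP: (tent_itv (2 ^+ k * (x - p.1))).
have -> : 2 ^+ k / 2 * p.2 = p.2 * (2 ^+ k * 2^-1) by ring.
rewrite ler_wpM2l// ler_wpM2l ?(ltW k0)//; apply: tent_near.
have := floor_itv (2 ^+ k.+1 * x); have := floor_itv (2 ^+ k.+1 * p.1).
rewrite hp fj !intrD !exprS ler_norml; lra.
Qed.

(** The other [2 ^ k - 1] cells are capped by the Frostman bound, so a nearly full total mass leaves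
    no cell light. *)
Lemma cell_mass_ge k (j : nat) : (k <= n)%N -> (j < 2 ^ k)%N ->
  (2 ^+ k)^-1 - (1 - \sum_(p <- s) p.2) - (kappa ^+ k - 1) <= cell_mass s k j%:Z.
Proof.
move=> kn jN; have k0 : 0 < 2 ^+ k :> R by rewrite exprn_gt0.
have tot : \sum_(p <- s) p.2 = \sum_(i < 2 ^ k) cell_mass s k (i : nat)%:Z.
  rewrite /cell_mass (exchange_big_dep xpredT)//= big_seq [RHS]big_seq; apply: eq_bigr => p ps.
  have [_ /andP[p0 p1]] := frost.1 p ps.
  have y0 : 0 <= 2 ^+ k * p.1 by rewrite mulr_ge0// ltW.
  have : exists z : nat, Num.floor (2 ^+ k * p.1) = z%:Z.
    by exists `|Num.floor (2 ^+ k * p.1)|%N; rewrite gez0_abs// floor_ge0.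
  case=> z fE; have fN : (z < 2 ^ k)%N.
    rewrite -(ltr_nat R) natrX; apply: (@le_lt_trans _ _ (2 ^+ k * p.1)).
      by have := floor_le (2 ^+ k * p.1); rewrite fE.
    by rewrite gtr_pMr.
  rewrite (big_pred1 (Ordinal fN))// => i /=; rewrite fE.
  by rewrite eqz_nat eq_sym.
have k2 : (kappa / 2) ^+ k = kappa ^+ k * (2 ^+ k)^-1 by rewrite expr_div_n.
have kap : 1 <= kappa ^+ k by rewrite exprn_ege1.
have rest : \sum_(i < 2 ^ k | i != Ordinal jN) cell_mass s k (i : nat)%:Z <=
    ((2 ^+ k) - 1) * (kappa / 2) ^+ k.
  apply: (@le_trans _ _ (\sum_(i < 2 ^ k | i != Ordinal jN) (kappa / 2) ^+ k)).
    by apply: ler_sum => i _; exact: frost.2.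
  rewrite sumr_const -[leLHS]mulr_natl ler_wpM2r ?exprn_ge0 ?divr_ge0 ?(le_trans _ kappa1)//.
  have -> : 2 ^+ k - 1 = (2 ^ k).-1%:R :> R.
    by rewrite -subn1 natrB ?expn_gt0// natrX.
  by rewrite ler_nat; have := cardC1 (Ordinal jN); rewrite card_ord => <-.
move: tot; rewrite (bigD1 (Ordinal jN))//= => ->; rewrite k2 in rest.
have inv0 : 0 < (2 ^+ k)^-1 :> R by rewrite invr_gt0.
have e1 : (2 ^+ k - 1) * (kappa ^+ k * (2 ^+ k)^-1) = kappa ^+ k - kappa ^+ k * (2 ^+ k)^-1.
  by field; rewrite gt_eqF.
by rewrite e1 in rest; nra.
Qed.

End mollified_measure.

(** * Comparison of consecutive scales *)

Lemma abel_bound (R : realDomainType) (n : nat) (G D H : nat -> R) (e B M l r : R) :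
  0 <= M -> 0 <= B ->
  (forall i, (i <= n)%N -> `|G i| <= B) -> (forall i, (i <= n)%N -> `|H i| <= M) ->
  (forall i, (i < n)%N -> `|H i.+1 - H i| <= l) ->
  (forall i, (i < n)%N -> `|G i.+1 - G i - e * D i| <= r) ->
  `|e * \sum_(i < n) D i * H i| <= B * (2 * M + n%:R * l) + n%:R * (r * M).
Proof.
move=> M0 B0 GB HM Hl Gr.
have parts k : \sum_(i < k) (G i.+1 - G i) * H i =
    G k * H k - G 0%N * H 0%N - \sum_(i < k) G i.+1 * (H i.+1 - H i).
  elim: k => [|k IH]; first by rewrite !big_ord0; ring.
  by rewrite !big_ord_recr /= IH; ring.
have -> : e * \sum_(i < n) D i * H i = \sum_(i < n) (G i.+1 - G i) * H i -
    \sum_(i < n) (G i.+1 - G i - e * D i) * H i.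
  by rewrite -sumrB mulr_sumr; apply: eq_bigr => i _; ring.
rewrite parts (le_trans (ler_normB _ _))// lerD//; last first.
  apply: (@norm_sum_bound_ord R n (fun i => (G i.+1 - G i - e * D i) * H i)) => i hi.
  by rewrite normrM ler_pM ?Gr ?HM// ltnW.
have GH i : (i <= n)%N -> `|G i * H i| <= B * M by move=> hi; rewrite normrM ler_pM ?GB ?HM.
have S : `|\sum_(i < n) G i.+1 * (H i.+1 - H i)| <= n%:R * (B * l).
  apply: (@norm_sum_bound_ord R n (fun i => G i.+1 * (H i.+1 - H i))) => i hi.
  by rewrite normrM ler_pM ?GB ?Hl.
have := GH n (leqnn n); have := GH 0%N (leq0n n).
have := ler_normB (G n * H n - G 0%N * H 0%N) (\sum_(i < n) G i.+1 * (H i.+1 - H i)).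
have := ler_normB (G n * H n) (G 0%N * H 0%N).
by rewrite mulrDr mulrCA -(mulrCA _ B) in S *; lra.
Qed.

Definition trilinear (R : realType) (a q : R) (n : nat) (f g h : R -> R) : R :=
  let e := (64 * n%:R)^-1 in
  \sum_(i < n) \sum_(j < n) f (xpt e i) * g (ypt e j) * h (quad a q (xpt e i) (ypt e j)).

(** With [U = 2 ^ (4 * k)] the fourth root in [trilinear_smoothing] yields [2 ^- k], and [32 ^ 4]
    dominates [8 + smoothing_cst]. *)
Lemma trilinear_oscillating (R : realType) (a q : R) (k n j0 : nat) (A B Q : R)
    (f g D G : R -> R) :
  48 <= `|a| <= 96 -> `|q| <= 1 -> (0 < j0)%N ->
  n = ((2 ^ (4 * k)) ^ 5 * (2 ^ (4 * k) * j0))%N ->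
  (64 * n%:R)^-1 <= ((2 ^+ (4 * k))^-1) ^+ 20 :> R ->
  0 < A -> 0 < B -> 0 < Q -> (forall x, `|f x| <= A) -> (forall x, `|g x| <= B) ->
  oscillating ((2 ^+ (36 * k))^-1) (fun x => D x / Q) (fun x => G x / Q) ->
  `|trilinear a q n f g D| <= 32 * A * B * Q * (2 ^+ k)^-1 * n%:R ^+ 2.
Proof.
move=> ha hq j00 nE en A0 B0 Q0 fA gB osc.
pose U := (2 ^ (4 * k))%N; have U0 : (0 < U)%N by rewrite expn_gt0.
pose e : R := (64 * n%:R)^-1.
pose X := \sum_(i < n) \sum_(j < n) (f (xpt e i) / A) * (g (ypt e j) / B) *
  (D (quad a q (xpt e i) (ypt e j)) / Q).
have UE : U%:R = 2 ^+ (4 * k) :> R by rewrite /U natrX.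
have osc' : oscillating (U%:R^-1 ^+ 9) (fun x => D x / Q) (fun x => G x / Q).
  by rewrite UE exprVn -exprM (_ : (4 * k * 9 = 36 * k)%N)//; lia.
have en' : (64 * (U ^ 5 * (U * j0))%N%:R)^-1 <= U%:R^-1 ^+ 20 :> R by rewrite -nE UE.
have f1 i : `|f (xpt e i) / A| <= 1.
  by rewrite normrM normfV (gtr0_norm A0) ler_pdivrMr// mul1r.
have g1 i : `|g (ypt e i) / B| <= 1.
  by rewrite normrM normfV (gtr0_norm B0) ler_pdivrMr// mul1r.
have := trilinear_smoothing ha hq U0 j00 osc' en' f1 g1.
rewrite -nE -/e -/X => X4.
have TX : trilinear a q n f g D = A * B * Q * X.
  rewrite /trilinear /X mulr_sumr; apply: eq_bigr => i _; rewrite mulr_sumr.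
  by apply: eq_bigr => j _; field; rewrite !gt_eqF.
rewrite TX normrM gtr0_norm ?mulr_gt0//.
have -> : 32 * A * B * Q * (2 ^+ k)^-1 * n%:R ^+ 2 = A * B * Q * (32 * (2 ^+ k)^-1 * n%:R ^+ 2).
  by ring.
rewrite ler_pM2l ?mulr_gt0//.
have k0 : 0 < (2 ^+ k)^-1 :> R by rewrite invr_gt0 exprn_gt0.
have r0 : 0 <= 32 * (2 ^+ k)^-1 * n%:R ^+ 2 :> R by rewrite !mulr_ge0 ?sqr_ge0// ltW.
rewrite -(ler_pXn2r (n := 4))// ?nnegrE// -normrX ger0_norm; last first.
  by rewrite (_ : X ^+ 4 = (X ^+ 2) ^+ 2) ?sqr_ge0// -exprM.
apply: (le_trans X4).
have -> : (32 * (2 ^+ k)^-1 * n%:R ^+ 2) ^+ 4 = 32 * 32 * 32 * 32 * U%:R^-1 * n%:R ^+ 8 :> R.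
  rewrite UE mulnC exprM; field; rewrite expf_neq0//.
rewrite ler_wpM2r ?exprn_ge0// ler_wpM2r ?invr_ge0//.
by rewrite /smoothing_cst; lra.
Qed.

Lemma lattice_lt1 (R : realType) (n i : nat) : (0 < n)%N -> (i <= n)%N ->
  0 <= (64 * n%:R : R)^-1 * i%:R <= 1 / 64.
Proof.
move=> n0 ni; have n0' : 0 < n%:R :> R by rewrite ltr0n.
apply/andP; split; first by rewrite mulr_ge0// invr_ge0 mulr_ge0.
rewrite mulrC ler_pdivrMr ?mulr_gt0//.
have : i%:R <= n%:R :> R by rewrite ler_nat.
by move=> ?; have -> : 1 / 64 * (64 * n%:R) = n%:R :> R by field.
Qed.

Section slots.
Variables (R : realType) (a q : R) (n : nat).
Hypotheses (ha : 48 <= `|a| <= 96) (hq : `|q| <= 1) (n0 : (0 < n)%N).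
Let e : R := (64 * n%:R)^-1.
Let e0 : 0 < e. Proof. by rewrite invr_gt0 mulr_gt0// ltr0n. Qed.
Let en : e * n%:R = 1 / 64.
Proof. by rewrite /e; field; rewrite pnatr_eq0 -lt0n. Qed.

(** Both partial differences of [quad] over one mesh have the form [e * (t + a * s)], and
    [14 = 2 + 96 / 8]. *)
Let quad_diff (t s : R) : `|s| <= 1 / 8 -> `|t| <= 2 -> `|e * (t + a * s)| <= 14 * e.
Proof.
move=> s8 t2; rewrite normrM gtr0_norm// mulrC ler_pM2r//.
case/andP: ha => _ a2; have h : `|a| * `|s| <= 96 * (1 / 8) by rewrite ler_pM.
by rewrite (le_trans (ler_normD _ _))// normrM; lra.
Qed.

Lemma quad_lipschitz_x (i j : nat) : (i < n)%N -> (j < n)%N ->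
  `|quad a q (xpt e i.+1) (ypt e j) - quad a q (xpt e i) (ypt e j)| <= 14 * e.
Proof.
move=> hi hj; have /andP[i0 i1] := lattice_lt1 R n0 (ltnW hi).
have /andP[i2 i3] := lattice_lt1 R n0 hi; have /andP[j1 j2] := lattice_lt1 R n0 (ltnW hj).
rewrite -/e in i0 i1 i2 i3 j1 j2.
have -> : quad a q (xpt e i.+1) (ypt e j) - quad a q (xpt e i) (ypt e j) =
   e * (1 - q + a * (xpt e i.+1 + xpt e i - 2 * ypt e j)).
  by rewrite /quad /xpt /ypt -natr1; field.
apply: quad_diff.
  move: i0 i1 i2 i3 j1 j2; rewrite /xpt /ypt ler_norml.
  by move: (e * i%:R) (e * i.+1%:R) (e * j%:R); clear => *; lra.
by move: hq; rewrite !ler_norml => /andP[? ?]; clear i2 i3; lra.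
Qed.

Lemma quad_lipschitz_y (i j : nat) : (i < n)%N -> (j < n)%N ->
  `|quad a q (xpt e i) (ypt e j.+1) - quad a q (xpt e i) (ypt e j)| <= 14 * e.
Proof.
move=> hi hj; have /andP[i0 i1] := lattice_lt1 R n0 (ltnW hi).
have /andP[i2 i3] := lattice_lt1 R n0 hj; have /andP[j1 j2] := lattice_lt1 R n0 (ltnW hj).
rewrite -/e in i0 i1 i2 i3 j1 j2.
have -> : quad a q (xpt e i) (ypt e j.+1) - quad a q (xpt e i) (ypt e j) =
   e * (q + a * (ypt e j.+1 + ypt e j - 2 * xpt e i)).
  by rewrite /quad /xpt /ypt -natr1; field.
apply: quad_diff.
  move: i0 i1 i2 i3 j1 j2; rewrite /xpt /ypt ler_norml.
  by move: (e * i%:R) (e * j.+1%:R) (e * j%:R); clear => *; lra.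
by move: hq; rewrite !ler_norml => /andP[? ?]; clear i2 i3; lra.
Qed.

Variables (f g h D G : R -> R) (A B M L r : R).
Hypotheses (A0 : 0 <= A) (B0 : 0 <= B) (M0 : 0 <= M) (L0 : 0 <= L) (r0 : 0 <= r).
Hypotheses (GB : forall x, `|G x| <= B) (hM : forall x, `|h x| <= M).
Hypotheses (hL : forall x y, `|h x - h y| <= L * `|x - y|).
Hypotheses (Gr : forall x y, `|G (x + y) - G x - y * D x| <= r * y ^+ 2).

Let slot_bound (z H : nat -> R) :
  (forall i, z i.+1 = z i + e) -> (forall i, (i <= n)%N -> `|H i| <= M) ->
  (forall i, (i < n)%N -> `|H i.+1 - H i| <= L * (14 * e)) ->
  `|\sum_(i < n) D (z i) * H i| <= 64 * n%:R * (B * (2 * M + L) + r * e * M).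
Proof.
move=> zS HM Hl.
have := @abel_bound R n (fun i => G (z i)) (fun i => D (z i)) H e B M (L * (14 * e)) (r * e ^+ 2) M0 B0
  (fun i _ => GB _) HM Hl.
move=> /(_ _) X; have {X} := X _; rewrite normrM gtr0_norm//.
move=> /(_ (fun i _ => _)) X.
have {X} : e * `|\sum_(i < n) D (z i) * H i| <=
     B * (2 * M + n%:R * (L * (14 * e))) + n%:R * (r * e ^+ 2 * M).
  by apply: X => i; rewrite zS; exact: Gr.
(* As [e * n = 1 / 64], the Lipschitz term is [14 / 64 * L], which stays below [L]. *)
have -> : n%:R * (L * (14 * e)) = (e * n%:R) * 14 * L by ring.
have -> : n%:R * (r * e ^+ 2 * M) = (e * n%:R) * (r * e * M) by ring.
have -> : 64 * n%:R = e^-1 by rewrite /e invrK.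
rewrite en => H1; rewrite ler_pdivlMl//; apply: (le_trans H1).
have k1 : 0 <= B * L by rewrite mulr_ge0.
have k2 : 0 <= r * e * M by rewrite !mulr_ge0// ltW.
by rewrite !mulrDr in k1 *; lra.
Qed.

Lemma trilinear_slot1 : (forall x, `|g x| <= A) ->
  `|trilinear a q n D g h| <= 64 * A * (B * (2 * M + L) + r * e * M) * n%:R ^+ 2.
Proof.
move=> gA; rewrite /trilinear -/e exchange_big /=.
have -> : 64 * A * (B * (2 * M + L) + r * e * M) * n%:R ^+ 2 =
  n%:R * (A * (64 * n%:R * (B * (2 * M + L) + r * e * M))) by ring.
apply: norm_sum_bound_fin => j.
have -> : \sum_(i < n) D (xpt e i) * g (ypt e j) * h (quad a q (xpt e i) (ypt e j)) =
  g (ypt e j) * \sum_(i < n) D (xpt e i) * h (quad a q (xpt e i) (ypt e j)).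
  by rewrite mulr_sumr; apply: eq_bigr => i _; ring.
rewrite normrM ler_pM//.
apply: (@slot_bound (xpt e) (fun i => h (quad a q (xpt e i) (ypt e j)))) => // [i|i hi].
  by rewrite /xpt -natr1; ring.
by apply: (le_trans (hL _ _)); rewrite ler_wpM2l// quad_lipschitz_x.
Qed.

Lemma trilinear_slot2 : (forall x, `|f x| <= A) ->
  `|trilinear a q n f D h| <= 64 * A * (B * (2 * M + L) + r * e * M) * n%:R ^+ 2.
Proof.
move=> fA; rewrite /trilinear -/e.
have -> : 64 * A * (B * (2 * M + L) + r * e * M) * n%:R ^+ 2 =
  n%:R * (A * (64 * n%:R * (B * (2 * M + L) + r * e * M))) by ring.
apply: norm_sum_bound_fin => i.
have -> : \sum_(j < n) f (xpt e i) * D (ypt e j) * h (quad a q (xpt e i) (ypt e j)) =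
  f (xpt e i) * \sum_(j < n) D (ypt e j) * h (quad a q (xpt e i) (ypt e j)).
  by rewrite mulr_sumr; apply: eq_bigr => j _; ring.
rewrite normrM ler_pM//.
apply: (@slot_bound (ypt e) (fun j => h (quad a q (xpt e i) (ypt e j)))) => // [j|j hj].
  by rewrite /ypt -natr1; ring.
by apply: (le_trans (hL _ _)); rewrite ler_wpM2l// quad_lipschitz_y.
Qed.
End slots.

(** * Summing the increments over the scales *)

Section telescoping.
Variables (R : realType) (a q b w : R) (N : nat) (F G : nat -> R -> R).
Hypotheses (ha : 48 <= `|a| <= 96) (hq : `|q| <= 1).
Hypotheses (hb : forall k, b ^+ k = 2 ^+ (36 * k)) (w1 : 1 <= w).
Hypothesis Fbound : forall k x, (k <= N)%N -> 0 <= F k x <= 3 * w ^+ k.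
Hypothesis Flip : forall k x y, (k <= N)%N ->
  `|F k x - F k y| <= 24 * b ^+ k * w ^+ k * `|x - y|.
Hypothesis Gtaylor : forall k x h, (k <= N)%N ->
  `|G k (x + h) - G k x - h * F k x| <= 2 * (b ^+ k) ^+ 2 * h ^+ 2.
Hypothesis Gdist : forall k k' x, (k <= k' <= N)%N -> `|G k' x - G k x| <= 3 * (w / b) ^+ k.

Let b2 : 2 <= b.
Proof.
rewrite -[b]expr1 hb -[leLHS]expr1 ler_weXn2l//; lra.
Qed.
Let b0 : 0 < b. Proof. by apply: lt_le_trans b2. Qed.
Let b1 : 1 <= b. Proof. by apply: le_trans b2; lra. Qed.
Let w0 : 0 < w. Proof. by apply: lt_le_trans w1. Qed.

Definition diagonal_form (n k : nat) := trilinear a q n (F (2 * k)) (F (2 * k)) (F k).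

(** The first summand comes from the third slot, where the two densities give 3 * 3 and the
    normalisation [48 * b ^+ 2]; the second one from the two other slots, 192 for each. *)
Definition step_cst : R := 32 * 9 * 48 * b ^+ 2 + 384 * (90 + 12 * b ^+ 4).

Let Fnorm k x : (k <= N)%N -> `|F k x| <= 3 * w ^+ k.
Proof. by move=> kN; have /andP[f0 f1] := Fbound x kN; rewrite ger0_norm. Qed.

(** [F k.+1] varies at scale [b ^- k.+1], whereas the difference has to be controlled at scale
    [b ^- k]. The factor [b] lost in the Lipschitz bound and [b ^+ 2] lost in the Taylor bound are
    absorbed by the normalisation. *)
Let Fdiff_osc k : (k.+1 <= N)%N ->
  oscillating ((2 ^+ (36 * k))^-1) (fun x => (F k.+1 x - F k x) / (48 * b ^+ 2 * w ^+ k.+1))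
    (fun x => (G k.+1 x - G k x) / (48 * b ^+ 2 * w ^+ k.+1)).
Proof.
move=> kN; have kN' := ltnW kN; rewrite -hb.
set Q := 48 * _ * _.
have bk : 1 <= b ^+ k by rewrite exprn_ege1.
have wk : 1 <= w ^+ k by rewrite exprn_ege1.
have bk0 : 0 < b ^+ k by rewrite exprn_gt0.
have wS : w ^+ k <= w ^+ k.+1 by rewrite exprS ler_peMl// ltW// exprn_gt0.
have wS1 : 1 <= w ^+ k.+1 by apply: le_trans wS.
have bS : b <= b ^+ 2 by rewrite expr2 ler_peMl// ltW.
have b21 : 1 <= b ^+ 2 by apply: le_trans bS.
have Q0 : 0 < Q by rewrite !mulr_gt0 ?exprn_gt0.
have QE : b ^+ 2 * w ^+ k.+1 = Q / 48 by rewrite /Q; field.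
have Qw : w ^+ k.+1 <= Q / 48 by rewrite -QE ler_peMl// ltW// exprn_gt0.
have Qb : b ^+ 2 <= Q / 48 by rewrite -QE ler_peMr// ltW// exprn_gt0.
have Qbw : b * w ^+ k.+1 <= Q / 48 by rewrite -QE ler_pM2r// exprn_gt0.
split => [x|x y|x|x y].
- rewrite normrM normfV (gtr0_norm Q0) ler_pdivrMr// mul1r ler_norml.
  by have := Fbound x kN; have := Fbound x kN'; lra.
- rewrite -mulrBl normrM normfV (gtr0_norm Q0) ler_pdivrMr// invrK.
  have -> : F k.+1 x - F k x - (F k.+1 y - F k y) = (F k.+1 x - F k.+1 y) - (F k x - F k y) by ring.
  rewrite (le_trans (ler_normB _ _))// (le_trans (lerD (Flip x y kN) (Flip x y kN')))//.
  rewrite -mulrDl [leRHS]mulrAC ler_wpM2r//.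
  have h1 : b ^+ k.+1 * w ^+ k.+1 <= b ^+ k * (Q / 48).
    by rewrite exprSr -mulrA ler_pM2l.
  have h2 : b ^+ k * w ^+ k <= b ^+ k * (Q / 48) by rewrite ler_pM2l// (le_trans wS).
  by lra.
- rewrite normrM normfV (gtr0_norm Q0) ler_pdivrMr//.
  have kk : (k <= k.+1 <= N)%N by rewrite leqnSn.
  apply: (le_trans (Gdist x kk)); rewrite expr_div_n mulrA mulrC ler_pM2l ?invr_gt0//.
  by lra.
- have -> : (G k.+1 (x + y) - G k (x + y)) / Q - (G k.+1 x - G k x) / Q -
     y * ((F k.+1 x - F k x) / Q) =
    ((G k.+1 (x + y) - G k.+1 x - y * F k.+1 x) - (G k (x + y) - G k x - y * F k x)) / Q by ring.
  rewrite normrM normfV (gtr0_norm Q0) ler_pdivrMr//.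
  rewrite (le_trans (ler_normB _ _))// (le_trans (lerD (Gtaylor x y kN) (Gtaylor x y kN')))//.
  rewrite -mulrDl exprVn invrK [leRHS]mulrAC ler_wpM2r ?sqr_ge0//.
  have h1 : (b ^+ k.+1) ^+ 2 <= (b ^+ k) ^+ 2 * (Q / 48).
    by rewrite (exprSr b k) exprMn ler_pM2l// exprn_gt0.
  have h2 : (b ^+ k) ^+ 2 <= (b ^+ k) ^+ 2 * (Q / 48).
    by rewrite ler_peMr ?sqr_ge0// (le_trans _ Qb).
  by have := sqr_ge0 (b ^+ k); lra.
Qed.

(** The increments of the first two slots are paired with the old third function: at level [k] its
    Lipschitz constant is the smaller one. *)
Let trilinear_split n (f1 f2 g1 g2 h1 h2 : R -> R) :
  trilinear a q n f1 g1 h1 - trilinear a q n f2 g2 h2 =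
  trilinear a q n f1 g1 (fun x => h1 x - h2 x) +
  trilinear a q n (fun x => f1 x - f2 x) g1 h2 +
  trilinear a q n f2 (fun x => g1 x - g2 x) h2.
Proof.
rewrite /trilinear -sumrB -!big_split; apply: eq_bigr => i _ /=.
by rewrite -sumrB -!big_split; apply: eq_bigr => j _ /=; ring.
Qed.

Lemma diagonal_form_step k K : (k < K)%N -> (2 * K <= N)%N ->
  `|diagonal_form (2 ^ (180 * K)) k.+1 - diagonal_form (2 ^ (180 * K)) k| <=
  step_cst * (w ^+ 5) ^+ k.+1 * (2 ^+ k)^-1 * (2 ^ (180 * K))%:R ^+ 2.
Proof.
move=> kK KN.
(* One lattice of [2 ^ (180 * K)] points serves all levels below [K]; this writes its size as
   [U ^ 5 * (U * j0)] with [U = 2 ^ (4 * k)]. *)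
have E : (180 * K = 4 * k * 5 + (4 * k + (180 * K - 24 * k)))%N by (clear -kK KN; lia).
have i1 : (2 * k.+1 <= N)%N by (clear -kK KN; lia).
have i2 : (2 * k <= N)%N by (clear -kK KN; lia).
have i3 : (k.+1 <= N)%N by (clear -kK KN; lia).
have i4 : (k <= N)%N by (clear -kK KN; lia).
have i5 : (4 * k * 20 <= 180 * K)%N by (clear -kK KN; lia).
have i6 : (36 * (5 * k) <= 180 * K)%N by (clear -kK KN; lia).
have i7 : (2 * k <= 2 * k.+1)%N by (clear -kK KN; lia).
have i8 : (3 * k <= 3 * k.+1)%N by (clear -kK KN; lia).
set n := (2 ^ _)%N.
have n0 : (0 < n)%N by rewrite expn_gt0.
pose e : R := (64 * n%:R)^-1.
have e0 : 0 < e by rewrite invr_gt0 mulr_gt0// ltr0n.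
have nR : n%:R = 2 ^+ (180 * K) :> R by rewrite /n natrX.
have eK : e <= (2 ^+ (180 * K))^-1.
  rewrite lef_pV2 ?posrE ?exprn_gt0 ?mulr_gt0 ?ltr0n// nR ler_peMl ?exprn_ge0//; lra.
have eb m : (m <= 180 * K)%N -> e <= (2 ^+ m)^-1.
  move=> mK; apply: (le_trans eK); rewrite lef_pV2 ?posrE ?exprn_gt0//.
  by rewrite ler_weXn2l//; lra.
rewrite /diagonal_form trilinear_split.
have bk : 1 <= b ^+ k by rewrite exprn_ege1.
have wk : 1 <= w ^+ k by rewrite exprn_ege1.
have wk2 : 1 <= w ^+ (2 * k.+1) by rewrite exprn_ege1.
have h2k : 2 ^+ k <= b ^+ k by rewrite lerXn2r// ?nnegrE// ltW.
have P1 : `|trilinear a q n (F (2 * k.+1)) (F (2 * k.+1)) (fun x => F k.+1 x - F k x)| <=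
    32 * (3 * w ^+ (2 * k.+1)) * (3 * w ^+ (2 * k.+1)) * (48 * b ^+ 2 * w ^+ k.+1) * (2 ^+ k)^-1 * n%:R ^+ 2.
  apply: (@trilinear_oscillating R a q k n (2 ^ (180 * K - 24 * k)) _ _ _ _ _ _ (fun x => G k.+1 x - G k x)) => //.
  - by rewrite expn_gt0.
  - by rewrite -expnM -!expnD -E.
  - by rewrite exprVn -exprM; apply: eb.
  - by rewrite mulr_gt0// exprn_gt0.
  - by rewrite mulr_gt0// exprn_gt0.
  - by rewrite !mulr_gt0// exprn_gt0.
  - by move=> x; exact: Fnorm.
  - by move=> x; exact: Fnorm.
  - exact: Fdiff_osc.
pose bnd := 64 * (3 * w ^+ (2 * k.+1)) *
   (3 * (w / b) ^+ (2 * k) * (2 * (3 * w ^+ k) + 24 * b ^+ k * w ^+ k) +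
    (4 * (b ^+ (2 * k.+1)) ^+ 2) * e * (3 * w ^+ k)) * n%:R ^+ 2.
have Gd x : `|G (2 * k.+1) x - G (2 * k) x| <= 3 * (w / b) ^+ (2 * k).
  by apply: Gdist; rewrite i7 i1.
have Gt x y : `|G (2 * k.+1) (x + y) - G (2 * k) (x + y) - (G (2 * k.+1) x - G (2 * k) x) -
    y * (F (2 * k.+1) x - F (2 * k) x)| <= 4 * (b ^+ (2 * k.+1)) ^+ 2 * y ^+ 2.
  have -> : G (2 * k.+1) (x + y) - G (2 * k) (x + y) - (G (2 * k.+1) x - G (2 * k) x) -
    y * (F (2 * k.+1) x - F (2 * k) x) =
    (G (2 * k.+1) (x + y) - G (2 * k.+1) x - y * F (2 * k.+1) x) -
    (G (2 * k) (x + y) - G (2 * k) x - y * F (2 * k) x) by ring.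
  rewrite (le_trans (ler_normB _ _))// (le_trans (lerD (Gtaylor x y i1) (Gtaylor x y i2)))//.
  rewrite -mulrDl ler_wpM2r ?sqr_ge0//.
  have : (b ^+ (2 * k)) ^+ 2 <= (b ^+ (2 * k.+1)) ^+ 2.
    by rewrite -!exprM ler_weXn2l// leq_mul2r i7.
  by lra.
have wb0 : 0 <= w / b by rewrite divr_ge0// ltW.
have P2 : `|trilinear a q n (fun x => F (2 * k.+1) x - F (2 * k) x) (F (2 * k.+1)) (F k)| <= bnd.
  apply: (@trilinear_slot1 R a q n ha hq n0 _ _ _ (fun x => G (2 * k.+1) x - G (2 * k) x)) => //.
  - by rewrite mulr_ge0// exprn_ge0.
  - by rewrite mulr_ge0// exprn_ge0// ltW.
  - by rewrite !mulr_ge0// exprn_ge0// ltW.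
  - by rewrite mulr_ge0// sqr_ge0.
  - by move=> x; exact: Fnorm.
  - by move=> x y; exact: Flip.
  - by move=> x; exact: Fnorm.
have P3 : `|trilinear a q n (F (2 * k)) (fun x => F (2 * k.+1) x - F (2 * k) x) (F k)| <= bnd.
  apply: (@trilinear_slot2 R a q n ha hq n0 _ _ _ (fun x => G (2 * k.+1) x - G (2 * k) x)) => //.
  - by rewrite mulr_ge0// exprn_ge0.
  - by rewrite mulr_ge0// exprn_ge0// ltW.
  - by rewrite !mulr_ge0// exprn_ge0// ltW.
  - by rewrite mulr_ge0// sqr_ge0.
  - by move=> x; exact: Fnorm.
  - by move=> x y; exact: Flip.
  - move=> x; apply: (@le_trans _ _ (3 * w ^+ (2 * k))); first by exact: Fnorm.
    by rewrite ler_pM2l// ler_weXn2l.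
(* The primitive contributes [b ^- (2 * k)] against the Lipschitz constant [b ^+ k]; the mesh
   contributes [b ^- (5 * k)] against the Taylor constant of order [b ^+ (4 * k)]. Both leave
   [b ^- k]. *)
have bnd_le : bnd <= 192 * (90 + 12 * b ^+ 4) * (w ^+ 5) ^+ k.+1 * (2 ^+ k)^-1 * n%:R ^+ 2.
  rewrite /bnd ler_wpM2r ?sqr_ge0//.
  have eb5 : e <= (b ^+ (5 * k))^-1 by rewrite hb; apply: eb.
  have -> : (w ^+ 5) ^+ k.+1 = w ^+ (2 * k.+1) * w ^+ (3 * k.+1).
    by rewrite -exprM -exprD; congr (_ ^+ _); clear; lia.
  have -> : 192 * (90 + 12 * b ^+ 4) * (w ^+ (2 * k.+1) * w ^+ (3 * k.+1)) / 2 ^+ k =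
    64 * (3 * w ^+ (2 * k.+1)) * ((90 + 12 * b ^+ 4) * w ^+ (3 * k.+1) * (2 ^+ k)^-1) by ring.
  rewrite ler_wpM2l ?mulr_ge0 ?exprn_ge0 ?(ltW w0)//.
  pose B := b ^+ k; pose W := w ^+ k.
  have B1 : 1 <= B by []. have W1 : 1 <= W by [].
  have Bn : B != 0 by rewrite gt_eqF// (lt_le_trans _ B1).
  have -> : (w / b) ^+ (2 * k) = W ^+ 2 / B ^+ 2.
    by rewrite expr_div_n mulnC !exprM.
  have bS : b ^+ (2 * k.+1) = b ^+ 2 * B ^+ 2.
    by rewrite /B -exprM -exprD; congr (_ ^+ _); clear; lia.
  have b5 : b ^+ (5 * k) = B ^+ 5 by rewrite mulnC exprM.
  have W3 : W ^+ 3 <= w ^+ (3 * k.+1).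
    by rewrite /W -exprM ler_weXn2l// mulnC.
  rewrite bS -/B -/W; rewrite b5 in eb5.
  have t2 : 4 * (b ^+ 2 * B ^+ 2) ^+ 2 * e * (3 * W) <= 12 * b ^+ 4 * W / B.
    have -> : 12 * b ^+ 4 * W / B = 4 * (b ^+ 2 * B ^+ 2) ^+ 2 * (B ^+ 5)^-1 * (3 * W) by field.
    by rewrite ler_wpM2r ?mulr_ge0 ?exprn_ge0 ?(ltW w0)// ler_wpM2l// mulr_ge0// sqr_ge0.
  have t1 : 3 * (W ^+ 2 / B ^+ 2) * (2 * (3 * W) + 24 * B * W) <= 90 * W ^+ 3 / B.
    have -> : 3 * (W ^+ 2 / B ^+ 2) * (2 * (3 * W) + 24 * B * W) =
      W ^+ 3 / B * (18 / B + 72) by field.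
    have -> : 90 * W ^+ 3 / B = W ^+ 3 / B * 90 by ring.
    rewrite ler_wpM2l ?divr_ge0 ?exprn_ge0 ?(ltW w0) ?(ltW b0)//.
    have : B^-1 <= 1 by rewrite invf_le1// (lt_le_trans _ B1).
    by lra.
  apply: (le_trans (lerD t1 t2)).
  have B0 : 0 < B by rewrite (lt_le_trans _ B1).
  apply: (@le_trans _ _ ((90 + 12 * b ^+ 4) * W ^+ 3 / B)).
    have W13 : W <= W ^+ 3 by rewrite exprS ler_peMr ?(ltW (lt_le_trans ltr01 W1))// exprn_ege1.
    rewrite -subr_ge0.
    have -> : (90 + 12 * b ^+ 4) * W ^+ 3 / B - (90 * W ^+ 3 / B + 12 * b ^+ 4 * W / B) =
      12 * b ^+ 4 * (W ^+ 3 - W) / B by ring.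
    rewrite divr_ge0 ?(ltW B0)// mulr_ge0 ?subr_ge0// mulr_ge0// exprn_ge0//.
    exact: ltW.
  have c0 : 0 <= 90 + 12 * b ^+ 4 by rewrite addr_ge0// mulr_ge0// exprn_ge0// ltW.
  apply: ler_pM.
  - by rewrite mulr_ge0// exprn_ge0// (le_trans _ W1).
  - by rewrite invr_ge0 ltW.
  - by rewrite ler_wpM2l.
  - by rewrite lef_pV2 ?posrE ?exprn_gt0.
have P1' : 32 * (3 * w ^+ (2 * k.+1)) * (3 * w ^+ (2 * k.+1)) * (48 * b ^+ 2 * w ^+ k.+1) * (2 ^+ k)^-1 * n%:R ^+ 2
   = 32 * 9 * 48 * b ^+ 2 * (w ^+ 5) ^+ k.+1 * (2 ^+ k)^-1 * n%:R ^+ 2.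
  have -> : (w ^+ 5) ^+ k.+1 = w ^+ (2 * k.+1) * w ^+ (2 * k.+1) * w ^+ k.+1.
    by rewrite -exprM -!exprD; congr (_ ^+ _); clear; lia.
  by ring.
rewrite P1' in P1.
rewrite (le_trans (ler_normD _ _))//.
have P12 := le_trans (ler_normD _ _) (lerD P1 P2).
apply: (le_trans (lerD P12 P3)); rewrite /step_cst.
set Y := (w ^+ 5) ^+ k.+1 * (2 ^+ k)^-1 * n%:R ^+ 2.
have -> : (32 * 9 * 48 * b ^+ 2 + 384 * (90 + 12 * b ^+ 4)) * (w ^+ 5) ^+ k.+1 / 2 ^+ k * n%:R ^+ 2 =
  32 * 9 * 48 * b ^+ 2 * Y + 2 * (192 * (90 + 12 * b ^+ 4) * Y) by rewrite /Y; ring.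
have -> : 32 * 9 * 48 * b ^+ 2 * (w ^+ 5) ^+ k.+1 / 2 ^+ k * n%:R ^+ 2 =
  32 * 9 * 48 * b ^+ 2 * Y by rewrite /Y; ring.
have bl : bnd <= 192 * (90 + 12 * b ^+ 4) * Y.
  by apply: (le_trans bnd_le); rewrite le_eqVlt /Y; apply/orP; left; apply/eqP; ring.
clear -bl; move: bl; set Z := 192 * _ * Y => bl.
by rewrite -addrA lerD2l; have := lerD bl bl; rewrite -mulr2n mulr_natl.
Qed.

(** As [w ^+ 5 / 2 <= 3 / 4], step [k] loses at most [step_cst * (3 / 2) * (3 / 4) ^+ k], and the
    geometric series sums to [(3 / 2) / (1 - 3 / 4) = 6] times its leading power. *)
Lemma diagonal_form_ge k0 K c : (k0 <= K)%N -> (2 * K <= N)%N -> w ^+ 5 <= 3 / 2 ->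
  c * (2 ^ (180 * K))%:R ^+ 2 <= diagonal_form (2 ^ (180 * K)) k0 ->
  (c - 6 * step_cst * (3 / 4) ^+ k0) * (2 ^ (180 * K))%:R ^+ 2 <=
    diagonal_form (2 ^ (180 * K)) K.
Proof.
move=> k0K KN w5 base; set n := (2 ^ _)%N in base *.
have step0 : 0 <= step_cst.
  have := exprn_ge0 2 (ltW b0); have := exprn_ge0 4 (ltW b0); rewrite /step_cst.
  by move: (b ^+ 2) (b ^+ 4) => x y ? ?; lra.
have H m : (k0 + m <= K)%N -> (c - 6 * step_cst * ((3 / 4) ^+ k0 - (3 / 4) ^+ (k0 + m))) * n%:R ^+ 2 <=
    diagonal_form n (k0 + m).
  elim: m => [|m IH] mK; first by rewrite addn0 subrr mulr0 subr0.
  rewrite addnS in mK *; have := IH (ltnW mK).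
  have := diagonal_form_step mK KN; rewrite -/n ler_norml => /andP[S _] I.
  set k := (k0 + m)%N in S I *.
  have W : (w ^+ 5) ^+ k.+1 * (2 ^+ k)^-1 <= (3 / 2) * (3 / 4) ^+ k.
    have -> : (3 / 2) * (3 / 4) ^+ k = (3 / 2) ^+ k.+1 * (2 ^+ k)^-1 :> R.
      have -> : 3 / 4 = 3 / 2 / 2 :> R by field.
      by rewrite [in LHS]expr_div_n exprS mulrA.
    by rewrite ler_wpM2r ?invr_ge0 ?exprn_ge0// lerXn2r// nnegrE ?exprn_ge0// ltW.
  have n20 : 0 <= n%:R ^+ 2 :> R by rewrite sqr_ge0.
  have W' := ler_wpM2r n20 (ler_wpM2l step0 W).
  rewrite -!mulrA in S; rewrite -!mulrA in W'.
  have E : (3 / 4) ^+ k.+1 = 3 / 4 * (3 / 4) ^+ k :> R by rewrite exprS.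
  rewrite E.
  set T := step_cst * _ in S.
  have -> : (c - 6 * step_cst * ((3 / 4) ^+ k0 - 3 / 4 * (3 / 4) ^+ k)) * n%:R ^+ 2 =
    (c - 6 * step_cst * ((3 / 4) ^+ k0 - (3 / 4) ^+ k)) * n%:R ^+ 2 -
    step_cst * (3 / 2 * ((3 / 4) ^+ k * n%:R ^+ 2)) by field.
  have TT : T <= step_cst * (3 * (2^-1 * ((3 / 4) ^+ k * n%:R ^+ 2))) by [].
  by rewrite -(mulrA 3 2^-1); lra.
have := H (K - k0)%N; rewrite subnKC// => /(_ (leqnn _)); apply: le_trans.
rewrite ler_wpM2r ?sqr_ge0// lerD2l lerN2 ler_wpM2l ?mulr_ge0// lerBlDr lerDl.
by rewrite exprn_ge0//; lra.
Qed.
End telescoping.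

(** * Dyadic content *)

(* The pair [(k, j)] stands for the dyadic interval [j / 2^k, (j + 1) / 2^k[. *)
Definition dyadic := (nat * int)%type.

Section content.
Variable R : realType.
Implicit Types (x y : R) (S : set dyadic) (A B : set R) (c : R).

Definition dyadic_index k x : int := Num.floor (2 ^+ k * x).

Lemma dyadic_index_nested k d x y : dyadic_index (k + d) x = dyadic_index (k + d) y ->
  dyadic_index k x = dyadic_index k y.
Proof.
move=> exy; apply/eqP; rewrite floor_eq.
have d0 : 0 < 2 ^+ d :> R by rewrite exprn_gt0.
set m := dyadic_index k y; have /andP[m1 m2] := floor_itv (2 ^+ k * y).
rewrite -/(dyadic_index k y) -/m in m1 m2.
have /andP[x1 x2] := floor_itv (2 ^+ (k + d) * x).
have /andP[y1 y2] := floor_itv (2 ^+ (k + d) * y).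
rewrite -/(dyadic_index (k + d) x) exy in x1 x2; rewrite -/(dyadic_index (k + d) y) in y1 y2.
set j := dyadic_index (k + d) y in x1 x2 y1 y2.
have kd (z : R) : 2 ^+ (k + d) * z = 2 ^+ d * (2 ^+ k * z) by rewrite exprD; ring.
rewrite !kd in x1 x2 y1 y2.
have dE : (2 ^+ d)%:~R = 2 ^+ d :> R by rewrite rmorphXn.
have mj : m * 2 ^+ d <= j.
  rewrite -(ltzD1) -(ltr_int R); apply: le_lt_trans y2; rewrite intrM dE [leLHS]mulrC.
  by rewrite ler_pM2l.
have jm : j < (m + 1) * 2 ^+ d.
  rewrite -(ltr_int R); apply: (le_lt_trans y1); rewrite intrM dE [ltRHS]mulrC.
  by rewrite ltr_pM2l.
apply/andP; split.
  rewrite -(ler_pM2l d0) (le_trans _ x1)//.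
  by rewrite -dE mulrC -intrM ler_int.
rewrite -(ltr_pM2l d0) (lt_le_trans x2)//.
by rewrite -dE [leRHS]mulrC -intrM ler_int lezD1.
Qed.

Variable tau : R.
Hypothesis tau0 : 0 < tau.

Definition dyadic_covers S A := forall x, A x -> exists k, S (k, dyadic_index k x).

(** Bounds the sum of the weights of a possibly infinite family through its finite subsums. For
    [tau = 2 ^ (- beta)] the weight is the length to the power beta. *)
Definition cost_le S c := forall l : seq dyadic, uniq l -> (forall p, p \in l -> S p) ->
  \sum_(p <- l) tau ^+ p.1 <= c.

Definition content_le A c := exists S, dyadic_covers S A /\ cost_le S c.

Lemma cost_le_ge0 S c : cost_le S c -> 0 <= c.
Proof. by move=> /(_ [::] isT); rewrite big_nil; apply. Qed.

Lemma cost_le_trans S c c' : cost_le S c -> c <= c' -> cost_le S c'.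
Proof. by move=> H cc' l ul lS; apply: le_trans cc'; apply: H. Qed.

Lemma content_le_trans A c c' : content_le A c -> c <= c' -> content_le A c'.
Proof. by move=> [S [SA Sc]] cc'; exists S; split => //; apply: cost_le_trans cc'. Qed.

Lemma content_le_sub A B c : B `<=` A -> content_le A c -> content_le B c.
Proof. by move=> BA [S [SA Sc]]; exists S; split => // x /BA; apply: SA. Qed.

Definition dyadic_meet (I J : dyadic) := exists x, dyadic_index I.1 x = I.2 /\ dyadic_index J.1 x = J.2.

(* [keepl S T] and [keepr S T] together keep the coarsest intervals of the two
   families, and what they discard still covers everything that is covered twice. *)
Definition keepl S T : set dyadic := [set I | S I /\ ~ exists J, [/\ T J, (J.1 <= I.1)%N & dyadic_meet I J]].
Definition keepr S T : set dyadic := [set J | T J /\ ~ exists I, [/\ S I, (I.1 < J.1)%N & dyadic_meet J I]].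
Definition dropl S T : set dyadic := [set I | S I /\ exists J, [/\ T J, (J.1 <= I.1)%N & dyadic_meet I J]].
Definition dropr S T : set dyadic := [set J | T J /\ exists I, [/\ S I, (I.1 < J.1)%N & dyadic_meet J I]].
Definition coarsest S T := keepl S T `|` keepr S T.

(** The coarsest interval around [x] in either family survives. When both families contain it, only
    the copy in [T] is kept, hence the case distinction. *)
Lemma coarsest_level S T x k : (S `|` T) (k, dyadic_index k x) ->
  exists2 k', (k' <= k)%N & coarsest S T (k', dyadic_index k' x).
Proof.
move=> h; pose P k := `[< (S `|` T) (k, dyadic_index k x) >].
have exP : exists k, P k by exists k; apply/asboolP.
case: (ex_minnP exP) => m /asboolP mP mmin.
exists m; first by apply: mmin; apply/asboolP.
have small J : (S `|` T) J -> (J.1 < m)%N -> ~ dyadic_meet (m, dyadic_index m x) J.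
  move=> STJ Jm [y /= [yx yJ]].
  have := mmin J.1; rewrite leqNgt Jm => /(_ _) H; apply: notF; apply: H.
  apply/asboolP; suff -> : dyadic_index J.1 x = J.2 by case: J STJ {Jm yJ}.
  rewrite -yJ; apply: (@dyadic_index_nested _ (m - J.1)).
  by rewrite subnKC// ltnW.
have [Tm|Tm] := pselect (T (m, dyadic_index m x)).
  by right; split => // -[I [SI Im]]; apply: small => //; left.
left; split; first by case: mP.
move=> [J [TJ]]; rewrite leq_eqVlt => /orP[/eqP Jm|Jm] mt; last first.
  by apply: (small J) => //; right.
apply: Tm; case: mt => y /= [yx yJ]; rewrite -yx; case: J TJ Jm yJ => J1 J2 /= TJ J1m.
by rewrite J1m => ->; rewrite -J1m.
Qed.

Lemma drop_covers S T A : dyadic_covers S A -> dyadic_covers T A ->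
  dyadic_covers (dropl S T `|` dropr S T) A.
Proof.
move=> SA TA x Ax; have [k Sk] := SA x Ax; have [k' Tk'] := TA x Ax.
have [kk'|kk'] := leqP k' k.
  by exists k; left; split => //; exists (k', dyadic_index k' x); split => //; exists x.
by exists k'; right; split => //; exists (k, dyadic_index k x); split => //; exists x.
Qed.

(** Strong subadditivity: a finite list of kept intervals and one of dropped intervals together use
    each member of [S] and of [T] at most once. The dropped family costs at least [c0], which is
    saved. *)
Lemma coarsest_cost S T cS cT c0 : cost_le S cS -> cost_le T cT ->
  (forall c, cost_le (dropl S T `|` dropr S T) c -> c0 <= c) ->
  cost_le (coarsest S T) (cS + cT - c0).
Proof.
move=> HS HT H0 l ul lM; rewrite lerBrDr -lerBrDl; apply: H0 => l' ul' lD.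
pose inS p := `[< keepl S T p >]; pose inS' p := `[< dropl S T p >].
have h1 : \sum_(p <- l | inS p) tau ^+ p.1 + \sum_(p <- l' | inS' p) tau ^+ p.1 <= cS.
  rewrite -(big_filter l) -(big_filter l') -big_cat; apply: HS.
    rewrite cat_uniq !filter_uniq//= andbT; apply/hasPn => p.
    rewrite !mem_filter => /andP[/asboolP[_ p1] _]; apply/negP => /andP[/asboolP[_ p2] _].
    by apply: p2.
  by move=> p; rewrite mem_cat !mem_filter => /orP[] /andP[/asboolP[]].
have h2 : \sum_(p <- l | ~~ inS p) tau ^+ p.1 + \sum_(p <- l' | ~~ inS' p) tau ^+ p.1 <= cT.
  have r1 p : p \in l -> ~~ inS p -> keepr S T p by move=> /lM[] // h /asboolP.
  have r2 p : p \in l' -> ~~ inS' p -> dropr S T p by move=> /lD[] // h /asboolP.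
  rewrite -(big_filter l) -(big_filter l') -big_cat; apply: HT.
    rewrite cat_uniq !filter_uniq//= andbT; apply/hasPn => p.
    rewrite !mem_filter => /andP[p1 pl']; apply/negP => /andP[p2 pl].
    by have [_ []] := r1 p pl p2; case: (r2 p pl' p1).
  move=> p; rewrite mem_cat !mem_filter => /orP[] /andP[p1 pl]; first by case: (r1 p pl p1).
  by case: (r2 p pl p1).
by rewrite lerBrDr addrC (bigID inS) [X in _ + X](bigID inS') /=; lra.
Qed.

Definition content A : R := inf [set c | content_le A c].

Lemma content_lb A c : content_le A c -> content A <= c.
Proof.
move=> h; apply: ge_inf => //; exists 0 => d [S [_ Sd]]; exact: cost_le_ge0 Sd.
Qed.

Lemma content_approx A c e : content_le A c -> 0 < e -> content_le A (content A + e).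
Proof.
move=> h e0; have hi : has_inf [set c | content_le A c].
  split; first by exists c.
  by exists 0 => d [S [_ Sd]]; exact: cost_le_ge0 Sd.
have [d /= hd de] := inf_adherent e0 hi.
by apply: content_le_trans hd _; apply: ltW.
Qed.

(* Strong subadditivity ([coarsest_cost]) keeps the successive merged covers almost
   optimal, and each point eventually stays in one and the same interval of them. *)
Lemma content_increasing (A : nat -> set R) c e : (forall n, A n `<=` A n.+1) ->
  (forall n, content_le (A n) c) -> 0 < e -> content_le (\bigcup_n A n) (c + e).
Proof.
move=> Amono Ac e0.
have en n : 0 < e / 2 ^+ n.+1 by rewrite divr_gt0// exprn_gt0.
have /choice[C HC] n : exists S, dyadic_covers S (A n) /\ cost_le S (content (A n) + e / 2 ^+ n.+1).
  by have [S HS] := content_approx (Ac n) (en n); exists S.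
pose W := fix W n := if n is m.+1 then coarsest (W m) (C m.+1) else C 0%N.
have WS n : W n.+1 = coarsest (W n) (C n.+1) by [].
(* Both covers in a merge pay for [A n]; its content is subtracted each time, so that only the
   errors e/2, e/4, ... accumulate. *)
have HW n : dyadic_covers (W n) (A n) /\ cost_le (W n) (content (A n) + e * (1 - (2 ^+ n.+1)^-1)).
  elim: n => [|n [W1 W2]].
    by have [c1 c2] := HC 0%N; split => //; apply: cost_le_trans c2 _; rewrite expr1; lra.
  have [c1 c2] := HC n.+1; rewrite WS; split.
    move=> x Ax; have [k Ck] := c1 x Ax.
    have [k' _ h] := @coarsest_level (W n) (C n.+1) x k (or_intror Ck); by exists k'.
  have dr c' : cost_le (dropl (W n) (C n.+1) `|` dropr (W n) (C n.+1)) c' -> content (A n) <= c'.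
    move=> hc; apply: content_lb; exists (dropl (W n) (C n.+1) `|` dropr (W n) (C n.+1)).
    by split => //; apply: drop_covers => // x /Amono; apply: c1.
  apply: cost_le_trans (coarsest_cost W2 c2 dr) _.
  have E : (2 ^+ n.+2)^-1 = (2 ^+ n.+1)^-1 / 2 :> R by rewrite [in LHS]exprSr invfM.
  by rewrite E; set u := (2 ^+ n.+1)^-1; lra.
pose V : set dyadic := [set I | exists N, forall n, (N <= n)%N -> W n I].
exists V; split.
  move=> x [N _ ANx].
  (* From one merged cover to the next, the interval around [x] can only be replaced by one of no
     higher level. Once the least level reached after [N] occurs, it stays for good. *)
  pose P k := `[< exists2 n, (N <= n)%N & W n (k, dyadic_index k x) >].
  have exP : exists k, P k.
    by have [k hk] := (HW N).1 x ANx; exists k; apply/asboolP; exists N.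
  case: (ex_minnP exP) => k /asboolP[n0 Nn0 Wk] kmin.
  exists k, n0 => n /subnKC <-; elim: (n - n0)%N => [|d IH]; first by rewrite addn0.
  rewrite addnS WS; have [k' k'k h] := @coarsest_level (W (n0 + d)%N) (C (n0 + d).+1) x k (or_introl IH).
  suff -> : k = k' by [].
  apply/eqP; rewrite eqn_leq k'k andbT; apply: kmin; apply/asboolP.
  by exists (n0 + d).+1 => //; rewrite (leq_trans Nn0)// leqW// leq_addr.
move=> l ul lV.
have [N HN] : exists N, forall p, p \in l -> W N p.
  have : exists N, forall p, p \in l -> forall n, (N <= n)%N -> W n p.
    elim: l {ul} lV => [|p l IH] lV; first by exists 0%N.
    have [N1 h1] := lV p (mem_head _ _).
    have [N2 h2] := IH (fun q ql => lV q (mem_behead (s := p :: l) ql)).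
    exists (maxn N1 N2) => q; rewrite inE => /orP[/eqP ->|ql] n; rewrite geq_max => /andP[n1 n2].
      exact: h1.
    exact: h2.
  by move=> [N h]; exists N => p /h; apply.
have := (HW N).2 l ul HN; move/le_trans; apply.
have := content_lb (Ac N); have : 0 < (2 ^+ N.+1)^-1 :> R by rewrite invr_gt0 exprn_gt0.
by set u := (2 ^+ N.+1)^-1; nra.
Qed.
End content.

(** * Null sets by iterated covers *)

Lemma sum_fibers (V : nmodType) (T P : eqType) (l : seq T) (par : T -> P) (F : T -> V) :
  \sum_(q <- l) F q = \sum_(p <- undup (map par l)) \sum_(q <- l | par q == p) F q.
Proof.
rewrite (exchange_big_dep xpredT)//= big_seq [RHS]big_seq; apply: eq_bigr => q ql.
rewrite big_mkcond (bigD1_seq (par q)) ?mem_undup ?map_f ?undup_uniq//= eqxx big1 ?addr0//.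
by move=> p; rewrite eq_sym => /negbTE ->.
Qed.

Section null.
Variables (R : realType) (tau : R).
Hypothesis tau0 : 0 < tau.
Implicit Types (E : set R) (S : set dyadic).

Lemma cost_le_bigcup (P : eqType) (p0 : P) (D : set P) (S : P -> set dyadic) (cst : P -> R) (c : R) :
  (forall p, D p -> cost_le tau (S p) (cst p)) ->
  (forall u : seq P, uniq u -> (forall p, p \in u -> D p) -> \sum_(p <- u) cst p <= c) ->
  cost_le tau [set q | exists p, D p /\ S p q] c.
Proof.
move=> HS Hc l ul lS.
have /choice[par Hpar] q : exists p, (exists p', D p' /\ S p' q) -> D p /\ S p q.
  by have [[p ?]|h] := pselect (exists p', D p' /\ S p' q); [exists p | exists p0].
rewrite (sum_fibers _ par); apply: (@le_trans _ _ (\sum_(p <- undup (map par l)) cst p)).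
  apply: ler_sum_mem => p; rewrite mem_undup => /mapP[q0 /lS/Hpar[Dp _] ->].
  rewrite -big_filter; apply: (HS _ Dp); first exact: filter_uniq.
  by move=> q; rewrite mem_filter => /andP[/eqP <- /lS/Hpar[]].
apply: Hc; first exact: undup_uniq.
by move=> p; rewrite mem_undup => /mapP[q0 /lS/Hpar[Dp _] ->].
Qed.

(* [q] is read relatively to [p], as if [p] were [0, 1[. *)
Definition dyadic_compose (p q : dyadic) : dyadic := ((p.1 + q.1)%N, p.2 * 2 ^+ q.1 + q.2).

Lemma dyadic_compose_index (p : dyadic) k (x : R) :
  dyadic_compose p (k, dyadic_index k x) = ((p.1 + k)%N, dyadic_index (p.1 + k) ((x + p.2%:~R) / 2 ^+ p.1)).
Proof.
rewrite /dyadic_compose /=; congr pair; apply/esym/eqP; rewrite floor_eq.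
have := floor_itv (2 ^+ k * x); rewrite -/(dyadic_index k x) !intrD intrM rmorphXn /= exprD.
have -> : 2 ^+ p.1 * 2 ^+ k * ((x + p.2%:~R) / 2 ^+ p.1) = 2 ^+ k * x + p.2%:~R * 2 ^+ k.
  by field; rewrite expf_neq0.
by lra.
Qed.

Lemma cost_le_compose p S c : cost_le tau S c ->
  cost_le tau [set dyadic_compose p q | q in S] (tau ^+ p.1 * c).
Proof.
move=> HS l ul lS.
have /choice[f Hf] r : exists q, r \in l -> S q /\ dyadic_compose p q = r.
  have [/lS[q Sq <-]|h] := boolP (r \in l); first by exists q.
  by exists (0%N, 0).
have -> : \sum_(r <- l) tau ^+ r.1 = tau ^+ p.1 * \sum_(q <- map f l) tau ^+ q.1.
  rewrite big_map mulr_sumr big_seq [RHS]big_seq; apply: eq_bigr => r /Hf[_ {1}<-].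
  by rewrite /dyadic_compose /= exprD.
rewrite ler_pM2l ?exprn_gt0//; apply: HS.
  rewrite map_inj_in_uniq// => r r' /Hf[_ {2}<-] /Hf[_ {2}<-] -> //.
by move=> q /mapP[r /Hf[? _] ->].
Qed.

(* The part of [E] in the dyadic interval [(m, j)], rescaled to [0, 1[. *)
Definition zoom E m (j : int) : set R := [set x | 0 <= x < 1 /\ E ((x + j%:~R) / 2 ^+ m)].

Lemma zoom_zoom E m j k x : zoom E m j x ->
  zoom E (m + k) (j * 2 ^+ k + dyadic_index k x) (2 ^+ k * x - (dyadic_index k x)%:~R).
Proof.
move=> [x01 Ex]; split.
  by have := floor_itv (2 ^+ k * x); rewrite -/(dyadic_index k x) intrD; lra.
suff -> : (2 ^+ k * x - (dyadic_index k x)%:~R + (j * 2 ^+ k + dyadic_index k x)%:~R) /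
    2 ^+ (m + k) = (x + j%:~R) / 2 ^+ m by [].
rewrite intrD intrM rmorphXn /= exprD; field.
by rewrite !expf_neq0.
Qed.

(** Covers compose: a rescaled cover placed inside each interval of the previous one multiplies the
    cost by [theta]. The level 0 interval weighs 1, more than [theta], so it never occurs and every
    round raises the levels. *)
Lemma zoom_refine E theta : theta < 1 -> (forall m j, content_le tau (zoom E m j) theta) ->
  forall r m j, exists S, [/\ dyadic_covers S (zoom E m j), cost_le tau S (theta ^+ r) &
    forall p, S p -> (r <= p.1)%N].
Proof.
move=> th1 Hth; have th0 : 0 <= theta by have [S [_ /cost_le_ge0]] := Hth 0%N 0.
elim=> [|r IH] m j.
  have [S [S1 S2]] := Hth m j; exists S; split => //.
  by apply: cost_le_trans S2 _; rewrite expr0 ltW.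
have [S [Scov Scost]] := Hth m j.
have Slev p : S p -> (0 < p.1)%N.
  move=> Sp; rewrite lt0n; apply/eqP => p0.
  have := Scost [:: p] isT; rewrite big_seq1 p0 expr0 => H.
  suff : 1 <= theta by rewrite leNgt th1.
  by apply: H => q; rewrite inE => /eqP ->.
have /choice[T HT] (p : dyadic) : exists S', [/\ dyadic_covers S' (zoom E (m + p.1) (j * 2 ^+ p.1 + p.2)),
    cost_le tau S' (theta ^+ r) & forall q, S' q -> (r <= q.1)%N] by exact: IH.
exists [set q | exists p, S p /\ [set dyadic_compose p q' | q' in T p] q]; split.
- move=> x Ex; have [k Sk] := Scov x Ex; have [Tcov _ _] := HT (k, dyadic_index k x).
  have [k' Tk'] := Tcov _ (zoom_zoom k Ex).
  exists (k + k')%N, (k, dyadic_index k x); split => //; eexists; first exact: Tk'.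
  rewrite dyadic_compose_index /= subrK; congr (_, dyadic_index _ _).
  by rewrite mulrC mulKf// expf_neq0.
- apply: (@cost_le_bigcup _ (0%N, 0) S _ (fun p => tau ^+ p.1 * theta ^+ r)).
    by move=> p Sp; apply: cost_le_compose; case: (HT p).
  move=> u uu uS; rewrite -mulr_suml exprS ler_wpM2r ?exprn_ge0//.
  exact: Scost.
- move=> q [p [Sp [q' Tq' <-]]] /=; have [_ _ /(_ _ Tq')] := HT p.
  by have := Slev p Sp; lia.
Qed.

Lemma sum_geometric_le (u : seq nat) : uniq u -> \sum_(i <- u) (2 ^+ i.+1)^-1 <= 1 :> R.
Proof.
move=> uu; have [N uN] : exists N, forall i, i \in u -> (i < N)%N.
  exists (\max_(i <- u) i).+1 => i iu; rewrite ltnS.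
  exact: (@leq_bigmax_seq _ u xpredT id).
have p0 i : 0 <= (2 ^+ i.+1)^-1 :> R by rewrite invr_ge0 exprn_ge0.
have pu : perm_eq u [seq i <- iota 0 N | i \in u].
  apply: uniq_perm => //; first by rewrite filter_uniq// iota_uniq.
  move=> i; rewrite mem_filter mem_iota add0n /=.
  by case: (boolP (i \in u)) => //= /uN.
rewrite (perm_big _ pu) /= big_filter big_mkcond /=.
apply: (@le_trans _ _ (\sum_(i <- iota 0 N) (2 ^+ i.+1)^-1)).
  by apply: ler_sum => i _; case: ifP.
suff -> : \sum_(i <- iota 0 N) (2 ^+ i.+1)^-1 = 1 - (2 ^+ N)^-1 :> R.
  by rewrite gerBl invr_ge0 exprn_ge0.
rewrite -{1}(subn0 N) -/(index_iota 0 N) big_mkord; elim: (N) => [|n IH].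
  by rewrite big_ord0 expr0 invr1 subrr.
rewrite big_ord_recr /= IH exprS; field.
by rewrite expf_neq0.
Qed.

(** A uniform deficit of content at all places and scales makes [E] null; read backwards, it finds a
    zoom of almost maximal content. The cost [e] is shared among the unit intervals through
    [pickle]. *)
Lemma content_null_cover E theta (e : R) r0 : theta < 1 ->
  (forall m j, content_le tau (zoom E m j) theta) -> 0 < e ->
  exists S, [/\ dyadic_covers S E, cost_le tau S e & forall p, S p -> (r0 <= p.1)%N].
Proof.
move=> th1 Hth e0; have th0 : 0 <= theta by have [S [_ /cost_le_ge0]] := Hth 0%N 0.
have /choice[T HT] (j : int) : exists S, [/\ dyadic_covers S (zoom E 0 j),
     cost_le tau S (e / 2 ^+ (pickle j).+1) & forall p, S p -> (r0 <= p.1)%N].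
  have c0 : 0 < e / 2 ^+ (pickle j).+1 by rewrite divr_gt0// exprn_gt0.
  have [r [rr0 hr]] : exists r, (r0 <= r)%N /\ theta ^+ r <= e / 2 ^+ (pickle j).+1.
    have : (fun n => theta ^+ n) @ \oo --> (0 : R) by apply: cvg_expr; rewrite ger0_norm.
    move=> /cvgrPdist_le /(_ _ c0)[N _ HN]; exists (maxn r0 N); split; first exact: leq_maxl.
    have := HN (maxn r0 N) (leq_maxr _ _) => /=.
    by rewrite sub0r normrN ger0_norm// exprn_ge0.
  have [S [S1 S2 S3]] := zoom_refine th1 Hth r 0 j; exists S; split => //.
    exact: cost_le_trans S2 hr.
  by move=> p /S3; apply: leq_trans.
exists [set q | exists j, setT j /\ [set dyadic_compose (0%N, j) q' | q' in T j] q]; split.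
- move=> x Ex; set j := Num.floor x.
  have [Tcov _ _] := HT j.
  have zx : zoom E 0 j (x - j%:~R).
    split; last by rewrite subrK expr0 divr1.
    by have := floor_itv x; rewrite -/j intrD; lra.
  have [k Tk] := Tcov _ zx; exists k, j; split => //; eexists; first exact: Tk.
  by rewrite dyadic_compose_index /= add0n expr0 divr1 subrK.
- apply: (@cost_le_bigcup _ 0 setT _ (fun j => e / 2 ^+ (pickle j).+1)).
    move=> j _; have [_ Tc _] := HT j; have := @cost_le_compose (0%N, j) _ _ Tc.
    by rewrite expr0 mul1r.
  move=> u uu _; rewrite -mulr_sumr ler_piMr ?(ltW e0)//.
  rewrite -(big_map pickle xpredT (fun i => (2 ^+ i.+1)^-1)); apply: sum_geometric_le.
  by rewrite map_inj_uniq//; exact: pcan_inj pickleK.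
- by move=> q [j [_ [q' Tq' <-]]] /=; have [_ _ /(_ _ Tq')] := HT j.
Qed.
End null.

(** * Frostman measures from maximal flows on the dyadic tree *)

Lemma dyadic_index_child (R : realType) k (x : R) :
  dyadic_index k.+1 x = dyadic_index k x * 2 \/ dyadic_index k.+1 x = dyadic_index k x * 2 + 1.
Proof.
have := floor_itv (2 ^+ k * x); have := floor_itv (2 ^+ k.+1 * x).
rewrite -/(dyadic_index k x) -/(dyadic_index k.+1 x) exprS -mulrA.
set i := dyadic_index k x; set j := dyadic_index k.+1 x; rewrite !intrD => /andP[a1 a2] /andP[b1 b2].
have h1 : i * 2 < j + 1.
  by rewrite -(ltr_int R) intrD intrM; apply: le_lt_trans a2; lra.
have h2 : j < i * 2 + 2.
  by rewrite -(ltr_int R) intrD intrM; apply: (le_lt_trans a1); lra.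
by clear -h1 h2; lia.
Qed.

Lemma dyadic_index_parent (R : realType) k (i : int) (x : R) :
  (dyadic_index k.+1 x = i * 2 \/ dyadic_index k.+1 x = i * 2 + 1) -> dyadic_index k x = i.
Proof. by have := dyadic_index_child k x; lia. Qed.

Section frostman_flow.
Variables (R : realType) (kappa : R) (A : set R).
Hypothesis kappa0 : 0 < kappa.
Let tau := kappa / 2.
Let tau0 : 0 < tau. Proof. by rewrite divr_gt0. Qed.

(* [s] is a measure on the part of [A] in the dyadic interval [(k, i)] that
   obeys the Frostman condition down to level [k + d], and [T] is a cover of that
   part whose cost equals the mass of [s]: max-flow equals min-cut on a tree. *)
Let flow_cut k i d (s : seq (R * R)) (T : seq dyadic) :=
  [/\ forall p, p \in s -> [/\ 0 <= p.2, A p.1 & dyadic_index k p.1 = i],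
      forall k' j, (k <= k' <= k + d)%N -> cell_mass s k' j <= tau ^+ k',
      forall x, A x -> dyadic_index k x = i -> exists k', (k', dyadic_index k' x) \in T &
      \sum_(p <- T) tau ^+ p.1 = \sum_(p <- s) p.2].

Let flow_cut_leaf k i : exists s T, flow_cut k i 0 s T.
Proof.
have [[x [Ax xi]]|h] := pselect (exists x, A x /\ dyadic_index k x = i); last first.
  exists [::], [::]; split => //; last by rewrite !big_nil.
    by move=> k' j _; rewrite /cell_mass big_nil exprn_ge0// ltW.
  by move=> x Ax xi; exfalso; apply: h; exists x.
exists [:: (x, tau ^+ k)], [:: (k, i)]; split.
- by move=> p; rewrite inE => /eqP -> /=; split => //; rewrite exprn_ge0// ltW.
- move=> k' j; rewrite addn0 -eqn_leq => /eqP <-.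
  by rewrite /cell_mass big_mkcond big_seq1; case: ifP => _ //=; rewrite exprn_ge0// ltW.
- by move=> y Ay yi; exists k; rewrite yi inE.
- by rewrite !big_seq1.
Qed.

Let cell_mass_far (s : seq (R * R)) k' j : (forall p, p \in s -> dyadic_index k' p.1 != j) ->
  cell_mass s k' j = 0.
Proof.
move=> h; rewrite /cell_mass big_seq_cond big_pred0// => p.
by apply/negbTE; rewrite negb_and; case: (boolP (p \in s)) => //= /h.
Qed.

(** If the two children together respect the capacity [tau ^+ k], flows and cuts are united;
    otherwise the flow is scaled down to the capacity and the parent alone is the cut. *)
Let flow_cut_node k i d s0 T0 s1 T1 : flow_cut k.+1 (i * 2) d s0 T0 ->
  flow_cut k.+1 (i * 2 + 1) d s1 T1 -> exists s T, flow_cut k i d.+1 s T.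
Proof.
move=> [a1 a2 a3 a4] [b1 b2 b3 b4].
pose t := \sum_(p <- s0) p.2 + \sum_(p <- s1) p.2.
have sp0 p : p \in s0 -> dyadic_index k p.1 = i.
  by move=> /a1[_ _ h]; apply: dyadic_index_parent; left.
have sp1 p : p \in s1 -> dyadic_index k p.1 = i.
  by move=> /b1[_ _ h]; apply: dyadic_index_parent; right.
have t0 : 0 <= t.
  by rewrite addr_ge0// big_seq sumr_ge0// => p; [move=> /a1[]|move=> /b1[]].
have deep k' j : (k.+1 <= k' <= k.+1 + d)%N -> cell_mass (s0 ++ s1) k' j <= tau ^+ k'.
  move=> kk'; rewrite /cell_mass big_cat /= -!/(cell_mass _ _ _).
  have [[p [ps pj]]|h] := pselect (exists p, p \in s0 /\ dyadic_index k' p.1 = j).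
    rewrite (@cell_mass_far s1) ?addr0 ?a2// => p' p's; apply/eqP => p'j.
    have : dyadic_index k.+1 p.1 = dyadic_index k.+1 p'.1.
      apply: (@dyadic_index_nested _ _ (k' - k.+1)).
      by case/andP: kk' => kk' _; rewrite subnKC// pj p'j.
    by have [_ _ ->] := a1 p ps; have [_ _ ->] := b1 p' p's; clear; lia.
  rewrite (@cell_mass_far s0) ?add0r ?b2// => p ps; apply/eqP => pj.
  by apply: h; exists p.
have [tk|tk] := lerP t (tau ^+ k).
  exists (s0 ++ s1), (T0 ++ T1); split.
  - move=> p; rewrite mem_cat => /orP[ps|ps].
      by have [? ? _] := a1 p ps; split => //; apply: sp0.
    by have [? ? _] := b1 p ps; split => //; apply: sp1.
  - move=> k' j; rewrite addnS -addSn leq_eqVlt => /andP[/orP[/eqP <- _|h1 h2]]; last by apply: deep; rewrite h1.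
    apply: le_trans tk; rewrite /t -big_cat /= /cell_mass big_mkcond; apply: ler_sum_mem => p ps.
    case: ifP => // _; move: ps; rewrite mem_cat => /orP[/a1[]|/b1[]]//.
  - move=> x Ax xi; have := dyadic_index_child k x; rewrite xi => -[] h.
      by have [k' hk'] := a3 x Ax h; exists k'; rewrite mem_cat hk'.
    by have [k' hk'] := b3 x Ax h; exists k'; rewrite mem_cat hk' orbT.
  - by rewrite !big_cat /= a4 b4.
have t1 : 0 < t by apply: lt_trans tk; rewrite exprn_gt0.
pose l := tau ^+ k / t.
have l0 : 0 <= l by rewrite divr_ge0 ?exprn_ge0// ltW.
have l1 : l <= 1 by rewrite ler_pdivrMr// mul1r ltW.
pose s := [seq (p.1, l * p.2) | p <- s0 ++ s1].
have cmE k' j : cell_mass s k' j = l * cell_mass (s0 ++ s1) k' j.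
  by rewrite /cell_mass big_map mulr_sumr.
have tot : \sum_(p <- s) p.2 = tau ^+ k.
  rewrite big_map -mulr_sumr big_cat /= -/t /l; field; by rewrite gt_eqF.
exists s, [:: (k, i)]; split.
- move=> p /mapP[p' p's ->] /=; move: p's; rewrite mem_cat => /orP[ps|ps].
    by have [? ? _] := a1 p' ps; split => //; [rewrite mulr_ge0|apply: sp0].
  by have [? ? _] := b1 p' ps; split => //; [rewrite mulr_ge0|apply: sp1].
- move=> k' j; rewrite addnS -addSn leq_eqVlt => /andP[/orP[/eqP <- _|h1 h2]].
    rewrite -tot /cell_mass big_mkcond; apply: ler_sum_mem => p /mapP[p' p's ->] /=.
    case: ifP => // _; rewrite mulr_ge0//.
    by move: p's; rewrite mem_cat => /orP[/a1[]|/b1[]].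
  rewrite cmE; apply: (@le_trans _ _ (l * tau ^+ k')).
    by rewrite ler_wpM2l// deep// h1.
  by rewrite ler_piMl// exprn_ge0// ltW.
- by move=> x Ax xi; exists k; rewrite xi inE.
- by rewrite big_seq1 tot.
Qed.

Let flow_cut_exists d : forall k i, exists s T, flow_cut k i d s T.
Proof.
elim: d => [|d IH] k i; first exact: flow_cut_leaf.
have [s0 [T0 h0]] := IH k.+1 (i * 2); have [s1 [T1 h1]] := IH k.+1 (i * 2 + 1).
exact: flow_cut_node h0 h1.
Qed.

Lemma frostman_exists c n : A `<=` [set x | 0 <= x < 1] -> ~ content_le tau A c ->
  exists s, [/\ frostman kappa n s, forall p, p \in s -> A p.1 & c <= \sum_(p <- s) p.2].
Proof.
move=> A01 Ac; have [s [T [h1 h2 h3 h4]]] := flow_cut_exists n 0 0.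
have idx0 x : A x -> dyadic_index 0 x = 0.
  by move=> /A01 /= x01; apply/eqP; rewrite floor_eq expr0 mul1r.
exists s; split.
- split; first by move=> p /h1[? /A01].
  by move=> k j kn; apply: h2.
- by move=> p /h1[].
- rewrite leNgt; apply/negP => cs; apply: Ac; exists [set p | p \in T]; split.
    by move=> x Ax; have [k' hk'] := h3 x Ax (idx0 x Ax); exists k'.
  move=> l ul lT; apply: le_trans (ltW cs); rewrite -h4.
  (* [T] may list an interval twice, which only raises its sum; [undup] makes it comparable with
     [l]. *)
  have pl : perm_eq l [seq p <- undup T | p \in l].
    apply: uniq_perm => //; first by rewrite filter_uniq// undup_uniq.
    by move=> p; rewrite mem_filter mem_undup; case: (boolP (p \in l)) => //= /lT.
  have w0 (p : dyadic) : 0 <= tau ^+ p.1 by rewrite exprn_ge0// ltW.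
  rewrite (perm_big _ pl) /= big_filter; apply: (@le_trans _ _ (\sum_(p <- undup T) tau ^+ p.1)).
    by rewrite big_mkcond; apply: ler_sum => p _; case: ifP.
  elim: (T) => [|p T' IH] /=; first by rewrite !big_nil.
  by case: ifP => _; rewrite !big_cons ?lerD2l//; apply: (le_trans IH); rewrite lerDr.
Qed.
End frostman_flow.

(** * From dyadic covers to Hausdorff measure *)

Section hausdorff_null.
Local Open Scope ereal_scope.
Variables (R : realType) (beta : R).
Hypothesis beta0 : (0 <= beta)%R.
Let tau : R := (2 `^ (- beta))%R.

Let tau0 : (0 < tau)%R. Proof. exact: powR_gt0. Qed.

Definition dyadic_cell (p : dyadic) : set R := [set x | dyadic_index p.1 x = p.2].

Lemma diam_ge0 (U : set R) : 0 <= diam U.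
Proof. by apply: ereal_sup_ubound; left. Qed.

Lemma diam_dyadic_cell (p : dyadic) : diam (dyadic_cell p) <= ((2 ^+ p.1)^-1)%:E.
Proof.
apply: ge_ereal_sup => _ [->|[x xp [y yp <-]]]; rewrite lee_fin ?invr_ge0 ?exprn_ge0//.
have := floor_itv (2 ^+ p.1 * x)%R; have := floor_itv (2 ^+ p.1 * y)%R.
rewrite -/(dyadic_index p.1 x) -/(dyadic_index p.1 y) xp yp => /andP[a1 a2] /andP[b1 b2].
have p0 : (0 < 2 ^+ p.1 :> R)%R by rewrite exprn_gt0.
rewrite -(ler_pM2l p0) mulfV ?gt_eqF// -{1}(gtr0_norm p0) -normrM mulrBr ler_norml.
by rewrite !intrD in a2 b2; lra.
Qed.

Lemma diam_pow_ge0 (U : set R) : 0 <= diam_pow beta U.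
Proof. by rewrite /diam_pow; case: ifP => // _; exact: poweR_ge0. Qed.

Lemma diam_pow_dyadic_cell (p : dyadic) : diam_pow beta (dyadic_cell p) <= (tau ^+ p.1)%:E.
Proof.
rewrite /diam_pow; case: ifP => _; first by rewrite lee_fin exprn_ge0// ltW.
have -> : (tau ^+ p.1)%:E = ((2 ^+ p.1)^-1)%:E `^ beta.
  have -> : (2 ^+ p.1)^-1%R = (2 `^ (- p.1%:R))%R :> R by rewrite powRN powR_mulrn.
  rewrite -(powR_mulrn _ (powR_ge0 2 _)).
  by rewrite poweR_EFin -[in LHS]powRrM -powRrM !mulNr mulrC.
apply: gt0_ler_poweR => //; rewrite ?in_itv /= ?diam_ge0 ?leey ?lee_fin ?invr_ge0 ?exprn_ge0//.
exact: diam_dyadic_cell.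
Qed.

Lemma hausdorff_premeasure_ge0 delta (A : set R) : 0 <= hausdorff_premeasure beta delta A.
Proof.
apply: le_ereal_inf_tmp => _ [U _ <-].
by apply: nneseries_ge0 => n _ _; exact: diam_pow_ge0.
Qed.

Lemma hausdorff_measure_null (E : set R) :
  (forall (e : R) r0, (0 < e)%R ->
    exists S, [/\ dyadic_covers S E, cost_le tau S e & forall p, S p -> (r0 <= p.1)%N]) ->
  hausdorff_measure beta E = 0.
Proof.
move=> Hnull; suff pre0 delta : (0 < delta)%R -> hausdorff_premeasure beta delta E = 0.
  apply/eqP; rewrite eq_le; apply/andP; split.
    by apply: ge_ereal_sup => _ [d /= d0 <-]; rewrite pre0.
  by rewrite -(pre0 1%R)//; apply: ereal_sup_ubound; exists 1%R => //=.
move=> d0; apply/eqP; rewrite eq_le hausdorff_premeasure_ge0 andbT.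
apply/lee_addgt0Pr => e e0; rewrite add0e.
have [r0 Hr0] : exists r0, forall r, (r0 <= r)%N -> ((2 ^+ r)^-1 <= delta :> R)%R.
  have : (fun n => (2^-1 : R) ^+ n)%R @ \oo --> (0 : R)%R.
    by apply: cvg_expr; rewrite ger0_norm ?invr_ge0//; lra.
  move=> /cvgrPdist_le /(_ _ d0)[N _ HN]; exists N => r Nr.
  have := HN r Nr => /=; rewrite sub0r normrN ger0_norm ?exprn_ge0 ?invr_ge0//.
  by rewrite exprVn.
have [S [Scov Scost Slev]] := Hnull e r0 e0.
(* The family [S] is enumerated through [pickle_inv]; numbers that code no member of [S] receive the
   empty set, of weight 0 for every exponent. *)
pose U n : set R := if (pickle_inv n : option dyadic) is Some p then
  (if `[< S p >] then dyadic_cell p else set0) else set0.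
apply: (@le_trans _ _ (\sum_(0 <= k <oo) diam_pow beta (U k))).
  apply: ereal_inf_lbound; exists U => //; split.
    have dset0 : diam (set0 : set R) <= delta%:E.
      by apply: ge_ereal_sup => _ [->|[x []]]; rewrite lee_fin ltW.
    move=> k; rewrite /U; case: pickle_inv => // p; case: asboolP => // Sp.
    by apply: (le_trans (diam_dyadic_cell p)); rewrite lee_fin Hr0// Slev.
  move=> x Ex; have [k Sk] := Scov x Ex; exists (pickle (k, dyadic_index k x)) => //.
  by rewrite /U pickleK_inv; case: asboolP.
apply: lime_le; first by apply: is_cvg_nneseries => n _ _; exact: diam_pow_ge0.
apply: nearW => n.
pose l := [seq p <- pmap (@pickle_inv dyadic) (iota 0 n) | `[< S p >]].
apply: (@le_trans _ _ (\sum_(p <- l) tau ^+ p.1)%:E); last first.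
  rewrite lee_fin; apply: Scost.
    rewrite filter_uniq//; apply: (@pmap_uniq _ _ _ pickle); last exact: iota_uniq.
    exact: pickle_invK.
  by move=> p; rewrite mem_filter => /andP[/asboolP].
rewrite /l -sumEFin big_filter; rewrite /index_iota subn0.
elim: (iota 0 n) => [|m s IH]; first by rewrite !big_nil.
rewrite big_cons /= /U.
case: (pickle_inv m) => [p|] /=; last first.
  by rewrite /diam_pow eqxx add0e.
rewrite big_cons; case: asboolP => Sp; last by rewrite /diam_pow eqxx add0e.
by apply: leeD => //; exact: diam_pow_dyadic_cell.
Qed.

End hausdorff_null.

(** * Souslin sets *)

Section souslin_sets.
Variable R : realType.
Implicit Types (E : set R) (F : (nat -> nat) -> set R).

(** The complement is open in the product of Baire space and the line, spelled out with basic
    neighbourhoods. *)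
Definition closed_rel F := forall sigma x, ~ F sigma x -> exists n (r : R), 0 < r /\
  forall sigma' y, (forall i, (i < n)%N -> sigma' i = sigma i) -> `|y - x| < r -> ~ F sigma' y.

(* Projections of closed subsets of Baire space times the line. *)
Definition souslin E := exists F, closed_rel F /\ E = [set x | exists sigma, F sigma x].

Lemma souslin_bigcup (E : nat -> set R) : (forall n, souslin (E n)) -> souslin (\bigcup_n E n).
Proof.
move=> /choice[F HF]; exists (fun sigma => F (sigma 0%N) (fun n => sigma n.+1)); split.
  move=> sigma x; have [Fcl _] := HF (sigma 0%N) => /Fcl[n [r [r0 H]]].
  exists n.+1, r; split => // sigma' y agree yx; rewrite agree//.
  by apply: H => // i ni; rewrite agree.
apply/seteqP; split => x.
  move=> [n _ Ex]; have [_ En] := HF n; rewrite En in Ex.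
  by case: Ex => sigma Fs; exists (fun m => if m is m'.+1 then sigma m' else n).
move=> [sigma Fs]; exists (sigma 0%N) => //; have [_ ->] := HF (sigma 0%N).
by eexists; exact: Fs.
Qed.

(** One sequence codes countably many by pairing indices. The relation stays closed because finitely
    many terms of one component depend on finitely many terms of the code. *)
Lemma souslin_bigcap (E : nat -> set R) : (forall n, souslin (E n)) -> souslin (\bigcap_n E n).
Proof.
move=> /choice[F HF].
exists (fun sigma => [set x | forall n, F n (fun i => sigma (pickle (n, i))) x]); split.
  move=> sigma x /existsNP[n Fn]; have [Fcl _] := HF n.
  have [N [r [r0 H]]] := Fcl _ _ Fn.
  exists (\max_(i < N) pickle (n, i : nat)).+1, r; split => // sigma' y agree yx /(_ n).
  apply: H => // i iN; apply: agree; rewrite ltnS.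
  exact: (@leq_bigmax _ (fun i : 'I_N => pickle (n, i : nat)) (Ordinal iN)).
apply/seteqP; split => x.
  move=> Ex; have /choice[s Hs] n : exists sigma, F n sigma x.
    by have [_ En] := HF n; have := Ex n I; rewrite En.
  exists (fun m => if (unpickle m : option (nat * nat)) is Some p then s p.1 p.2 else 0%N) => n.
  suff -> : (fun i => if (unpickle (pickle (n, i)) : option (nat * nat)) is Some p then s p.1 p.2 else 0%N) = s n by [].
  by apply/funext => i; rewrite pickleK.
move=> [sigma Fs] n _; have [_ ->] := HF n.
by exists (fun i => sigma (pickle (n, i))).
Qed.

Lemma souslin_ocitv (a b : R) : souslin `]a, b]%classic.
Proof.
exists (fun sigma => [set x | a + (sigma 0%N).+1%:R^-1 <= x <= b]); split.
  move=> sigma x /negP; rewrite negb_and -!ltNge => /orP[xa|xb].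
    exists 1%N, (a + (sigma 0%N).+1%:R^-1 - x); split; first by rewrite subr_gt0.
    move=> s' y agree yx; rewrite /= agree// => /andP[h _].
    move: yx h; rewrite ltr_norml => /andP[_].
    by move: ((sigma 0%N).+1%:R^-1) => t h1 h2; lra.
  exists 1%N, (x - b); split; first by rewrite subr_gt0.
  move=> s' y agree yx /andP[_ h].
  by move: yx; rewrite ltr_norml => /andP[yx _]; lra.
apply/seteqP; split => x /=; rewrite in_itv /=.
  move=> /andP[ax xb]; have xa0 : 0 < x - a by rewrite subr_gt0.
  have [n hn] : exists n : nat, n.+1%:R^-1 < x - a.
    exists (Num.truncn (x - a)^-1); rewrite invf_plt ?posrE//.
    exact: truncnS_gt.
  by exists (fun=> n); rewrite xb andbT -lerBrDl ltW.
move=> [sigma /andP[ax xb]]; rewrite xb andbT; apply: lt_le_trans ax.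
by rewrite ltrDl invr_gt0.
Qed.

Lemma souslin_ocitvC (a b : R) : souslin (~` `]a, b]%classic).
Proof.
exists (fun sigma => [set x | (x <= a) || (b + (sigma 0%N).+1%:R^-1 <= x)]); split.
  move=> sigma x /negP; rewrite negb_or -!ltNge => /andP[xa xb].
  exists 1%N, (Num.min (x - a) (b + (sigma 0%N).+1%:R^-1 - x)); split.
    by rewrite lt_min !subr_gt0 xa.
  move=> s' y agree; rewrite lt_min /= agree// !ltr_norml.
  move=> /andP[/andP[h1 _] /andP[_]]; move: ((sigma 0%N).+1%:R^-1) => t h2 /orP[]; lra.
apply/seteqP; split => x /=; rewrite in_itv /=.
  move=> /negP; rewrite negb_and -leNgt -ltNge => /orP[->|bx]; first by exists (fun=> 0%N).
  have xb0 : 0 < x - b by rewrite subr_gt0.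
  have [n hn] : exists n : nat, n.+1%:R^-1 < x - b.
    exists (Num.truncn (x - b)^-1); rewrite invf_plt ?posrE//.
    exact: truncnS_gt.
  by exists (fun=> n); apply/orP; right; rewrite -lerBrDl ltW.
move=> [sigma /orP[xa|bx]]; apply/negP; rewrite negb_and -leNgt -ltNge ?xa//.
by apply/orP; right; apply: lt_le_trans bx; rewrite ltrDl invr_gt0.
Qed.

(** The induction runs over the sets that are Souslin together with their complements: this class is
    a sigma-algebra and contains the half-open intervals. *)
Lemma measurable_souslin E : measurable E -> souslin E.
Proof.
move=> mE; suff : (souslin E /\ souslin (~` E)) by case.
apply: (@smallest_sub _ (@sigma_algebra R setT) (@ocitv R) [set A | souslin A /\ souslin (~` A)]) => //; last first.
  by move=> _ [[a b] _ <-] /=; split; [exact: souslin_ocitv|exact: souslin_ocitvC].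
split => /=.
- have -> : set0 = `]0, 0]%classic :> set R by rewrite set_itvoc0.
  by split; [exact: souslin_ocitv|exact: souslin_ocitvC].
- by move=> A [A1 A2]; rewrite setTD setCK.
- move=> A HA; split; first by apply: souslin_bigcup => n; case: (HA n).
  by rewrite setC_bigcup; apply: souslin_bigcap => n; case: (HA n).
Qed.

Variable tau : R.

(* The sequences that are dominated by [b] form a compact set. *)
Definition bounded_part F (b : seq nat) (Z : set R) : set R :=
  [set x | Z x /\ exists sigma, F sigma x /\ forall i, (i < size b)%N -> (sigma i <= nth 0%N b i)%N].

(** The bounds are chosen one term at a time. As the bound on the next term grows, the sets increase
    to the previous one, so by [content_increasing] some finite bound halves the remaining margin at
    worst. *)
Lemma bounded_part_content F Z c c' : c < c' ->
  ~ content_le tau (Z `&` [set x | exists sigma, F sigma x]) c' ->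
  exists b : nat -> nat, forall n, ~ content_le tau (bounded_part F (mkseq b n) Z) c.
Proof.
move=> cc' Hc'; pose eps n : R := (c' - c) / 2 ^+ n.
have eps0 n : 0 < eps n by rewrite divr_gt0 ?subr_gt0// exprn_gt0.
have epsS n : eps n = eps n.+1 + eps n.+1.
  by rewrite /eps exprS; field; rewrite expf_neq0.
have step b : ~ content_le tau (bounded_part F b Z) (c + eps (size b)) ->
    exists m, ~ content_le tau (bounded_part F (rcons b m) Z) (c + eps (size b).+1).
  move=> h; apply: contrapT => /forallNP h'; apply: h.
  have inc m : bounded_part F (rcons b m) Z `<=` bounded_part F (rcons b m.+1) Z.
    move=> x [Zx [sigma [Fs sb]]]; split => //; exists sigma; split => // i.
    rewrite size_rcons => isz; have := sb i; rewrite size_rcons => /(_ isz).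
    rewrite !nth_rcons; case: ltnP => // _; case: eqP => // _; exact: leqW.
  have lec m : content_le tau (bounded_part F (rcons b m) Z) (c + eps (size b).+1).
    by apply: contrapT; exact: h'.
  have := content_increasing inc lec (eps0 (size b).+1).
  rewrite -addrA -epsS; apply: content_le_sub => x [Zx [sigma [Fs sb]]].
  exists (sigma (size b)) => //; split => //; exists sigma; split => // i.
  rewrite size_rcons ltnS leq_eqVlt nth_rcons => /orP[/eqP ->|ib].
    by rewrite ltnn eqxx.
  by rewrite ib sb.
have /choice[f Hf] b : exists m, ~ content_le tau (bounded_part F b Z) (c + eps (size b)) ->
    ~ content_le tau (bounded_part F (rcons b m) Z) (c + eps (size b).+1).
  have [/step[m hm]|hb] := pselect (~ content_le tau (bounded_part F b Z) (c + eps (size b))).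
    by exists m.
  by exists 0%N.
pose s := fix s n := if n is m.+1 then rcons (s m) (f (s m)) else [::].
have sz n : size (s n) = n by elim: n => //= n IH; rewrite size_rcons IH.
have Hs n : ~ content_le tau (bounded_part F (s n) Z) (c + eps n).
  elim: n => [|n IH] /=.
    rewrite /eps expr0 divr1 addrC subrK => h; apply: Hc'; apply: content_le_sub h.
    by move=> x [Zx [sigma Fs]]; split => //; exists sigma.
  by have := Hf (s n); rewrite sz; apply.
have sE n : s n = mkseq (fun i => f (s i)) n.
  by elim: n => //= n IH; rewrite mkseqS -IH.
exists (fun i => f (s i)) => n; rewrite -sE => h; apply: (Hs n).
by apply: content_le_trans h _; rewrite lerDl ltW.
Qed.

Lemma bounded_part_antitone F Z (b : nat -> nat) n n' : (n <= n')%N ->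
  bounded_part F (mkseq b n') Z `<=` bounded_part F (mkseq b n) Z.
Proof.
move=> nn' x [Zx [sigma [Fs sb]]]; split => //; exists sigma; split => // i.
rewrite size_mkseq => im; have := sb i; rewrite size_mkseq => /(_ (leq_trans im nn')).
by rewrite !nth_mkseq// (leq_trans im).
Qed.

(* Koenig's lemma extracts a limit of the witnesses. *)
Lemma bounded_part_limit F Z (b : nat -> nat) x : closed_rel F ->
  (forall n (e : R), 0 < e -> exists2 y, bounded_part F (mkseq b n) Z y & `|y - x| < e) ->
  exists sigma, F sigma x.
Proof.
move=> Fcl H.
have /choice[w Hw] n : exists w : (nat -> nat) * R, [/\ F w.1 w.2,
    forall i, (i < n)%N -> (w.1 i <= b i)%N & `|w.2 - x| < n.+1%:R^-1].
  have n0 : 0 < n.+1%:R^-1 :> R by rewrite invr_gt0.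
  have [y [Zy [sigma [Fs sb]]] yx] := H n _ n0; exists (sigma, y); split => //= i im.
  by have := sb i; rewrite size_mkseq nth_mkseq//; apply.
(* [P t] says that infinitely many witnesses begin with [t]. The next term takes finitely many
   values, so one of them extends [t]. *)
pose P (t : seq nat) := forall M, exists2 n, (M <= n)%N &
  forall i, (i < size t)%N -> (w n).1 i = nth 0%N t i.
have P0 : P [::] by move=> M; exists M.
have step t : P t -> exists v, P (rcons t v).
  move=> Pt; apply: contrapT => /forallNP h.
  have /choice[M HM] v : exists M, forall n, (M <= n)%N ->
      ~ forall i, (i < size (rcons t v))%N -> (w n).1 i = nth 0%N (rcons t v) i.
    have /existsNP[M hM] := h v; exists M => n Mn hn.
    by apply: hM; exists n.
  pose M0 := maxn (size t).+1 (\max_(v < (b (size t)).+1) M v).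
  have [n Mn hn] := Pt M0; move: Mn; rewrite geq_max => /andP[tn Mn].
  have [_ /(_ _ tn) wb _] := Hw n.
  have vb : ((w n).1 (size t) < (b (size t)).+1)%N by [].
  apply: (HM ((w n).1 (size t)) n).
    apply: leq_trans Mn; exact: (@leq_bigmax _ (fun v : 'I_(b (size t)).+1 => M v) (Ordinal vb)).
  move=> i; rewrite size_rcons ltnS leq_eqVlt nth_rcons => /orP[/eqP ->|it].
    by rewrite ltnn eqxx.
  by rewrite it hn.
have /choice[f Hf] t : exists v, P t -> P (rcons t v).
  by have [/step[v hv]|h] := pselect (P t); [exists v | exists 0%N].
pose s := fix s n := if n is m.+1 then rcons (s m) (f (s m)) else [::].
have Ps n : P (s n) by elim: n => //= n IH; exact: Hf.
have sE n : s n = mkseq (fun i => f (s i)) n by elim: n => //= n IH; rewrite mkseqS -IH.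
exists (fun i => f (s i)); apply: contrapT => /Fcl[N [r [r0 hr]]].
have [n Mn hn] := Ps N (Num.truncn r^-1).
have [Fw _ wx] := Hw n; apply: (hr _ _ _ _ Fw).
  by move=> i iN; rewrite hn sE ?size_mkseq// nth_mkseq.
apply: (lt_le_trans wx); rewrite invf_ple ?posrE//.
by apply: (le_trans (ltW (truncnS_gt _))); rewrite ler_nat ltnS.
Qed.
End souslin_sets.

(** * Configurations *)

Lemma expr_le_linear (R : realDomainType) (x : R) M : 0 <= x <= 1 -> (1 + x) ^+ M <= 1 + (2 ^+ M - 1) * x.
Proof.
move=> /andP[x0 x1]; elim: M => [|M IH]; first by rewrite !expr0; lra.
rewrite [in X in X <= _]exprS; apply: (@le_trans _ _ ((1 + x) * (1 + (2 ^+ M - 1) * x))).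
  by rewrite ler_wpM2l//; lra.
have : 1 <= 2 ^+ M :> R by rewrite exprn_ege1//; lra.
rewrite exprS; move: (2 ^+ M) => u u1.
have : 0 <= (u - 1) * x * (1 - x) by rewrite !mulr_ge0// subr_ge0.
by lra.
Qed.

(** [kappa] is [2 ^ (1 / L)] with [beta = 1 - 1 / L]; Bernoulli's inequality gives
    [2 <= (1 + x) ^+ L], so that [kappa <= 1 + x]. *)
Lemma kappa_exists (R : realType) (M : nat) (eta : R) : 0 < eta <= 1 -> exists beta kappa : R,
  [/\ 0 < beta < 1, 1 <= kappa, kappa / 2 = 2 `^ (- beta) & kappa ^+ M <= 1 + eta].
Proof.
move=> /andP[eta0 eta1]; pose x := eta / 2 ^+ M.
have x0 : 0 < x by rewrite divr_gt0// exprn_gt0.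
have M1 : 1 <= 2 ^+ M :> R by rewrite exprn_ege1//; lra.
have x1 : x <= 1 by rewrite ler_pdivrMr ?exprn_gt0//; lra.
have xM : (1 + x) ^+ M <= 1 + eta.
  have x01 : 0 <= x <= 1 by rewrite ltW.
  apply: (le_trans (expr_le_linear M x01)); rewrite lerD2l.
  have -> : eta = 2 ^+ M * x by rewrite /x; field; rewrite expf_neq0.
  by rewrite ler_wpM2r ?(ltW x0)//; lra.
(* One successor makes [L] exceed [x^-1]; the other one ensures [L >= 2], hence [beta > 0]. *)
pose L := (Num.truncn (x^-1)).+2.
have Lx : 2 <= (1 + x) ^+ L.
  have : 1 + L%:R * x <= (1 + x) ^+ L.
    elim: (L) => [|l IH]; first by rewrite expr0 mul0r addr0.
    rewrite exprS -natr1; apply: (@le_trans _ _ ((1 + x) * (1 + l%:R * x))).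
      have : 0 <= l%:R * x * x by rewrite !mulr_ge0// ltW.
      by move: (l%:R : R) => v ?; lra.
    by rewrite ler_wpM2l//; lra.
  apply: le_trans; rewrite -[leLHS]/(1 + 1) lerD2l.
  rewrite -ler_pdivrMr// mul1r; apply: (le_trans (ltW (truncnS_gt _))).
  by rewrite ler_nat.
have L2 : 2 <= L%:R :> R by rewrite ler_nat.
have L0 : 0 < L%:R :> R by apply: lt_le_trans L2.
pose kappa : R := 2 `^ (L%:R^-1).
have k1 : 1 <= kappa.
  by rewrite -[leLHS](powRr0 2) ler_powR ?invr_ge0//; lra.
have kL : kappa ^+ L = 2 by rewrite -powR_mulrn ?powR_ge0// -powRrM mulVf ?gt_eqF// powRr1.
have kx : kappa <= 1 + x.
  by rewrite -(ler_pXn2r (n := L))// ?nnegrE ?powR_ge0 ?kL//; lra.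
exists (1 - L%:R^-1), kappa; split => //.
- apply/andP; split; last by rewrite ltrBlDr ltrDl invr_gt0.
  by rewrite subr_gt0 invf_lt1//; lra.
- by rewrite opprB powRD ?pnatr_eq0 ?implybT// powR_inv1.
- by apply: le_trans xM; rewrite lerXn2r// nnegrE ?powR_ge0//; lra.
Qed.

Lemma density_gt0_near (R : realType) (s : seq (R * R)) k x : (forall p, p \in s -> 0 <= p.2) ->
  0 < density s k x -> exists2 p, p \in s & `|x - p.1| < (2 ^+ k)^-1.
Proof.
move=> s0 d0; have k0 : 0 < 2 ^+ k :> R by rewrite exprn_gt0.
apply: contrapT => H; move: d0; rewrite /density big_seq big1 ?ltxx// => p ps.
rewrite tent_far ?mulr0// normrM (gtr0_norm k0) leNgt; apply/negP => h.
by apply: H; exists p => //; rewrite -(ltr_pM2l k0) mulfV// gt_eqF.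
Qed.

(** The third point differs from [x] by at most 7/16, and [x] is close to 1/2. *)
Lemma quad_itv (R : realType) (a q x y : R) : 48 <= `|a| <= 96 -> `|q| <= 1 ->
  2^-1 <= x <= 33 / 64 -> 35 / 64 <= y <= 36 / 64 -> 0 <= quad a q x y < 1.
Proof.
move=> /andP[_ a2] q1 /andP[x1 x2] /andP[y1 y2].
have : `|(a * (y - x) + q) * (y - x)| <= 7 * (1 / 16).
  rewrite normrM ler_pM//; last by rewrite ger0_norm; lra.
  apply: (le_trans (ler_normD _ _)); rewrite normrM.
  have h : `|a| * `|y - x| <= 96 * (1 / 16) by rewrite ler_pM// ger0_norm; lra.
  by apply: (le_trans (lerD h q1)); lra.
have -> : (a * (y - x) + q) * (y - x) = a * (y - x) ^+ 2 + q * (y - x) by ring.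
rewrite ler_norml /quad => /andP[h1 h2].
by move: h1 h2; move: (_ + q * (y - x)) => z h1 h2; lra.
Qed.

Section approximate_configuration.
Variables (R : realType) (kappa b : R) (k0 : nat).
Let w : R := kappa ^+ 36.
(** The level of [F (2 * k0)], plus the one that [density_ge] asks for. [eta] is a quarter of the
    length of a cell of level [k1]: missing mass and growth of [kappa] may take a quarter each, and
    half remains. *)
Let k1 := (72 * k0).+1.
Let eta : R := (2 ^+ k1.+2)^-1.
Hypothesis hb : forall k, b ^+ k = 2 ^+ (36 * k).
Hypotheses (kappa1 : 1 <= kappa) (kappa180 : kappa ^+ 180 <= 3 / 2).
Hypotheses (kappak1 : kappa ^+ k1 <= 1 + eta).
Hypothesis k0_large : 6 * step_cst b * (3 / 4) ^+ k0 < 8^-1 ^+ 3.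

Let cell_mass_large n s k (j : nat) : frostman kappa n s -> 1 - eta <= \sum_(p <- s) p.2 ->
  (k <= n)%N -> (k <= k1)%N -> (j < 2 ^ k)%N -> (2 ^+ k.+1)^-1 <= cell_mass s k j%:Z.
Proof.
move=> fr tot kn kk1 jk; apply: le_trans (cell_mass_ge kappa1 fr kn jk).
have kap : kappa ^+ k <= 1 + eta by apply: le_trans kappak1; rewrite ler_weXn2l.
have : (2 ^+ k1.+2)^-1 <= (2 ^+ k.+2)^-1 :> R.
  by rewrite lef_pV2 ?posrE ?exprn_gt0// ler_weXn2l ?ltnS//; lra.
rewrite -/eta => etak.
have e1 : (2 ^+ k.+1)^-1 = (2 ^+ k)^-1 / 2 :> R by rewrite exprSr invfM.
have e2 : (2 ^+ k.+2)^-1 = (2 ^+ k)^-1 / 4 :> R.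
  by rewrite 2!exprSr !invfM -mulrA; congr (_ * _); field.
by rewrite e2 in etak; rewrite e1; lra.
Qed.

Lemma approximate_configuration (A : set R) (a q : R) K : 48 <= `|a| <= 96 -> `|q| <= 1 ->
  (k0 <= K)%N -> A `<=` [set x | 0 <= x < 1] -> ~ content_le (kappa / 2) A (1 - eta) ->
  exists x y, [/\ 2^-1 <= x <= 33 / 64, 35 / 64 <= y <= 36 / 64,
    exists2 p, A p & `|x - p| < (2 ^+ K)^-1,
    exists2 p, A p & `|y - p| < (2 ^+ K)^-1 &
    exists2 p, A p & `|quad a q x y - p| < (2 ^+ K)^-1].
Proof.
move=> ha hq k0K A01 Ac.
have kap0 : 0 < kappa by apply: lt_le_trans kappa1.
(* [72 * K] is the level of the finest density [F (2 * K)]; the extra level makes room for [k1] even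
   if [K = k0]. *)
have [s [fr sA tot]] := frostman_exists kap0 (72 * K).+1 A01 Ac.
have arith k : (k <= 2 * K)%N -> (36 * k <= (72 * K).+1)%N by clear; lia.
have arith2 : (k1 <= (72 * K).+1)%N by rewrite /k1; clear -k0K; lia.
have arith3 : (36 * (2 * k0)).+1 = k1 by rewrite /k1; clear; lia.
have arith4 : ((36 * k0).+1 <= k1)%N by rewrite /k1; clear; lia.
have w1 : 1 <= w by rewrite exprn_ege1.
have w5 : w ^+ 5 <= 3 / 2 by rewrite /w -exprM.
have wk k : w ^+ k = kappa ^+ (36 * k) by rewrite /w exprM.
pose F k := density s (36 * k); pose G k := mollified_cdf s (36 * k).
have Fb k x : (k <= 2 * K)%N -> 0 <= F k x <= 3 * w ^+ k.
  by move=> kK; rewrite wk; apply: (density_bounds fr); exact: arith.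
have Fl k x y : (k <= 2 * K)%N -> `|F k x - F k y| <= 24 * b ^+ k * w ^+ k * `|x - y|.
  by move=> kK; rewrite wk hb; apply: (density_lipschitz fr); exact: arith.
have Gt k x h : (k <= 2 * K)%N -> `|G k (x + h) - G k x - h * F k x| <= 2 * (b ^+ k) ^+ 2 * h ^+ 2.
  by move=> kK; rewrite hb; apply: (mollified_cdf_taylor fr).
have Gd k k' x : (k <= k' <= 2 * K)%N -> `|G k' x - G k x| <= 3 * (w / b) ^+ k.
  move=> /andP[kk' k'K]; rewrite expr_div_n wk hb -expr_div_n; apply: (mollified_cdf_dist fr).
  by rewrite arith// leq_mul2l kk'.
have [n nE] : exists n, n = (2 ^ (180 * K))%N by eexists.
pose e : R := (64 * n%:R)^-1.
have n0 : (0 < n)%N by rewrite nE expn_gt0.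
have xI i : (i < n)%N -> 2^-1 <= xpt e i <= 33 / 64.
  move=> hi; have := lattice_lt1 R n0 (ltnW hi); rewrite -/e /xpt.
  by move: (e * i%:R) => z /andP[z0 z1]; lra.
have yI j : (j < n)%N -> 35 / 64 <= ypt e j <= 36 / 64.
  move=> hi; have := lattice_lt1 R n0 (ltnW hi); rewrite -/e /ypt.
  by move: (e * j%:R) => z /andP[z0 z1]; lra.
have large k x : ((36 * k).+1 <= k1)%N -> 0 <= x < 1 -> 8^-1 <= F k x.
  move=> kk1 x01; have kn := leq_trans kk1 arith2.
  by apply: (density_ge fr) => // j jk; exact: (cell_mass_large fr tot).
have base : 8^-1 ^+ 3 * n%:R ^+ 2 <= diagonal_form a q F n k0.
  rewrite /diagonal_form /trilinear -/e.
  have -> : 8^-1 ^+ 3 * n%:R ^+ 2 = \sum_(i < n) \sum_(j < n) 8^-1 * 8^-1 * 8^-1 :> R.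
    by rewrite !sumr_const !card_ord -mulrnA -[RHS]mulr_natl natrM; ring.
  apply: ler_sum => i _; apply: ler_sum => j _.
  have /andP[i0 i1] := xI i (ltn_ord i); have /andP[j0 j1] := yI j (ltn_ord j).
  have f1 : 8^-1 <= F (2 * k0)%N (xpt e i) by apply: large; [rewrite arith3|lra].
  have f2 : 8^-1 <= F (2 * k0)%N (ypt e j) by apply: large; [rewrite arith3|lra].
  have f3 : 8^-1 <= F k0 (quad a q (xpt e i) (ypt e j)).
    by apply: large => //; apply: quad_itv => //; [exact: xI|exact: yI].
  by rewrite ler_pM// ?mulr_ge0// ler_pM.
have := diagonal_form_ge (c := 8^-1 ^+ 3) ha hq hb w1 Fb Fl Gt Gd k0K (leqnn _) w5.
rewrite -nE => /(_ base) SK.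
have Spos : 0 < diagonal_form a q F n K.
  by apply: lt_le_trans SK; rewrite mulr_gt0 ?subr_gt0// exprn_gt0// ltr0n.
have [i [j [i_n [j_n T0]]]] : exists i j, [/\ (i < n)%N, (j < n)%N &
    0 < F (2 * K)%N (xpt e i) * F (2 * K)%N (ypt e j) * F K (quad a q (xpt e i) (ypt e j))].
  apply: contrapT => H; move: Spos; rewrite ltNge => /negP; apply.
  rewrite /diagonal_form /trilinear -/e; apply: sumr_le0 => i _; apply: sumr_le0 => j _.
  by rewrite leNgt; apply/negP => T0; apply: H; exists i, j.
have K2 : (K <= 2 * K)%N by clear; lia.
have /andP[g1 _] := Fb _ (xpt e i) (leqnn (2 * K)).
have /andP[g2 _] := Fb _ (ypt e j) (leqnn (2 * K)).
have /andP[g3 _] := Fb _ (quad a q (xpt e i) (ypt e j)) K2.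
have gpos (u v z : R) : 0 <= u -> 0 <= v -> 0 <= z -> 0 < u * v * z -> [/\ 0 < u, 0 < v & 0 < z].
  move=> u0 v0 z0; rewrite !lt0r !mulf_eq0 !negb_or u0 v0 z0 !andbT.
  by move=> /andP[/andP[/andP[-> ->] ->]].
have [p1 p2 p3] := gpos _ _ _ g1 g2 g3 T0.
have s0 p : p \in s -> 0 <= p.2 by case: fr => h _ /h[].
have close k x : (K <= k)%N -> 0 < F k x -> exists2 p, A p & `|x - p| < (2 ^+ K)^-1.
  move=> Kk /(density_gt0_near s0)[p ps xp]; exists p.1; first exact: sA.
  apply: (lt_le_trans xp); rewrite lef_pV2 ?posrE ?exprn_gt0//.
  by rewrite ler_weXn2l//; [lra | clear -Kk; lia].
exists (xpt e i), (ypt e j); split.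
- exact: xI.
- exact: yI.
- exact: close K2 p1.
- exact: close K2 p2.
- exact: close (leqnn K) p3.
Qed.
End approximate_configuration.

Lemma cluster_pair (R : realType) (u v : nat -> R) (a b c d : R) :
  (forall n, a <= u n <= b) -> (forall n, c <= v n <= d) ->
  exists x y, [/\ a <= x <= b, c <= y <= d & forall n e, 0 < e ->
    exists2 k, (n <= k)%N & `|u k - x| < e /\ `|v k - y| < e].
Proof.
move=> uab vcd.
have cpt := compact_setX (@segment_compact R a b) (@segment_compact R c d).
pose F : set_system (R * R) := (fun n => (u n, v n)) @ \oo.
have FA : F (`[a, b] `*` `[c, d]).
  by exists 0%N => // n _; split; rewrite /= in_itv /=.
have [[x y] [[/= xab ycd] clF]] := cpt F _ FA.
rewrite !in_itv /= in xab ycd; exists x, y; split => // n e e0.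
have F1 : F [set p | exists2 k, (n <= k)%N & p = (u k, v k)].
  by exists n => // k nk; exists k.
have N1 : nbhs (x, y) (ball x e `*` ball y e).
  by exists (ball x e, ball y e) => //=; split; exact: nbhsx_ballx.
have [_ [[k nk ->] [/= h1 h2]]] := clF _ _ F1 N1.
by exists k => //; rewrite distrC; split => //; rewrite distrC.
Qed.

Lemma quad_dist (R : realType) (a q x y x' y' : R) : `|a| <= 96 -> `|q| <= 1 ->
  `|y - x| <= 1 -> `|y' - x'| <= 1 ->
  `|quad a q x y - quad a q x' y'| <= 200 * (`|x - x'| + `|y - y'|).
Proof.
move=> a96 q1 d1 d2.
have -> : quad a q x y - quad a q x' y' =
  (x - x') + (a * ((y - x) + (y' - x')) + q) * ((y - y') - (x - x')) by rewrite /quad; ring.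
have h1 : `|(y - x) + (y' - x')| <= 2 by rewrite (le_trans (ler_normD _ _))//; lra.
have h2 : `|a * ((y - x) + (y' - x')) + q| <= 96 * 2 + 1.
  by rewrite (le_trans (ler_normD _ _))// lerD// normrM ler_pM.
have h3 := ler_normB (y - y') (x - x').
rewrite (le_trans (ler_normD _ _))// normrM.
have h4 := ler_pM (normr_ge0 _) (normr_ge0 _) h2 h3.
have := normr_ge0 (x - x'); have := normr_ge0 (y - y').
by move: h4; move: (_ * _) `|x - x'| `|y - y'| => z s t; lra.
Qed.

Lemma closed_rel_affine (R : realType) (F : (nat -> nat) -> set R) (c d : R) : 0 < c -> closed_rel F ->
  closed_rel (fun sigma => [set x | F sigma ((x + d) / c)]).
Proof.
move=> c0 Fcl sigma x /Fcl[n [r [r0 H]]]; exists n, (r * c); split; first exact: mulr_gt0.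
move=> s' y agree yx; apply: H => //.
rewrite -mulrBl opprD addrACA subrr addr0 normrM normfV (gtr0_norm c0).
by rewrite ltr_pdivrMr.
Qed.

Section limit_configuration.
Variables (R : realType) (kappa b : R) (k0 : nat).
Let eta : R := (2 ^+ (72 * k0).+3)^-1.
Hypothesis hb : forall k, b ^+ k = 2 ^+ (36 * k).
Hypotheses (kappa1 : 1 <= kappa) (kappa180 : kappa ^+ 180 <= 3 / 2).
Hypotheses (kappak1 : kappa ^+ (72 * k0).+1 <= 1 + eta).
Hypothesis k0_large : 6 * step_cst b * (3 / 4) ^+ k0 < 8^-1 ^+ 3.

Lemma limit_configuration (F : (nat -> nat) -> set R) (a q c : R) : closed_rel F ->
  1 - eta < c ->
  ~ content_le (kappa / 2) ([set x | 0 <= x < 1] `&` [set x | exists sigma, F sigma x]) c ->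
  48 <= `|a| <= 96 -> `|q| <= 1 ->
  exists x y, [/\ x < y, exists sigma, F sigma x, exists sigma, F sigma y &
    exists sigma, F sigma (quad a q x y)].
Proof.
move=> Fcl cl nsmall ha hq.
have [B HB] := bounded_part_content cl nsmall.
pose A n := bounded_part F (mkseq B n) [set x | 0 <= x < 1].
have A01 n : A n `<=` [set x | 0 <= x < 1] by move=> x [].
pose good n (p : R * R) := [/\ 2^-1 <= p.1 <= 33 / 64, 35 / 64 <= p.2 <= 36 / 64,
    exists2 z, A n z & `|p.1 - z| < (2 ^+ n)^-1,
    exists2 z, A n z & `|p.2 - z| < (2 ^+ n)^-1 &
    exists2 z, A n z & `|quad a q p.1 p.2 - z| < (2 ^+ n)^-1].
(* The index is shifted by [k0] because approximate configurations are available from level [k0]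
   on. *)
have /choice[p Hp] n : exists p, good (n + k0)%N p.
  have [x [y [h1 h2 h3 h4 h5]]] := approximate_configuration hb kappa1 kappa180 kappak1
    k0_large ha hq (leq_addl n k0) (A01 (n + k0)%N) (HB (n + k0)%N).
  by exists (x, y).
have p1 n : 2^-1 <= (p n).1 <= 33 / 64 by case: (Hp n).
have p2 n : 35 / 64 <= (p n).2 <= 36 / 64 by case: (Hp n).
have [x [y [hx hy hxy]]] := cluster_pair p1 p2.
have small (e : R) : 0 < e -> exists N, forall n, (N <= n)%N -> (2 ^+ n)^-1 < e.
  move=> e0; have : (fun n => (2^-1 : R) ^+ n) @ \oo --> (0 : R).
    by apply: cvg_expr; rewrite ger0_norm ?invr_ge0//; lra.
  move=> /cvgrPdist_lt /(_ _ e0)[N _ HN]; exists N => n Nn.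
  have := HN n Nn => /=; rewrite sub0r normrN ger0_norm ?exprn_ge0 ?invr_ge0//.
  by rewrite exprVn.
have lim (f : R * R -> R) z : (forall n, exists2 w, A (n + k0)%N w & `|f (p n) - w| < (2 ^+ (n + k0))^-1) ->
    (forall n (e : R), 0 < e -> exists2 k, (n <= k)%N & `|f (p k) - z| < e) ->
    exists sigma, F sigma z.
  move=> Hf Hz; apply: (@bounded_part_limit R F [set x | 0 <= x < 1] B z Fcl) => n e e0.
  have e20 : 0 < e / 2 by rewrite divr_gt0.
  have [N HN] := small _ e20.
  have [k nk fz] := Hz (maxn n N) _ e20; rewrite geq_max in nk; case/andP: nk => nk Nk.
  have [w Aw fw] := Hf k; exists w.
    by apply: bounded_part_antitone Aw; apply: (leq_trans nk); exact: leq_addr.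
  have := HN (k + k0)%N (leq_trans Nk (leq_addr _ _)) => h.
  have -> : w - z = (f (p k) - z) - (f (p k) - w) by ring.
  by rewrite (le_lt_trans (ler_normB _ _))//; move: fz fw h; lra.
exists x, y; split.
(* The gap between 33/64 and 35/64 survives in the limit and keeps the configuration from
   collapsing. *)
- by move: hx hy => /andP[_ ?] /andP[? _]; lra.
- apply: (lim fst); first by move=> n; case: (Hp n).
  by move=> n e e0; have [k nk [h _]] := hxy n e e0; exists k.
- apply: (lim snd); first by move=> n; case: (Hp n).
  by move=> n e e0; have [k nk [_ h]] := hxy n e e0; exists k.
- apply: (lim (fun z => quad a q z.1 z.2)); first by move=> n; case: (Hp n).
  move=> n e e0; have e4 : 0 < e / 400 by lra.
  have [k nk [h1 h2]] := hxy n _ e4; exists k => //.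
  have /andP[_ a96] := ha.
  apply: (le_lt_trans (quad_dist a96 hq _ _)).
  + by have := p1 k; have := p2 k; rewrite ler_norml; lra.
  + by rewrite ler_norml; lra.
  + by move: h1 h2; move: `|_ - x| `|_ - y| => s t; lra.
Qed.
End limit_configuration.

Theorem theorem1p2 (R : realType) (q0 : R) (hq0 : 0 <= q0 < 1) :
  exists beta : R, 0 < beta < 1 /\
    forall E : set R, measurable E -> (beta%:E < hausdorff_dim E)%E ->
      exists a0 a1 : R, 0 < a0 < a1 /\
        forall a q : R, a0 <= `|a| <= a1 -> `|q| <= q0 ->
          exists x t : R, t != 0 /\
            [set x; x + t; x + a * t ^+ 2 + q * t] `<=` E.
Proof.
have [b hb] : exists b : R, forall k, b ^+ k = 2 ^+ (36 * k).
  by exists (2 ^+ 36) => k; rewrite exprM.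
have [k0 hk0] : exists k0, 6 * step_cst b * (3 / 4) ^+ k0 < 8^-1 ^+ 3.
  have c0 : 0 < 8^-1 ^+ 3 :> R by rewrite exprn_gt0.
  have : (fun n => 6 * step_cst b * (3 / 4) ^+ n) @ \oo --> (0 : R).
    rewrite -[X in _ --> X](mulr0 (6 * step_cst b)); apply: cvgMr.
    by apply: cvg_expr; rewrite ger0_norm; lra.
  move=> /cvgrPdist_lt /(_ _ c0)[N _ HN]; exists N.
  have := HN N (leqnn N) => /=; rewrite sub0r normrN; apply: le_lt_trans; exact: ler_norm.
pose eta : R := (2 ^+ (72 * k0).+3)^-1.
have eta0 : 0 < eta by rewrite invr_gt0 exprn_gt0.
have eta2 : eta <= 1 / 2.
  rewrite /eta exprS invfM mul1r ler_piMr ?invr_ge0// invf_le1 ?exprn_gt0// exprn_ege1//.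
  by lra.
have eta1 : 0 < eta <= 1 by rewrite eta0; lra.
have [beta [kappa [beta01 kappa1 kappaE kappaM]]] := kappa_exists (maxn 180 (72 * k0).+1) eta1.
have kappa180 : kappa ^+ 180 <= 3 / 2.
  apply: (@le_trans _ _ (kappa ^+ maxn 180 (72 * k0).+1)); first by rewrite ler_weXn2l// leq_maxl.
  by apply: (le_trans kappaM); lra.
have kappak1 : kappa ^+ (72 * k0).+1 <= 1 + eta.
  by apply: le_trans kappaM; rewrite ler_weXn2l// leq_maxr.
exists beta; split => // E mE dimE.
have /andP[beta0 beta1] := beta01.
have tau0 : 0 < kappa / 2 by rewrite divr_gt0// (lt_le_trans ltr01).
(* Otherwise every zoom has a content deficit, the beta-dimensional measure vanishes and the
   dimension is at most [beta]. The gap between [eta / 2] and [eta] is the margin spent in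
   [bounded_part_content]. *)
have [m [j Hmj]] : exists m j, ~ content_le (kappa / 2) (zoom E m j) (1 - eta / 2).
  apply: contrapT => H; move: dimE; rewrite ltNge => /negP; apply.
  apply: ereal_inf_lbound; exists beta => //; split; first exact: ltW.
  apply: hausdorff_measure_null; first exact: ltW.
  move=> e r0 e0; rewrite -kappaE; apply: (@content_null_cover _ _ tau0 E (1 - eta / 2)) => //.
    by lra.
  move=> m j; apply: contrapT => h; apply: H; exists m, j; exact: h.
have m0 : 0 < 2 ^+ m :> R by rewrite exprn_gt0.
have [F [Fcl EF]] := measurable_souslin mE.
pose F' sigma := [set x | F sigma ((x + j%:~R) / 2 ^+ m)].
have F'cl : closed_rel F' by exact: closed_rel_affine.
have etac : 1 - eta < 1 - eta / 2 by lra.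
have inE z : (exists sigma, F' sigma z) -> E ((z + j%:~R) / 2 ^+ m).
  by rewrite EF.
have Hc : ~ content_le (kappa / 2) ([set x | 0 <= x < 1] `&` [set x | exists sigma, F' sigma x]) (1 - eta / 2).
  move=> h; apply: Hmj; apply: content_le_sub h => x [x01].
  by rewrite EF => Ex; split.
(* For [t = s / 2 ^+ m] the increment [a * t ^+ 2 + q * t] is [2 ^- m] times
   [(a / 2 ^+ m) * s ^+ 2 + q * s]: the zoom rescales [a] and leaves [q] unchanged. *)
exists (48 * 2 ^+ m), (96 * 2 ^+ m); split.
  by rewrite mulr_gt0//= ltr_pM2r//; lra.
move=> a q /andP[a1 a2] hq.
have ha : 48 <= `|a / 2 ^+ m| <= 96.
  by rewrite normrM normfV (gtr0_norm m0) ler_pdivlMr// ler_pdivrMr// a1.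
have hq1 : `|q| <= 1 by apply: (le_trans hq); case/andP: hq0 => _ /ltW.
have [x [y [xy Ex Ey Ez]]] := limit_configuration hb kappa1 kappa180 kappak1 hk0 F'cl etac Hc ha hq1.
exists ((x + j%:~R) / 2 ^+ m), ((y - x) / 2 ^+ m); split.
  by rewrite mulf_neq0 ?invr_eq0 ?gt_eqF// subr_gt0.
have mn : 2 ^+ m != 0 :> R by rewrite gt_eqF.
move=> z [[->|->]|->].
- exact: inE.
- have -> : (x + j%:~R) / 2 ^+ m + (y - x) / 2 ^+ m = (y + j%:~R) / 2 ^+ m by field.
  exact: inE.
- have -> : (x + j%:~R) / 2 ^+ m + a * ((y - x) / 2 ^+ m) ^+ 2 + q * ((y - x) / 2 ^+ m) =
    (quad (a / 2 ^+ m) q x y + j%:~R) / 2 ^+ m by rewrite /quad; field.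
  exact: inE.
Qed.
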